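(* Let $A$ be a closed linear unbounded operator in $H$ with dense domain $D(A)$ equipped with the graph norm $|\cdot|_{D(A)}$, and let $a\in L^1_{\mathrm{loc}}(\mathbb{R}_+;\mathbb{R})$. Suppose that one of the following holds: (I) $A$ is the generator of a $C_0$-semigroup in $H$ and $a$ is completely positive; or (II) $A$ is the generator of a strongly continuous cosine family in $H$ and at least one of the following holds: (i) $a$ is completely positive; (ii) $a$ is a creep function with $a_1$ log-convex; (iii) $a=c\star c$ for some completely positive $c\in L^1_{\mathrm{loc}}(\mathbb{R}_+)$. Let $S(t)$, $t\ge 0$, be the resolvent for the pair $(A,a)$, and let $W^{\Psi}(t)=\sum_{i=1}^{\infty}\int_0^t S(t-\tau)\Psi_i(\tau)\,dW_i(\tau)$, $t\in[0,T]$. If $\Psi=(\Psi_i)_{i=1}^\infty$ and $A\Psi=(A\Psi_i)_{i=1}^\infty$ belong to $\mathcal{PUC}([0,T];L^2(\Omega;H))$ and, for every $i\in\mathbb{N}$ and every $t\in[0,T]$, $\Psi_i(t)\in D(A)$ $P$-a.s., then for every $t\in[0,T]$ $$W^{\Psi}(t)=\int_0^t a(t-\tau)\,AW^{\Psi}(\tau)\,d\tau+\sum_{i=1}^{\infty}\int_0^t\Psi_i(\tau)\,dW_i(\tau),\quad P\text{-a.s.}$$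
   Context: $(H,|\cdot|_H)$ is a separable Hilbert space, $(\Omega,\mathcal{F},(\mathcal{F}_t)_{t\ge0},P)$ is a filtered probability space, $T>0$ is fixed, and $(W_i)_{i=1}^\infty$ is a sequence of independent standard scalar Wiener processes with respect to $(\mathcal{F}_t)_{t\ge 0}$. The graph norm is $|h|_{D(A)}=(|h|_H^2+|Ah|_H^2)^{1/2}$. A function $f:[0,T]\to L^2(\Omega;H)$ is piecewise uniformly continuous (PUC) if there are $0=a_0<a_1<\dots<a_n=T$ such that $f$ is uniformly continuous on each $(a_{k-1},a_k)$. $\mathcal{PUC}([0,T];L^2(\Omega;H))$ is the space of sequences $\Psi=(\Psi_i)_{i=1}^\infty$ of PUC functions $\Psi_i:[0,T]\to L^2(\Omega;H)$, adapted to $(\mathcal{F}_t)$, with $\int_0^T\sum_{i=1}^\infty \mathbb{E}|\Psi_i(\tau)|_H^2\,d\tau<\infty$. For adapted PUC $\Psi_i$, $\int_0^T\Psi_i\,dW_i$ is the $L^2(\Omega;H)$-limit of the Riemann sums $\sum_k\Psi_i(\tau_{k-1})(W_i(\tau_k)-W_i(\tau_{k-1}))$; for $\Psi\in\mathcal{PUC}([0,T];L^2(\Omega;H))$ the series $\sum_{i=1}^\infty\int_0^T\Psi_i\,dW_i$ converges in $L^2(\Omega;H)$. A function $a\in L^1(0,T)$ is completely positive on $[0,T]$ if for every $\mu\ge0$ the solutions $s,r$ of $s(t)+\mu\int_0^t a(t-\tau)s(\tau)d\tau=1$ and $r(t)+\mu\int_0^t a(t-\tau)r(\tau)d\tau=a(t)$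 are nonnegative on $[0,T]$; a function in $L^1_{\mathrm{loc}}(\mathbb{R}_+)$ is completely positive if this holds on $[0,T]$ for every $T>0$. A creep function is a nonnegative, nondecreasing, concave function $a$ on $(0,\infty)$; it has the form $a(t)=a_0+a_\infty t+\int_0^t a_1(s)\,ds$ with $a_0=a(0+)$, $a_\infty=\lim_{t\to\infty}a(t)/t$, $a_1(t)=\dot a(t)-a_\infty$. $\star$ denotes convolution, $(c\star c)(t)=\int_0^t c(t-s)c(s)\,ds$. A resolvent for $(A,a)$ is a family $(S(t))_{t\ge0}$ of bounded linear operators in $H$ such that: $S$ is strongly continuous on $\mathbb{R}_+$ with $S(0)=I$; $S(t)(D(A))\subset D(A)$ and $AS(t)x=S(t)Ax$ for $x\in D(A)$, $t\ge0$; and $S(t)x=x+\int_0^t a(t-\tau)AS(\tau)x\,d\tau$ for $x\in D(A)$, $t\ge0$. It is known that under either (I) or (II) such a resolvent exists (and is exponentially bounded). *)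

(* Defs.v *)
From HB Require Import structures.
From mathcomp Require Import all_boot all_order all_algebra.
From mathcomp Require Import all_classical all_reals all_analysis measurable_realfun.

Set Implicit Arguments.
Unset Strict Implicit.
Unset Printing Implicit Defensive.

Import Order.TTheory GRing.Theory Num.Theory.
Import numFieldNormedType.Exports.

Local Open Scope classical_set_scope.
Local Open Scope ring_scope.

Section Hilbert.
Context {R : realType} (H : completeNormedModType R).

Definition hilbert_space : Prop :=
  exists ip : H -> H -> R,
    [/\ forall x y, ip x y = ip y x,
        forall (k : R) x y z, ip (k *: x + y) z = k * ip x z + ip y z
      & forall x, ip x x = `|x| ^+ 2].

Definition separable : Prop := exists2 Q : set H, countable Q & dense Q.

End Hilbert.

Section Operators.
Context {R : realType} {H : normedModType R}.

Definition bounded_operator (B : H -> H) : Prop :=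
  (forall (k : R) x y, B (k *: x + y) = k *: B x + B y) /\
  exists M : R, forall x, `|B x| <= M * `|x|.

(* A partially defined operator is a domain D together with a total function A
   whose values outside D are never used. *)
Definition linear_on (D : set H) (A : H -> H) : Prop :=
  D 0 /\
  forall (k : R) x y, D x -> D y ->
    D (k *: x + y) /\ A (k *: x + y) = k *: A x + A y.

Definition closed_operator (D : set H) (A : H -> H) : Prop :=
  closed [set p : H * H | D p.1 /\ p.2 = A p.1].

Definition unbounded_operator (D : set H) (A : H -> H) : Prop :=
  ~ exists M : R, forall x, D x -> `|A x| <= M * `|x|.

(* Only the values U t with 0 <= t matter. *)
Definition C0_semigroup (U : R -> H -> H) : Prop :=
  [/\ forall t, 0 <= t -> bounded_operator (U t),
      forall x, U 0 x = x,
      forall s t x, 0 <= s -> 0 <= t -> U (s + t) x = U s (U t x)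
    & forall x, U t x @[t --> 0^'+] --> x].

Definition semigroup_generator (D : set H) (A : H -> H) (U : R -> H -> H)
    : Prop :=
  forall x,
    (D x <-> exists y : H, h^-1 *: (U h x - x) @[h --> 0^'+] --> y) /\
    (D x -> h^-1 *: (U h x - x) @[h --> 0^'+] --> A x).

Definition generates_C0_semigroup (D : set H) (A : H -> H) : Prop :=
  exists U, C0_semigroup U /\ semigroup_generator D A U.

Definition cosine_family (C : R -> H -> H) : Prop :=
  [/\ forall t, bounded_operator (C t),
      forall x, C 0 x = x,
      forall s t x, C (t + s) x + C (t - s) x = 2 *: C t (C s x)
    & forall x, continuous (fun t : R => C t x)].

Definition C2 (u : R^o -> H) : Prop :=
  [/\ forall t, derivable u t 1, forall t, derivable (derive1 u) t 1
    & continuous (derive1n 2 u)].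

Definition cosine_generator (D : set H) (A : H -> H) (C : R -> H -> H)
    : Prop :=
  forall x,
    (D x <-> C2 (fun t => C t x)) /\
    (D x -> derive1n 2 (fun t : R^o => C t x) 0 = A x).

Definition generates_cosine_family (D : set H) (A : H -> H) : Prop :=
  exists C, cosine_family C /\ cosine_generator D A C.

End Operators.

Section Kernels.
Context {R : realType}.
Implicit Types a c k g : R -> R.
Local Notation mu := (@lebesgue_measure R).

Definition L1_on (T : R) (a : R -> R) : Prop :=
  mu.-integrable `[0, T] (EFin \o a).

Definition L1_loc (a : R -> R) : Prop := forall T, 0 < T -> L1_on T a.

Definition convolution a c (t : R) : R :=
  \int[mu]_(s in `[0, t]) (a (t - s) * c s).

(* s + m (k * s) = g in L^1(0,T), so the equation holds almost everywhere. *)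
Definition volterra_solution (T m : R) k g (s : R -> R) : Prop :=
  L1_on T s /\
  {ae mu, forall t : R, 0 <= t <= T -> s t + m * convolution k s t = g t}.

(* The two equations are uniquely solvable in L^1(0,T), so quantifying over all
   solutions is the same as speaking of "the" solution. *)
Definition completely_positive_on (T : R) a : Prop :=
  L1_on T a /\
  forall m, 0 <= m ->
    (forall s, volterra_solution T m a (cst 1) s ->
       {ae mu, forall t : R, 0 <= t <= T -> 0 <= s t}) /\
    (forall r, volterra_solution T m a a r ->
       {ae mu, forall t : R, 0 <= t <= T -> 0 <= r t}).

Definition completely_positive a : Prop :=
  forall T, 0 < T -> completely_positive_on T a.

Definition creep_function a : Prop :=
  [/\ forall t, 0 < t -> 0 <= a t,
      forall s t : R, 0 < s -> s <= t -> a s <= a t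
    & convex_function (`]0, +oo[ : set R^o) (fun t => - a t)].

(* Multiplicative form of the convexity of ln a, which also admits a = 0. *)
Definition log_convex a : Prop :=
  (forall t, 0 < t -> 0 <= a t) /\
  forall x y l : R, 0 < x -> 0 < y -> 0 < l < 1 ->
    a (l * x + (1 - l) * y) <= a x `^ l * a y `^ (1 - l).

(* A concave function is differentiable almost everywhere, which determines a1
   as an element of L^1_loc. *)
Definition creep_log_convex a : Prop :=
  creep_function a /\
  exists (a1 : R -> R) (ainf : R),
    [/\ a t / t @[t --> +oo] --> ainf,
        {ae mu, forall t : R, 0 < t -> is_derive (t : R^o) 1 a (ainf + a1 t)}
      & log_convex a1].

Definition square_of_completely_positive a : Prop :=
  exists c, [/\ L1_loc c, completely_positive c
    & {ae mu, forall t : R, 0 < t -> a t = convolution c c t}].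

End Kernels.

(* Bochner integral over a set D of finite Lebesgue measure of a function with
   values in the seminormed space (M, N), where M is a subspace of V.  It is the
   usual limit of integrals of simple functions; the family of approximations is
   indexed by the tolerance eps instead of by a sequence. *)
Definition is_bochner_integral {R : realType} {V : lmodType R}
    (M : set V) (N : V -> \bar R) (D : set R) (f : R -> V) (v : V) : Prop :=
  [/\ forall tau, D tau -> M (f tau), M v
    & forall eps : R, 0 < eps ->
      exists (n : nat) (E : 'I_n -> set R) (x : 'I_n -> V),
        let err := fun tau => N (f tau - \sum_(j < n) \1_(E j) tau *: x j) in
        [/\ forall j, [/\ measurable (E j), E j `<=` D & M (x j)],
            measurable_fun D err,
            (\int[@lebesgue_measure R]_(tau in D) err tau < eps%:E)%E
          & (N (v - \sum_(j < n) fine (@lebesgue_measure R (E j)) *: x j)%R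
             < eps%:E)%E]].

Section Resolvent.
Context {R : realType} {H : normedModType R}.

Definition bochner_H (D : set R) (f : R -> H) (v : H) : Prop :=
  is_bochner_integral setT (fun x : H => `|x|%:E) D f v.

Definition resolvent (D : set H) (A : H -> H) (a : R -> R) (S : R -> H -> H)
    : Prop :=
  [/\ forall t, 0 <= t -> bounded_operator (S t),
      (forall x, {within `[0, +oo[, continuous (fun t : R => S t x)}) /\
      (forall x, S 0 x = x),
      forall t x, 0 <= t -> D x -> D (S t x) /\ A (S t x) = S t (A x)
    & forall t x, 0 <= t -> D x ->
        bochner_H `[0, t] (fun tau => a (t - tau) *: A (S tau x)) (S t x - x)].

End Resolvent.

Section Probability.
Context {d : measure_display} {Omega : measurableType d} {R : realType}.
Variable P : probability Omega R.

Definition filtration (F : R -> set (set Omega)) : Prop :=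
  [/\ forall t, 0 <= t -> sigma_algebra setT (F t),
      forall t, 0 <= t -> F t `<=` measurable
    & forall s t, 0 <= s -> s <= t -> F s `<=` F t].

Definition wiener_process (F : R -> set (set Omega)) (B : R -> Omega -> R)
    : Prop :=
  [/\ {ae P, forall w, B 0 w = 0},
      forall t (C : set R), 0 <= t -> measurable C -> F t (B t @^-1` C),
      forall s t (C : set R), 0 <= s -> s < t -> measurable C ->
        P ((B t \- B s) @^-1` C) = normal_prob 0 (Num.sqrt (t - s)) C,
      forall s t (E : set Omega) (C : set R),
        0 <= s -> s < t -> F s E -> measurable C ->
        P (E `&` (B t \- B s) @^-1` C) = (P E * P ((B t \- B s)%R @^-1` C))%E
    & {ae P, forall w, {within `[0, +oo[, continuous (fun t : R => B t w)}}].

Definition process_sigma (B : R -> Omega -> R) : set (set Omega) :=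
  <<s [set E | exists t (C : set R),
         [/\ 0 <= t, measurable C & E = B t @^-1` C]] >>.

Definition independent_processes (W : nat -> R -> Omega -> R) : Prop :=
  forall (J : seq nat) (E : nat -> set Omega), uniq J ->
    (forall j, j \in J -> process_sigma (W j) (E j)) ->
    P (\bigcap_(j in [set` J]) E j) = (\prod_(j <- J) P (E j))%E.

Section Hvalued.
Context {H : normedModType R}.
Implicit Types (X I : Omega -> H) (f : R -> Omega -> H).

Definition L2norm X : \bar R := ('N[P]_2%:E[(fun w => `|X w|%R%:E)])%E.

Definition borel_measurable (G : set (set Omega)) X : Prop :=
  forall B : set H, <<s (@open H)>> B -> G (X @^-1` B).

(* Elements of L^2(Omega, G, P; H) are classes modulo P-a.s. equality: X stands
   for such a class as soon as some version of X is G-measurable and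
   square-integrable.  In particular A(Psi(t)) makes sense although A is
   arbitrary on the null set where Psi(t) is outside D(A). *)
Definition L2 (G : set (set Omega)) : set (Omega -> H) :=
  [set X | exists Y, [/\ borel_measurable G Y, (L2norm Y < +oo)%E
                       & {ae P, forall w, X w = Y w}]].

Definition bochner_L2 (D : set R) f X : Prop :=
  is_bochner_integral (L2 (@measurable d Omega)) L2norm D f X.

(* The division points of a partition s of [0, T] are those of 0 :: s; its k-th
   interval goes from (0 :: s)`_k to s`_k. *)
Definition adapted_PUC (F : R -> set (set Omega)) (T : R) f : Prop :=
  (forall t, 0 <= t <= T -> L2 (F t) (f t)) /\
  exists s : seq R, itv_partition 0 T s /\
    forall k, (k < size s)%N -> forall eps : R, 0 < eps ->
      exists2 delta : R, 0 < delta &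
        forall x y, (0 :: s)`_k < x < s`_k -> (0 :: s)`_k < y < s`_k ->
          `|x - y| < delta -> (L2norm (f x \- f y)%R < eps%:E)%E.

Definition PUC_space (F : R -> set (set Omega)) (T : R)
    (Psi : nat -> R -> Omega -> H) : Prop :=
  (forall i, adapted_PUC F T (Psi i)) /\
  (\int[@lebesgue_measure R]_(tau in `[0%R, T])
     \sum_(0 <= i <oo) \int[P]_w (`|Psi i tau w| ^+ 2)%R%:E < +oo)%E.

Definition riemann_sum (B : R -> Omega -> R) f (s : seq R) : Omega -> H :=
  fun w => \sum_(k < size s)
    (B s`_k w - B (0 :: s)`_k w) *: f (0 :: s)`_k w.

Definition is_stoch_integral (B : R -> Omega -> R) f (t : R) I : Prop :=
  L2 (@measurable d Omega) I /\
  forall eps : R, 0 < eps -> exists2 delta : R, 0 < delta &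
    forall s : seq R, itv_partition 0 t s ->
      (forall k, (k < size s)%N -> s`_k - (0 :: s)`_k < delta) ->
      (L2norm (riemann_sum B f s \- I)%R < eps%:E)%E.

Definition is_stoch_series (W : nat -> R -> Omega -> R)
    (Phi : nat -> R -> Omega -> H) (t : R) X : Prop :=
  L2 (@measurable d Omega) X /\
  exists I : nat -> Omega -> H,
    (forall i, is_stoch_integral (W i) (Phi i) t (I i)) /\
    L2norm (fun w => \sum_(i < n) I i w - X w) @[n --> \oo] --> 0%E.

(* WPsi t is a version of sum_i int_0^t S(t - tau) Psi_i(tau) dW_i(tau) for
   every t in [0, T]. *)
Definition is_stoch_convolution (W : nat -> R -> Omega -> R)
    (S : R -> H -> H) (Psi : nat -> R -> Omega -> H) (T : R)
    (WPsi : R -> Omega -> H) : Prop :=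
  forall t, 0 <= t <= T ->
    is_stoch_series W (fun i tau w => S (t - tau) (Psi i tau w)) t (WPsi t).

End Hvalued.
End Probability.

(* Main.v *)
Require Import Defs.
From HB Require Import structures.
From mathcomp Require Import all_boot all_order all_algebra.
From mathcomp Require Import all_classical all_reals all_analysis measurable_realfun.
From mathcomp Require Import ring lra.

Set Implicit Arguments.
Unset Strict Implicit.
Unset Printing Implicit Defensive.

Import Order.TTheory GRing.Theory Num.Theory.
Import numFieldNormedType.Exports.

Local Open Scope classical_set_scope.
Local Open Scope ring_scope.

(* Idea.  Classes in L2(Omega; H) are replaced by measurable versions, and a
   stochastic integral is a limit of Riemann sums controlled by the Ito isometry.
   Put Z(t) = sum_i int_0^t S(t - s) A Psi_i(s) dW_i(s).  Since A is closed, passing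
   to the limit first in Riemann sums and then in partial sums over i gives
   A W^Psi(t) = Z(t) almost surely.  On a grid t_k of [0, t] the resolvent equation
   says that S(t - t_k) x - x is the sum over l >= k of b_l S(t_l - t_k) A x, where
   b_l is the integral of a over (t - t_(l+1), t - t_l], up to an error bounded by
   the oscillation of r |-> S(r) A x at the scale of the mesh.  Multiplying by the
   increments of W_i and exchanging the two finite sums turns the Riemann sums of
   W^Psi(t) - int_0^t Psi dW into sum_l b_l Z(t_l), so that no stochastic Fubini
   theorem is needed.  Because Z is continuous in L2 and a(t - .) is an L1 limit of
   continuous functions, these sums converge to the Bochner integral of a(t - .) Z.
   Integrals against different W_i are orthogonal, so the sum over i reduces to
   finitely many noises uniformly in time. *)

(** * Inner products and Borel random variables *)

(** The resolvent is only strongly continuous, so no modulus of continuity of r |-> S(r) in operator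
    norm is available. It is replaced by the modulus of a single orbit, [osc h x]. This is Lipschitz
    in x, hence measurable along random variables; its mean square tends to 0 with h by dominated
    convergence, and a finite net in time makes this uniform over [0, T]. Two further uniformities
    drive the limits. The error of a Riemann sum depends on the integrand only through a modulus, a
    bound and the number of exceptional times, so the integrals at t_0, t_1, ..., whose number grows
    with the grid, are approximated simultaneously. The tail of the series over i is bounded, at
    every time, by M^2 times the tail of the energies, so the number of noises is fixed before the
    grid. The kernel is only integrable. The estimates bound each b_l, and the sum of all |b_l|, by
    the L1 norm of the kernel; the squares of the b_l enter only with the mesh as a factor. *)

Definition inner_product {R : realType} {H : normedModType R} (ip : H -> H -> R) :=
  [/\ forall x y, ip x y = ip y x,
      forall (k : R) x y z, ip (k *: x + y) z = k * ip x z + ip y z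
    & forall x, ip x x = `|x| ^+ 2].

Section InnerProduct.
Context {R : realType} {H : normedModType R} (ip : H -> H -> R).
Hypothesis ipP : inner_product ip.

Lemma ipC x y : ip x y = ip y x. Proof. by case: ipP. Qed.
Lemma ipxx x : ip x x = `|x| ^+ 2. Proof. by case: ipP. Qed.
Lemma ipDl x y z : ip (x + y) z = ip x z + ip y z.
Proof. by case: ipP => _ L _; rewrite -[x]scale1r L mul1r scale1r. Qed.
Lemma ip0l z : ip 0 z = 0.
Proof. by apply: (addrI (ip 0 z)); rewrite -ipDl !addr0. Qed.
Lemma ipZl k x z : ip (k *: x) z = k * ip x z.
Proof. by case: ipP => _ L _; rewrite -[k *: x]addr0 L ip0l addr0. Qed.
Lemma ipNl x z : ip (- x) z = - ip x z.
Proof. by rewrite -scaleN1r ipZl mulN1r. Qed.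
Lemma ipBl x y z : ip (x - y) z = ip x z - ip y z.
Proof. by rewrite ipDl ipNl. Qed.
Lemma ipDr x y z : ip z (x + y) = ip z x + ip z y.
Proof. by rewrite ipC ipDl !(ipC z). Qed.
Lemma ipZr k x z : ip z (k *: x) = k * ip z x.
Proof. by rewrite ipC ipZl ipC. Qed.
Lemma ipBr x y z : ip z (x - y) = ip z x - ip z y.
Proof. by rewrite ipC ipBl !(ipC z). Qed.
Lemma ip_suml I (r : seq I) (P : pred I) (F : I -> H) z :
  ip (\sum_(i <- r | P i) F i) z = \sum_(i <- r | P i) ip (F i) z.
Proof. by apply: (big_morph (ip^~ z)) => [x y|]; rewrite ?ipDl ?ip0l. Qed.

Lemma norm_subsq x y : `|x - y| ^+ 2 = `|x| ^+ 2 - 2 * ip x y + `|y| ^+ 2.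
Proof. by rewrite -!ipxx ipBl !ipBr (ipC y x); ring. Qed.
Lemma norm_addsq x y : `|x + y| ^+ 2 = `|x| ^+ 2 + 2 * ip x y + `|y| ^+ 2.
Proof. by rewrite -!ipxx ipDl !ipDr (ipC y x); ring. Qed.

Lemma ip_le x y : `|ip x y| <= `|x| * `|y|.
Proof.
have [->|y0] := eqVneq y 0; first by rewrite ipC ip0l !normr0 mulr0.
have ny : 0 < `|y| by rewrite normr_gt0.
have h k : 0 <= `|x| ^+ 2 - 2 * (k * ip x y) + k ^+ 2 * `|y| ^+ 2.
  have := norm_subsq x (k *: y); rewrite ipZr normrZ exprMn real_normK ?num_real//.
  by move=> <-; rewrite sqr_ge0.
have {}h := h (ip x y / `|y| ^+ 2).
rewrite -ler_sqr ?nnegrE ?mulr_ge0// exprMn real_normK ?num_real//.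
rewrite -ler_pdivrMr ?exprn_gt0// -subr_ge0; move: h.
set e := _ + _; suff -> : e = `|x| ^+ 2 - ip x y ^+ 2 / `|y| ^+ 2 by [].
by rewrite /e; field; rewrite gt_eqF.
Qed.

Lemma ip_le2 x y : `|ip x y| <= `|x| ^+ 2 + `|y| ^+ 2.
Proof.
apply: (le_trans (ip_le x y)).
have := sqr_ge0 (`|x| - `|y|); have := sqr_ge0 (`|x| + `|y|); nra.
Qed.

Lemma ip_continuous h : continuous (fun x => ip x h).
Proof.
move=> x; apply/cvgrPdist_le => /= e e0; near=> y.
rewrite -ipBl (le_trans (ip_le _ _))//.
rewrite (@le_trans _ _ (`|x - y| * (`|h| + 1)))// ?ler_wpM2l// ?lerDl//.
rewrite -ler_pdivlMr ?ltr_pwDr//; near: y.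
by apply: cvgr_dist_le => //; rewrite divr_gt0 ?ltr_pwDr.
Unshelve. all: by end_near. Qed.

End InnerProduct.

(** The sigma-algebra is an explicit parameter because the F t vary with t. [rmeasP] passes to the
    type generated by G, where the closure properties of measurable functions apply. *)
Definition rmeas {Omega : Type} {R : realType} (G : set (set Omega)) (f : Omega -> R) :=
  forall B, measurable B -> G (f @^-1` B).

Section Rmeas.
Context {d : measure_display} {Omega : measurableType d} {R : realType} (G : set (set Omega)).
Hypothesis sG : sigma_algebra setT G.
Local Notation GT := (g_sigma_algebraType G).
Implicit Types f g : Omega -> R.

Lemma rmeasP (f : Omega -> R) : rmeas G f <-> measurable_fun [set: GT] (f : GT -> R).
Proof.
have e : (measurable : set (set GT)) = G by rewrite /measurable/= sigma_algebra_id.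
split=> [h _ B mB|h B mB].
  by rewrite setTI e; exact: h.
by have := h measurableT B mB; rewrite setTI e.
Qed.

Lemma rmeas_cst (c : R) : rmeas G (fun=> c).
Proof. by apply/rmeasP; exact: measurable_cst. Qed.
Lemma rmeasD f g : rmeas G f -> rmeas G g -> rmeas G (fun w => f w + g w).
Proof. by move=> /rmeasP ? /rmeasP ?; apply/rmeasP; exact: measurable_funD. Qed.
Lemma rmeasB f g : rmeas G f -> rmeas G g -> rmeas G (fun w => f w - g w).
Proof. by move=> /rmeasP ? /rmeasP ?; apply/rmeasP; exact: measurable_funB. Qed.
Lemma rmeasM f g : rmeas G f -> rmeas G g -> rmeas G (fun w => f w * g w).
Proof. by move=> /rmeasP ? /rmeasP ?; apply/rmeasP; exact: measurable_funM. Qed.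
Lemma rmeas_comp (phi : R -> R) f : measurable_fun setT phi -> rmeas G f ->
  rmeas G (fun w => phi (f w)).
Proof.
move=> m h B mB; have := m measurableT B mB; rewrite setTI => mm.
exact: h mm.
Qed.

(** The set where g exceeds r is the union over n of the sets where [f n] exceeds r, and these
    half-lines generate the Borel sets. *)
Lemma rmeas_sup (f : nat -> Omega -> R) (g : Omega -> R) :
  (forall n, rmeas G (f n)) ->
  (forall w r, (r < g w) <-> exists n, r < f n w) -> rmeas G g.
Proof.
move=> mf fg; apply/rmeasP.
apply: (measurability _ (RGenOInfty.measurableE R)) => _ [_ [r ->] <-].
rewrite (_ : _ `&` _ = \bigcup_n ([set: GT] `&` ((f n : GT -> R) @^-1` `]r, +oo[))).
  by apply: bigcupT_measurable => n; have /rmeasP h := mf n; exact: h.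
apply/seteqP; split=> [w [_]|w [n _ [_ /=]]] /=.
  by rewrite in_itv/= andbT => /fg [n h]; exists n => //; split => //=; rewrite in_itv/= h.
by rewrite in_itv/= andbT => h; split => //; rewrite in_itv/= andbT; apply/fg; exists n.
Qed.

Context {H : completeNormedModType R}.
Implicit Types X Y : Omega -> H.

(** The sets whose preimage under X lies in G form a sigma-algebra, so open sets suffice. *)
Lemma borel_open X : (forall U, open U -> G (X @^-1` U)) -> borel_measurable G X.
Proof.
move=> h B; apply: (@smallest_sub _ (sigma_algebra setT) _ [set B | G (X @^-1` B)]).
  case: sG => G0 GC GU; split => /=.
  - by rewrite preimage_set0.
  - by move=> C GX; rewrite setTD preimage_setC -setTD; exact: GC.
  - by move=> C GX; rewrite preimage_bigcup; exact: GU.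
exact: h.
Qed.

Lemma borel_contR (phi : H -> R) X : continuous phi -> borel_measurable G X ->
  rmeas G (fun w => phi (X w)).
Proof.
move=> cphi bX; apply/rmeasP.
apply: (measurability _ (RGenOInfty.measurableE R)) => _ [_ [r ->] <-].
have e : (measurable : set (set GT)) = G by rewrite /measurable/= sigma_algebra_id.
rewrite setTI e -[X in G X]/(X @^-1` (phi @^-1` `]r, +oo[)).
apply: bX; apply: sub_sigma_algebra; apply: open_comp => //.

Qed.

Lemma borel_cont (phi : H -> H) X : continuous phi -> borel_measurable G X ->
  borel_measurable G (fun w => phi (X w)).
Proof.
move=> cphi bX; apply: borel_open => U oU.
rewrite -[X in G X]/(X @^-1` (phi @^-1` U)).
apply: bX; apply: sub_sigma_algebra; apply: open_comp => //.

Qed.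

Context (ip : H -> H -> R) (ipP : inner_product ip) (sepH : separable H).

Lemma dense_enum : exists q : nat -> H, forall (x : H) (e : R), 0 < e -> exists n, `|x - q n| < e.
Proof.
have [Q cQ dQ] := sepH.
have [z Qz] : Q !=set0.
  by have [|z [_ Qz]] := dQ setT _ openT; [exists 0|exists z].
have /countable_injP[f fi] := cQ.
pose q n := xget z [set x | Q x /\ f x = n].
have qQ : Q `<=` range q.
  move=> x Qx; exists (f x) => //; rewrite /q.
  case: xgetP => [y _ [Qy fy]|/(_ x)]; last by case.
  by apply: fi; rewrite ?inE.
exists q => x e e0.
have [|y [] /=] := dQ (ball x e) _ (ball_open x e).
  by exists x; exact: ballxx.
move=> xy Qy; have [n _ qy] := qQ _ Qy; exists n.
by move: xy; rewrite -ball_normE /ball_/= qy.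
Qed.

(* |x|^2 is the supremum of 2 <x,h> - |h|^2 over a dense set of h. *)
Lemma weak_norm (X : Omega -> H) (x0 : H) : (forall h, rmeas G (fun w => ip (X w) h)) ->
  rmeas G (fun w => `|X w - x0| ^+ 2).
Proof.
move=> mX; have [q qd] := dense_enum.
apply: (@rmeas_sup (fun n w => 2 * ip (X w - x0) (q n) - `|q n| ^+ 2)) => [n|w r].
  apply: rmeasB; last exact: rmeas_cst.
  apply: rmeasM; first exact: rmeas_cst.
  under eq_fun do rewrite (ipBl ipP).
  by apply: rmeasB => //; exact: rmeas_cst.
set y := X w - x0; split=> [h|[n h]].
  have [n hn] : exists n, `|y - q n| < Num.sqrt (`|y| ^+ 2 - r).
    by apply: qd; rewrite sqrtr_gt0 subr_gt0.
  exists n; have : `|y - q n| ^+ 2 < `|y| ^+ 2 - r.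
    rewrite -[X in _ < X]sqr_sqrtr ?subr_ge0 ?ltW//.
    by rewrite ltr_sqr ?nnegrE ?sqrtr_ge0.
  by rewrite (norm_subsq ipP); lra.
have := norm_subsq ipP y (q n); have := sqr_ge0 `|y - q n|; lra.
Qed.

(** In a separable space an open set is a countable union of balls with centre in a dense sequence
    and radius 1/(k+1), and [weak_norm] makes the preimages of balls measurable. Measurability of
    vector-valued functions is thereby reduced to that of scalar ones. *)
Lemma weak_borel X : (forall h, rmeas G (fun w => ip (X w) h)) -> borel_measurable G X.
Proof.
move=> mX; have [q qd] := dense_enum; apply: borel_open => U oU.
pose J := [set p : nat * nat | ball (q p.1) (p.2.+1%:R^-1 : R) `<=` U].
have -> : X @^-1` U = \bigcup_(p in J) (X @^-1` (ball (q p.1) (p.2.+1%:R^-1 : R))).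
  apply/seteqP; split=> [w/= Uw|w [p Jp/=]]; last exact: Jp.
  have /nbhs_ballP [e /= e0 eU] : nbhs (X w) U by exact: open_nbhs_nbhs.
  have [k /(_ k (leqnn k)) ke] : exists k : nat, forall n : nat, (k <= n)%N -> n.+1%:R^-1 < e / 2.
    have /cvgrPdist_lt := @cvg_harmonic R => /(_ (e / 2)); rewrite divr_gt0// => /(_ isT) [k _ hk].
    exists k => n /hk; rewrite /= sub0r normrN ger0_norm//.
  have [n hn] := qd (X w) k.+1%:R^-1 ltac:(by rewrite invr_gt0).
  exists (n, k) => /=; last by rewrite -ball_normE /ball_/= distrC.
  move=> z; rewrite -ball_normE /ball_/= => hz; apply: eU; rewrite -ball_normE /ball_/=.
  rewrite (le_lt_trans (ler_distD (q n) _ _))// [ltRHS]splitr.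
  by rewrite ltrD// (lt_trans _ ke).
case: (sG) => G0 GC GU.
have GB p : G (X @^-1` (ball (q p.1) (p.2.+1%:R^-1 : R))).
  have := @weak_norm X (q p.1) mX `]-oo, (p.2.+1%:R^-1 : R) ^+ 2[%classic (measurable_itv _).
  congr G; apply/seteqP; split=> w/=; rewrite in_itv/= -ball_normE /ball_/= distrC.
    by rewrite ltr_sqr ?nnegrE ?invr_ge0//.
  by rewrite ltr_sqr ?nnegrE ?invr_ge0//.
(* The union over pairs is re-indexed by the codes of pairs, because G is closed under unions
   indexed by the natural numbers; codes outside J contribute the empty set. *)
pose B n := if unpickle n is Some p then
  if `[< J p >] then X @^-1` (ball (q p.1) (p.2.+1%:R^-1 : R)) else set0 else set0.
rewrite (_ : \bigcup_(p in J) _ = \bigcup_n B n).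
  by apply: GU => n; rewrite /B; case: unpickle => // p; case: ifP.
apply/seteqP; split=> [w [p Jp h]|w [n _]].
  by exists (pickle p) => //; rewrite /B pickleK asboolT.
by rewrite /B; case: unpickle => // p; case: ifPn => // /asboolP Jp h; exists p.
Qed.

Lemma borel_ip X h : borel_measurable G X -> rmeas G (fun w => ip (X w) h).
Proof. by move=> bX; apply: (@borel_contR (fun x => ip x h)) => //; exact: ip_continuous. Qed.

Lemma borel_cst x : borel_measurable G (fun=> x : H).
Proof. by apply: weak_borel => h; exact: rmeas_cst. Qed.
Lemma borelD X Y : borel_measurable G X -> borel_measurable G Y ->
  borel_measurable G (fun w => X w + Y w).
Proof.
move=> bX bY; apply: weak_borel => h; under eq_fun do rewrite (ipDl ipP).
by apply: rmeasD; exact: borel_ip.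
Qed.
Lemma borelZ (f : Omega -> R) X : rmeas G f -> borel_measurable G X ->
  borel_measurable G (fun w => f w *: X w).
Proof.
move=> bf bX; apply: weak_borel => h; under eq_fun do rewrite (ipZl ipP).
by apply: rmeasM => //; exact: borel_ip.
Qed.
Lemma borelB X Y : borel_measurable G X -> borel_measurable G Y ->
  borel_measurable G (fun w => X w - Y w).
Proof.
move=> bX bY; apply: weak_borel => h; under eq_fun do rewrite (ipBl ipP).
by apply: rmeasB; exact: borel_ip.
Qed.
Lemma borel_norm X : borel_measurable G X -> rmeas G (fun w => `|X w|).
Proof. by apply: borel_contR; exact: norm_continuous. Qed.

(** Polarisation expresses the product by norms of X + Y and X - Y, which avoids a Borel structure
    on H * H. *)
Lemma borel_ip2 X Y : borel_measurable G X -> borel_measurable G Y ->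
  rmeas G (fun w => ip (X w) (Y w)).
Proof.
move=> bX bY.
have -> : (fun w => ip (X w) (Y w)) =
  (fun w => 4^-1 * (`|X w + Y w| * `|X w + Y w| - `|X w - Y w| * `|X w - Y w|)).
  apply/funext => w; rewrite -!expr2 (norm_addsq ipP) (norm_subsq ipP); lra.
apply: rmeasM; first exact: rmeas_cst.
have mD := borel_norm (borelD bX bY); have mB := borel_norm (borelB bX bY).
by apply: rmeasB; apply: rmeasM.
Qed.

End Rmeas.

Import HBNNSimple.

(** * Square-integrable random variables *)

Section RandomVariables.
Context {d : measure_display} {Omega : measurableType d} {R : realType}.
Variable P : probability Omega R.
Implicit Types (f g : Omega -> R) (A : set Omega).

Definition integ f := P.-integrable setT (EFin \o f).
Definition mean f : R := \int[P]_w f w.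

Lemma rmeas_measurable f : rmeas measurable f <-> measurable_fun setT f.
Proof. by split=> [h _ B mB|h B mB]; [rewrite setTI|rewrite -[X in measurable X]setTI]; exact: h. Qed.

Lemma integ_meas f : integ f -> rmeas measurable f.
Proof. by move=> /integrableP[/measurable_EFinP m _]; exact/rmeas_measurable. Qed.

Lemma integD f g : integ f -> integ g -> integ (fun w => f w + g w).
Proof. by move=> i j; exact: (integrableD measurableT i j). Qed.
Lemma integB f g : integ f -> integ g -> integ (fun w => f w - g w).
Proof. by move=> i j; exact: (integrableB measurableT i j). Qed.
Lemma integZ k f : integ f -> integ (fun w => k * f w).
Proof. by move=> i; exact: (integrableZl measurableT k i). Qed.
Lemma integ_cst k : integ (fun=> k).
Proof. by apply: finite_measure_integrable_cst. Qed.
Lemma integ_le f g : rmeas measurable f -> integ g -> (forall w, `|f w| <= g w) -> integ f.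
Proof.
move=> /rmeas_measurable m ig h; apply: (@le_integrable _ _ _ _ _ _ _ (EFin \o g)) => //.
  exact/measurable_EFinP.
by move=> w _ /=; rewrite lee_fin (le_trans (h w))// ler_norm.
Qed.

Lemma meanD f g : integ f -> integ g -> mean (fun w => f w + g w) = mean f + mean g.
Proof. by move=> i j; rewrite /mean RintegralD. Qed.
Lemma meanB f g : integ f -> integ g -> mean (fun w => f w - g w) = mean f - mean g.
Proof. by move=> i j; rewrite /mean RintegralB. Qed.
Lemma meanZ k f : integ f -> mean (fun w => k * f w) = k * mean f.
Proof. by move=> i; rewrite /mean RintegralZl. Qed.
Lemma mean_cst k : mean (fun=> k) = k.
Proof. by rewrite /mean Rintegral_cst//= probability_setT mulr1. Qed.
Lemma mean_ge0 f : (forall w, 0 <= f w) -> 0 <= mean f.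
Proof. by move=> h; exact: Rintegral_ge0. Qed.
Lemma mean_le f g : integ f -> integ g -> (forall w, f w <= g w) -> mean f <= mean g.
Proof. by move=> i j h; apply: le_Rintegral. Qed.
Lemma mean_norm f : integ f -> `|mean f| <= mean (fun w => `|f w|).
Proof. by move=> i; exact: le_normr_Rintegral. Qed.
Lemma mean_EFin f : integ f -> ((mean f)%:E = \int[P]_w (f w)%:E)%E.
Proof. by move=> i; rewrite fineK//; exact: integrable_fin_num. Qed.
Lemma integ_sum I (r : seq I) (F : I -> Omega -> R) : (forall i, integ (F i)) ->
  integ (fun w => \sum_(i <- r) F i w).
Proof.
move=> h; elim: r => [|i r IH].
  by under eq_fun do rewrite big_nil; exact: integ_cst.
by under eq_fun do rewrite big_cons; exact: integD.
Qed.
Lemma mean_sum I (r : seq I) (F : I -> Omega -> R) : (forall i, integ (F i)) ->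
  mean (fun w => \sum_(i <- r) F i w) = \sum_(i <- r) mean (F i).
Proof.
move=> h; elim: r => [|i r IH].
  by under eq_fun do rewrite big_nil; rewrite mean_cst big_nil.
under eq_fun do rewrite big_cons; rewrite meanD// ?IH ?big_cons//.
exact: integ_sum.
Qed.

(** The variance of f is nonnegative. *)
Lemma mean_sqr_le f : integ f -> integ (fun w => f w ^+ 2) -> mean f ^+ 2 <= mean (fun w => f w ^+ 2).
Proof.
move=> i j; set m := mean f.
have : 0 <= mean (fun w => (f w ^+ 2 - (2 * m) * f w) + m ^+ 2).
  by apply: mean_ge0 => w; have := sqr_ge0 (f w - m); lra.
rewrite meanD ?meanB ?meanZ ?mean_cst//; last 4 first.
- exact: integ_cst.
- exact: integZ.
- by apply: integB => //; exact: integZ.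
- exact: integ_cst.
rewrite -/m; nra.
Qed.

(* The integral of a nonnegative function is a supremum over the simple
   functions below it, so this holds for non-measurable f and g too. *)
Lemma ge0_integral_ae_eq (f g : Omega -> \bar R) :
  (forall w, (0 <= f w)%E) -> (forall w, (0 <= g w)%E) ->
  {ae P, forall w, f w = g w} -> (\int[P]_w f w = \int[P]_w g w)%E.
Proof.
have main (f' g' : Omega -> \bar R) : (forall w, (0 <= f' w)%E) -> (forall w, (0 <= g' w)%E) ->
    {ae P, forall w, f' w = g' w} -> (\int[P]_w f' w <= \int[P]_w g' w)%E.
  move=> f0 g0 [N [mN N0 h]].
  rewrite !ge0_integralTE//; apply: ge_ereal_sup => _ [phi /= phif <-].
  (* Setting [phi] to 0 on the null set N keeps its integral and puts it below [g'] everywhere. *)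
  pose psi := mul_nnsfun phi (indic_nnsfun R (measurableC mN)).
  have -> : sintegral P phi = sintegral P psi.
    rewrite -!integralT_nnsfun.
    apply: ae_eq_integral => //; [exact/measurable_EFinP|exact/measurable_EFinP|].
    exists N; split => // w /=; apply: contra_notP => /= Nw _.
    by rewrite mindicE mem_set//= mulr1.
  apply: ereal_sup_ubound; exists psi => //= w.
  rewrite mindicE; case: (boolP (w \in ~` N)) => [|_]/=.
    rewrite inE/= => Nw; rewrite mulr1; apply: le_trans (phif w) _.
    have -> // : f' w = g' w.
    by apply: contrapT => /h.
  by rewrite mulr0 g0.
move=> f0 g0 fg; apply/eqP; rewrite eq_le !main//.
by apply: filterS fg => w.
Qed.

End RandomVariables.

Section L2space.
Context {d : measure_display} {Omega : measurableType d} {R : realType}.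
Variable P : probability Omega R.
Context {H : completeNormedModType R} (ip : H -> H -> R).
Hypotheses (ipP : inner_product ip) (sepH : separable H).
Implicit Types X Y Z : Omega -> H.

(** Genuine representatives: [L2] holds of anything that is almost surely equal to such a function,
    whereas [dot] and [nrm] are computed with honestly measurable ones. [L2P] translates between the
    two. *)
Definition M2 (G : set (set Omega)) X :=
  borel_measurable G X /\ integ P (fun w => `|X w| ^+ 2).
Definition dot X Y : R := mean P (fun w => ip (X w) (Y w)).
Definition nrm X : R := Num.sqrt (mean P (fun w => `|X w| ^+ 2)).

Local Notation mea := (@measurable d Omega).
Local Notation smea := (@sigma_algebra_measurable d Omega).

Lemma M2_sub G X : G `<=` mea -> M2 G X -> M2 mea X.
Proof. by move=> GM [bX iX]; split => // B mB; exact/GM/bX. Qed.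

Lemma M2_norm X : M2 mea X -> rmeas mea (fun w => `|X w|).
Proof. by case=> bX _; exact: (borel_norm smea). Qed.

Lemma rmeas_sqr f : rmeas mea f -> rmeas mea (fun w => f w ^+ 2 : R).
Proof. by move=> mf; under eq_fun do rewrite expr2; exact: (rmeasM smea). Qed.

Section Closure.
Variable G : set (set Omega).
Hypotheses (sG : sigma_algebra setT G) (GM : G `<=` mea).

Lemma M2D X Y : M2 G X -> M2 G Y -> M2 G (fun w => X w + Y w).
Proof.
move=> hX hY; have [bX iX] := hX; have [bY iY] := hY; split; first exact: (borelD sG ipP).
apply: (@integ_le _ _ _ _ _ (fun w => 2 * (`|X w| ^+ 2 + `|Y w| ^+ 2))).
- apply: rmeas_sqr; apply: borel_norm => //; first exact: smea.
  by move=> B mB; apply: GM; exact: (borelD sG ipP).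
- by apply: integZ; exact: integD.
move=> w; rewrite ger0_norm ?sqr_ge0//.
have := ler_normD (X w) (Y w); have := sqr_ge0 (`|X w| - `|Y w|).
have := normr_ge0 (X w + Y w); nra.
Qed.

Lemma M2Z k X : M2 G X -> M2 G (fun w => k *: X w).
Proof.
case=> bX iX; split; first by apply: (borelZ sG ipP) => //; exact: rmeas_cst.
under eq_fun do rewrite normrZ exprMn; exact: integZ.
Qed.

Lemma M2B X Y : M2 G X -> M2 G Y -> M2 G (fun w => X w - Y w).
Proof.
move=> hX hY; under eq_fun do rewrite -scaleN1r.
by apply: M2D => //; exact: M2Z.
Qed.

Lemma M2_cst x : M2 G (fun=> x).
Proof. by split; [exact: (borel_cst sG ipP)|exact: integ_cst]. Qed.

Lemma M2_sum I (r : seq I) (F : I -> Omega -> H) : (forall i, M2 G (F i)) ->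
  M2 G (fun w => \sum_(i <- r) F i w).
Proof.
move=> h; elim: r => [|i r IH].
  by under eq_fun do rewrite big_nil; exact: M2_cst.
by under eq_fun do rewrite big_cons; exact: M2D.
Qed.

Lemma M2_comp (B : H -> H) (M : R) X : continuous B -> 0 <= M -> (forall x, `|B x| <= M * `|x|) ->
  M2 G X -> M2 G (fun w => B (X w)).
Proof.
move=> cB M0 BM [bX iX]; split; first exact: borel_cont.
apply: (@integ_le _ _ _ _ _ (fun w => M ^+ 2 * `|X w| ^+ 2)).
- apply: rmeas_sqr; apply: borel_norm => //; first exact: smea.
  by move=> C mC; apply: GM; exact: (borel_cont sG cB bX).
- exact: integZ.
move=> w; rewrite ger0_norm ?sqr_ge0// -exprMn ler_sqr ?nnegrE ?mulr_ge0//.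
Qed.
End Closure.

Lemma ip_integ X Y : M2 mea X -> M2 mea Y -> integ P (fun w => ip (X w) (Y w)).
Proof.
move=> [bX iX] [bY iY]; apply: (@integ_le _ _ _ _ _ (fun w => `|X w| ^+ 2 + `|Y w| ^+ 2)).
- exact: (borel_ip2 smea ipP sepH).
- exact: integD.
- by move=> w; exact: ip_le2.
Qed.

Lemma dotC X Y : dot X Y = dot Y X.
Proof. by congr (mean P _); apply/funext => w; exact: ipC. Qed.
Lemma dotDl X Y Z : M2 mea X -> M2 mea Y -> M2 mea Z ->
  dot (fun w => X w + Y w) Z = dot X Z + dot Y Z.
Proof.
move=> hX hY hZ; rewrite /dot -meanD; [|exact: ip_integ..].
by congr (mean P _); apply/funext => w; exact: ipDl.
Qed.
Lemma dotBl X Y Z : M2 mea X -> M2 mea Y -> M2 mea Z ->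
  dot (fun w => X w - Y w) Z = dot X Z - dot Y Z.
Proof.
move=> hX hY hZ; rewrite /dot -meanB; [|exact: ip_integ..].
by congr (mean P _); apply/funext => w; exact: ipBl.
Qed.
Lemma dotBr X Y Z : M2 mea X -> M2 mea Y -> M2 mea Z ->
  dot Z (fun w => X w - Y w) = dot Z X - dot Z Y.
Proof. by move=> hX hY hZ; rewrite !(dotC Z) dotBl. Qed.
Lemma dotZl k X Z : M2 mea X -> M2 mea Z -> dot (fun w => k *: X w) Z = k * dot X Z.
Proof.
move=> hX hZ; rewrite /dot -meanZ; [|exact: ip_integ..].
by congr (mean P _); apply/funext => w; exact: ipZl.
Qed.
Lemma dot_suml I (r : seq I) (F : I -> Omega -> H) Z : (forall i, M2 mea (F i)) -> M2 mea Z ->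
  dot (fun w => \sum_(i <- r) F i w) Z = \sum_(i <- r) dot (F i) Z.
Proof.
move=> hF hZ; rewrite /dot -mean_sum; last by move=> i; exact: ip_integ.
by congr (mean P _); apply/funext => w; rewrite (ip_suml ipP).
Qed.
Lemma dot_sumr I (r : seq I) (F : I -> Omega -> H) Z : (forall i, M2 mea (F i)) -> M2 mea Z ->
  dot Z (fun w => \sum_(i <- r) F i w) = \sum_(i <- r) dot Z (F i).
Proof. by move=> hF hZ; rewrite dotC dot_suml//; apply: eq_bigr => i _; rewrite dotC. Qed.

Lemma nrm_ge0 X : 0 <= nrm X. Proof. exact: sqrtr_ge0. Qed.
Lemma nrm_sqE X : nrm X ^+ 2 = mean P (fun w => `|X w| ^+ 2).
Proof. by rewrite sqr_sqrtr// mean_ge0// => w; rewrite sqr_ge0. Qed.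
Lemma dotxx X : dot X X = nrm X ^+ 2.
Proof. by rewrite nrm_sqE /dot; under eq_fun do rewrite (ipxx ipP). Qed.

Lemma nrm_subsq X Y : M2 mea X -> M2 mea Y ->
  nrm (fun w => X w - Y w) ^+ 2 = nrm X ^+ 2 - 2 * dot X Y + nrm Y ^+ 2.
Proof.
move=> hX hY; have hB := M2B smea (fun _ => id) hX hY.
by rewrite -!dotxx dotBl// !dotBr// (dotC Y X); ring.
Qed.

Lemma nrmBC X Y : nrm (fun w => X w - Y w) = nrm (fun w => Y w - X w).
Proof. by rewrite /nrm; under eq_fun do rewrite distrC. Qed.

Lemma nrmZ k X : M2 mea X -> nrm (fun w => k *: X w) = `|k| * nrm X.
Proof.
case=> _ iX; rewrite /nrm; under eq_fun do rewrite normrZ exprMn.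
by rewrite meanZ// sqrtrM ?sqr_ge0// sqrtr_sqr normr_id.
Qed.

Lemma dot_le X Y : M2 mea X -> M2 mea Y -> `|dot X Y| <= nrm X * nrm Y.
Proof.
move=> hX hY; have h k : 0 <= nrm X ^+ 2 - 2 * (k * dot X Y) + k ^+ 2 * nrm Y ^+ 2.
  have hk := M2Z smea k hY.
  have := nrm_subsq hX hk; rewrite (dotC X) dotZl// nrmZ// exprMn real_normK ?num_real// dotC => <-.
  exact: sqr_ge0.
have [Y0|Y0] := eqVneq (nrm Y) 0.
  rewrite Y0 mulr0 normr_le0; apply/eqP; apply: contrapT => /eqP d0.
  (* When [nrm Y] is 0 the quadratic in k degenerates to an affine function; this k would give it
     the value -1. *)
  have := h ((nrm X ^+ 2 + 1) / (2 * dot X Y)); rewrite Y0 expr0n/= mulr0 addr0.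
  by rewrite (_ : 2 * _ = nrm X ^+ 2 + 1) ?opprD ?addNKr ?addKr; [lra|field].
rewrite -ler_sqr ?nnegrE ?mulr_ge0 ?nrm_ge0// exprMn real_normK ?num_real//.
have Yp : 0 < nrm Y ^+ 2 by rewrite lt0r sqr_ge0 sqrf_eq0 Y0.
rewrite -ler_pdivrMr// -subr_ge0; have := h (dot X Y / nrm Y ^+ 2).
set e := _ + _; suff -> : e = nrm X ^+ 2 - dot X Y ^+ 2 / nrm Y ^+ 2 by [].
by rewrite /e; field.
Qed.

Lemma nrmB_le X Y : M2 mea X -> M2 mea Y -> nrm (fun w => X w - Y w) <= nrm X + nrm Y.
Proof.
move=> hX hY; rewrite -ler_sqr ?nnegrE ?addr_ge0 ?nrm_ge0// nrm_subsq//.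
have := dot_le hX hY; rewrite ler_norml => /andP[h _]; lra.
Qed.

Lemma nrmD_le X Y : M2 mea X -> M2 mea Y -> nrm (fun w => X w + Y w) <= nrm X + nrm Y.
Proof.
move=> hX hY; have := nrmB_le hX (M2Z smea (-1) hY); rewrite nrmZ// normrN1 mul1r.
by under eq_fun do rewrite scaleN1r opprK.
Qed.

Lemma nrm_tri X Y Z : M2 mea X -> M2 mea Y -> M2 mea Z ->
  nrm (fun w => X w - Z w) <= nrm (fun w => X w - Y w) + nrm (fun w => Y w - Z w).
Proof.
move=> hX hY hZ; have h1 := M2B smea (fun _ => id) hX hY; have h2 := M2B smea (fun _ => id) hY hZ.
apply: le_trans (nrmD_le h1 h2); rewrite le_eqVlt; apply/orP; left; apply/eqP.
by congr nrm; apply/funext => w; rewrite addrA subrK.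
Qed.

Lemma nrm0 : nrm (fun=> 0) = 0.
Proof. by rewrite /nrm; under eq_fun do rewrite normr0 expr0n/=; rewrite mean_cst sqrtr0. Qed.

Lemma nrm_sum_le I (r : seq I) (F : I -> Omega -> H) : (forall i, M2 mea (F i)) ->
  nrm (fun w => \sum_(i <- r) F i w) <= \sum_(i <- r) nrm (F i).
Proof.
move=> h; elim: r => [|i r IH].
  by under eq_fun do rewrite big_nil; rewrite nrm0 big_nil.
under eq_fun do rewrite big_cons; rewrite big_cons.
apply: le_trans (nrmD_le (h i) _) _; first exact: M2_sum smea (fun _ => id) _ _ _ _.
by rewrite lerD2l.
Qed.

Lemma nrm_le_fun X (g : Omega -> R) (c : R) : M2 mea X -> integ P (fun w => g w ^+ 2) -> 0 <= c ->
  mean P (fun w => g w ^+ 2) <= c ^+ 2 -> (forall w, `|X w| <= g w) -> nrm X <= c.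
Proof.
move=> [bX iX] ig c0 gc Xg; rewrite -ler_sqr ?nnegrE ?nrm_ge0// nrm_sqE; apply: le_trans gc.
apply: mean_le => // w; rewrite ler_sqr ?nnegrE//.
exact: le_trans (Xg w).
Qed.

Lemma nrm_le_op X Y (k : R) : M2 mea X -> M2 mea Y -> 0 <= k -> {ae P, forall w, `|X w| <= k * `|Y w|} ->
  nrm X <= k * nrm Y.
Proof.
move=> [bX iX] [bY iY] k0 h; rewrite -ler_sqr ?nnegrE ?mulr_ge0 ?nrm_ge0// exprMn !nrm_sqE -meanZ//.
rewrite -lee_fin !mean_EFin//; last exact: integZ.
apply: ae_ge0_le_integral => //.
- by case/integrableP: iX.
- by move=> w _; rewrite lee_fin mulr_ge0 ?sqr_ge0.
- by case/integrableP: (integZ (k ^+ 2) iY).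
- apply: filterS h => w hw _; rewrite lee_fin -exprMn ler_sqr ?nnegrE ?mulr_ge0//.
Qed.

Lemma nrm0_ae X : M2 mea X -> nrm X = 0 -> {ae P, forall w, X w = 0}.
Proof.
move=> [bX iX] X0; have := nrm_sqE X; rewrite X0 expr0n/= => /esym m0.
have /integrableP[mX _] := iX.
have : (\int[P]_w `|(`|X w| ^+ 2)%:E| = 0)%E.
  transitivity ((mean P (fun w => `|X w| ^+ 2))%:E); last by rewrite m0.
  rewrite mean_EFin//; by apply: eq_integral => w _; rewrite gee0_abs ?lee_fin ?sqr_ge0.
move/(ae_eq_integral_abs P measurableT mX); apply: filterS => w /(_ Logic.I)[] /eqP.
by rewrite sqrf_eq0 normr_eq0 => /eqP.
Qed.

(** No measurability is assumed, since functions such as [A (Psi i t w)] are arbitrary on a null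
    set. *)
Lemma L2norm_ae X Y : {ae P, forall w, X w = Y w} -> L2norm P X = L2norm P Y.
Proof.
move=> h; rewrite /L2norm unlock/=; congr (_ `^ _)%E.
apply: ge0_integral_ae_eq => [w|w|]; [by rewrite lee_fin powR_ge0|by rewrite lee_fin powR_ge0|].
by apply: filterS h => w /= ->.
Qed.

Lemma L2norm_nrm X : M2 mea X -> L2norm P X = (nrm X)%:E.
Proof.
move=> [_ iX]; rewrite /L2norm unlock/=.
have -> : (\int[P]_w `|(`|X w|)%:E| `^ 2 = (mean P (fun w => `|X w| ^+ 2))%:E)%E.
  rewrite mean_EFin//; apply: eq_integral => w _.
  by rewrite /= normr_id powR_mulrn.
by rewrite poweR_EFin powR12_sqrt// mean_ge0// => w; rewrite sqr_ge0.
Qed.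

Lemma L2norm_fin_integ X : borel_measurable mea X -> (L2norm P X < +oo)%E -> M2 mea X.
Proof.
move=> bX h; split => //; have mX := borel_norm smea bX.
apply/integrableP; split.
  by apply/measurable_EFinP/rmeas_measurable; exact: rmeas_sqr.
have -> : (\int[P]_w `|(EFin \o (fun w => `|X w| ^+ 2)%R) w| =
    \int[P]_w (`|(`|X w|%R)%:E| `^ 2%R)%E)%E.
  by apply: eq_integral => w _; rewrite /= normr_id powR_mulrn// ger0_norm ?sqr_ge0.
have := @poweR_Lnorm _ _ _ P (fun w => `|X w|%:E) 2 ltac:(by []) => <-.
by rewrite poweR_lty.
Qed.

Lemma L2P G X : sigma_algebra setT G -> G `<=` mea ->
  L2 P G X <-> exists Y, M2 G Y /\ {ae P, forall w, X w = Y w}.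
Proof.
move=> sG GM; split=> [[Y [bY nY h]]|[Y [hY h]]]; exists Y.
  split => //; split => //.
  have bY' : borel_measurable mea Y by move=> B mB; exact/GM/bY.
  by case: (L2norm_fin_integ bY' nY).
split => //; first by case: hY.
by rewrite L2norm_nrm ?ltry//; exact: M2_sub hY.
Qed.

End L2space.

(** * Completeness of L2(Omega; H), almost sure subsequences and closed operators *)

Section Completeness.
Context {d : measure_display} {Omega : measurableType d} {R : realType}.
Variable P : probability Omega R.
Context {H : completeNormedModType R} (ip : H -> H -> R).
Hypotheses (ipP : inner_product ip) (sepH : separable H).
Implicit Types X Y Z : Omega -> H.

Local Notation mea := (@measurable d Omega).
Local Notation smea := (@sigma_algebra_measurable d Omega).
Local Notation M2 := (M2 P).
Local Notation nrm := (nrm P).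

(** Fatou's lemma for the squared norms. It yields square-integrability of the limit together with
    the bound, which is why membership in [M2] appears in the conclusion. *)
Lemma fatou_nrm (v : nat -> Omega -> H) X (C : R) : (forall n, M2 mea (v n)) ->
  borel_measurable mea X -> {ae P, forall w, v n w @[n --> \oo] --> X w} -> 0 <= C ->
  (\forall n \near \oo, nrm (v n) <= C) -> M2 mea X /\ nrm X <= C.
Proof.
move=> hv bX cv C0 [K _ hK].
have mf n : measurable_fun setT (fun w => (`|v n w| ^+ 2)%:E).
  by case: (hv n) => _ /integrableP[].
have mX : measurable_fun setT (fun w => (`|X w| ^+ 2)%:E).
  by apply/measurable_EFinP/rmeas_measurable; apply: rmeas_sqr; exact: (borel_norm smea).
have le : (\int[P]_w (`|X w| ^+ 2)%:E <= (C ^+ 2)%:E)%E.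
  apply: (@le_trans _ _ (\int[P]_w limn_einf (fun n => (`|v n w| ^+ 2)%:E))%E).
    apply: ae_ge0_le_integral => //.
    - move=> w _; rewrite limn_einf_lim; apply: lime_ge; first exact: is_cvg_einfs.
      by near=> n; apply: le_ereal_inf_tmp => _ [k _ <-]; rewrite lee_fin sqr_ge0.
    - apply: measurableT_comp => //; apply: measurable_fun_limn_esup => n.
      exact: measurableT_comp.
    apply: filterS cv => w cw _; rewrite (_ : limn_einf _ = (`|X w| ^+ 2)%:E)//.
    apply: (cvg_limn_einf_sup _).1; apply: cvg_EFin; first by near=> n.
    by apply: cvgM; exact: cvg_norm.
  apply: le_trans (fatou P measurableT mf _) _ => [n w _|]; first by rewrite lee_fin sqr_ge0.
  apply: (@le_trans _ _ (limn_esup (fun n => \int[P]_w (`|v n w| ^+ 2)%:E))%E).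
    exact: limn_einf_sup.
  rewrite limn_esup_lim; apply: lime_le; first exact: is_cvg_esups.
  near=> n; apply: ge_ereal_sup => _ [k /= nk <-].
  have [_ iv] := hv k; rewrite -mean_EFin// lee_fin -nrm_sqE ler_sqr ?nnegrE ?nrm_ge0//.
  by apply: hK => /=; apply: leq_trans nk; near: n; exists K.
have iX : integ P (fun w => `|X w| ^+ 2).
  apply/integrableP; split => //; under eq_integral do rewrite /= ger0_norm ?sqr_ge0//.
  exact: le_lt_trans le (ltry _).
split; first by split.
by rewrite -ler_sqr ?nnegrE ?nrm_ge0// nrm_sqE -lee_fin mean_EFin.
Unshelve. all: by end_near. Qed.

Lemma mean_norm_le X : M2 mea X -> (\int[P]_w (`|X w|)%:E <= (nrm X)%:E)%E.
Proof.
move=> [bX iX]; have i1 : integ P (fun w => `|X w|).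
  apply: (@integ_le _ _ _ _ _ (fun w => 1 + `|X w| ^+ 2)).
  - exact: (borel_norm smea).
  - by apply: integD => //; exact: integ_cst.
  - move=> w; rewrite normr_id; have := sqr_ge0 (`|X w| - 1); have := normr_ge0 (X w); nra.
rewrite -mean_EFin// lee_fin -ler_sqr ?nnegrE ?nrm_ge0 ?mean_ge0//.
by rewrite nrm_sqE; exact: mean_sqr_le.
Qed.

Lemma nneseries_lty_cvg (a : nat -> R) : (forall k, 0 <= a k) ->
  (\sum_(0 <= k <oo) (a k)%:E < +oo)%E -> cvgn (series a).
Proof.
move=> a0 h; apply: nondecreasing_is_cvgn.
  apply/nondecreasing_seqP => n; rewrite /series/= big_nat_recr//= lerDl//.
exists (fine (\sum_(0 <= k <oo) (a k)%:E)) => _ [n _ <-].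
rewrite -lee_fin fineK; last first.
  by rewrite ge0_fin_numE// nneseries_ge0// => k _ _; rewrite lee_fin.
rewrite /series/= -sumEFin; apply: nneseries_lim_ge => k _ _; by rewrite lee_fin.
Qed.

(** The expectation of the sum of the norms is at most the sum of the L2 norms, hence finite, so the
    sum itself is finite almost surely. *)
Lemma ae_summable (g : nat -> Omega -> H) : (forall k, M2 mea (g k)) ->
  (forall k, nrm (g k) <= 2 ^- k) ->
  {ae P, forall w, (\sum_(0 <= k <oo) (`|g k w|)%:E < +oo)%E}.
Proof.
move=> hg ng.
have mg k : measurable_fun setT (fun w => (`|g k w|)%:E).
  by apply/measurable_EFinP/rmeas_measurable; exact: M2_norm (hg k).
have : (\int[P]_w (\sum_(0 <= k <oo) (`|g k w|)%:E) < +oo)%E.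
  rewrite integral_nneseries//.
  apply: (@le_lt_trans _ _ (\sum_(0 <= k <oo) (2 * (1 / (2 ^ k.+1)%:R))%:E)%E).
    apply: lee_nneseries => [k _ _|k _]; first by rewrite integral_ge0.
    apply: le_trans (mean_norm_le (hg k)) _; rewrite lee_fin (le_trans (ng k))//.
    by rewrite expnS natrM natrX div1r invfM mulrA divff// mul1r.
  under eq_eseriesr do rewrite EFinM.
  rewrite nneseriesZl; first last.
  - by move=> k _; rewrite lee_fin.
  have := @epsilon_trick0 R 1 xpredT ltac:(by []).
  move=> h; apply: (@le_lt_trans _ _ (2%:E * 1)%E); last by rewrite mule1 ltry.
  by rewrite lee_wpmul2l ?lee_fin.
move=> h.
have : P.-integrable setT (fun w => \sum_(0 <= k <oo) (`|g k w|)%:E)%E.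
  apply/integrableP; split; first exact: ge0_emeasurable_sum.
  by under eq_integral do rewrite gee0_abs ?nneseries_ge0//.
move/(integrable_ae measurableT); apply: filterS => w /(_ Logic.I).
by rewrite fin_numElt => /andP[].
Qed.

Lemma ae_cvg0 (g : nat -> Omega -> H) : (forall k, M2 mea (g k)) ->
  (forall k, nrm (g k) <= 2 ^- k) -> {ae P, forall w, g k w @[k --> \oo] --> 0}.
Proof.
move=> hg ng; apply: filterS (ae_summable hg ng) => w h.
have /cvg_series_cvg_0 := nneseries_lty_cvg (fun k => normr_ge0 (g k w)) h.
by move/norm_cvg0P.
Qed.

Lemma fast_subseq (Q : nat -> nat -> Prop) :
  (forall k, \forall n \near \oo, Q k n) ->
  exists phi : nat -> nat, (forall k, (k <= phi k)%N) /\ forall k, Q k (phi k).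
Proof.
move=> h; have /choice[phi hphi] : forall k, exists n, (k <= n)%N /\ Q k n.
  move=> k; have [K _ hK] := h k; exists (maxn k K); split; first exact: leq_maxl.
  by apply: hK; exact: leq_maxr.
by exists phi; split => k; case: (hphi k).
Qed.

Lemma pow2_gt0 (k : nat) : 0 < (2 ^- k : R).
Proof. by rewrite invr_gt0 exprn_gt0. Qed.

(* The limit is taken along a rapidly converging subsequence, and set to 0 off
   the full event where its increments are absolutely summable. *)
Lemma L2_complete (u : nat -> Omega -> H) : (forall n, M2 mea (u n)) ->
  (forall e : R, 0 < e -> exists K, forall m n, (K <= m)%N -> (K <= n)%N ->
     nrm (fun w => u m w - u n w) <= e) ->
  exists X, M2 mea X /\ nrm (fun w => u n w - X w) @[n --> \oo] --> 0.
Proof.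
move=> hu cu.
have hB m n : M2 mea (fun w => u m w - u n w) by exact: (M2B ipP sepH smea (fun _ => id)).
have /choice[psi hpsi] : forall k, exists K, forall m n, (K <= m)%N -> (K <= n)%N ->
    nrm (fun w => u m w - u n w) <= 2 ^- k by move=> k; apply: cu; exact: pow2_gt0.
(* The maxima make [phi] nondecreasing, at least k, and at least [psi k], so that consecutive terms
   of the subsequence differ by at most 2^-k in norm. *)
pose phi := fix phi k := if k is j.+1 then maxn (maxn (psi k) k) (phi j) else psi 0%N.
have psiphi k : (psi k <= phi k)%N by case: k => //= k; rewrite !leq_max leqnn.
have phiS k : (phi k <= phi k.+1)%N by rewrite /= leq_maxr.
pose g k w := u (phi k.+1) w - u (phi k) w.
have hg k : M2 mea (g k) by exact: hB.
have ng k : nrm (g k) <= 2 ^- k.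
  by apply: hpsi => //; exact: leq_trans (phiS k).
have aeE := ae_summable hg ng.
pose E := [set w | (\sum_(0 <= k <oo) (`|g k w|)%:E < +oo)%E].
have mE : measurable E.
  have m : measurable_fun setT (fun w => \sum_(0 <= k <oo) (`|g k w|)%:E)%E.
    apply: ge0_emeasurable_sum => // k _.
    by apply/measurable_EFinP/rmeas_measurable; exact: M2_norm (hg k).
  rewrite -[E]setTI.
  exact: (emeasurable_fun_infty_o measurableT m).
have cE w : E w -> cvgn (fun k => u (phi k) w).
  move=> Ew; have /normed_cvg := nneseries_lty_cvg (fun k => normr_ge0 (g k w)) Ew.
  move=> c; rewrite (_ : (fun k => _) = (fun k => series (g^~ w) k + u (phi 0%N) w)).
    by apply: is_cvgD => //; exact: is_cvg_cst.
  apply/funext => k; rewrite /series/=; elim: k => [|k IH]; first by rewrite big_nil add0r.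
  by rewrite big_nat_recr//= /g addrAC -IH addrC subrK.
pose v k w := (\1_E w : R) *: u (phi k) w.
have cv w : cvgn (v^~ w).
  rewrite /v; have [/set_mem Ew|Ew] := boolP (w \in E).
    by apply: is_cvgZr => //; exact: cE.
  rewrite indicE (negbTE Ew) (_ : (fun k => _) = cst 0); first exact: is_cvg_cst.
  by apply/funext => k; rewrite scale0r.
pose X w : H := limn (v^~ w).
have cvX w : v^~ w @ \oo --> X w by exact: cv.
have bv k : borel_measurable mea (v k).
  apply: (borelZ smea ipP sepH); last by case: (hu (phi k)).
  by apply/rmeas_measurable; exact: measurable_indic.
have bX : borel_measurable mea X.
  apply: (weak_borel smea ipP sepH) => h; apply/rmeas_measurable.
  apply: (@measurable_fun_cvg _ _ _ _ (fun k w => ip (v k w) h)) => [k|w _].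
    by apply/rmeas_measurable; exact: (borel_ip smea ipP).
  have ci := @ip_continuous _ _ _ ipP h (X w).
  exact: (cvg_comp (v^~ w) (fun x => ip x h) (cvX w) ci).
have phi_ge k : (k <= phi k)%N by case: k => //= k; rewrite !leq_max leqnn orbT.
have close e : 0 < e -> \forall n \near \oo,
    M2 mea (fun w => X w - u n w) /\ nrm (fun w => X w - u n w) <= e.
  move=> e0; have [K hK] := cu e e0; near=> n.
  apply: (@fatou_nrm (fun k w => u (phi k) w - u n w)) => //.
  - by apply: (borelB smea ipP sepH) => //; case: (hu n).
  - apply: filterS aeE => w Ew; apply: cvgB; last exact: cvg_cst.
    rewrite (_ : (fun k => u (phi k) w) = v^~ w); first exact: cvX.
    by apply/funext => k; rewrite /v indicE mem_set// scale1r.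
  - exact: ltW.
  near=> k; apply: hK; last by near: n; exists K.
  by apply: leq_trans (phi_ge k); near: k; exists K.
exists X; split.
  have [n _ /(_ n (leqnn n))[h _]] := close 1 ltr01.
  have := M2D ipP sepH smea (fun _ => id) h (hu n).
  by under eq_fun do rewrite subrK.
apply/cvgr0Pnorm_le => e e0; apply: filterS (close e e0) => n [_].
by rewrite nrmBC ger0_norm ?nrm_ge0.
Unshelve. all: by end_near. Qed.

(** Along one common subsequence both [u] and [v] converge almost surely, and then the closedness of
    the graph in H * H applies at each sample point. *)
Lemma closed_L2 (D : set H) (A : H -> H) (u v : nat -> Omega -> H) X Y :
  closed_operator D A -> (forall n, M2 mea (u n)) -> (forall n, M2 mea (v n)) ->
  M2 mea X -> M2 mea Y ->
  nrm (fun w => u n w - X w) @[n --> \oo] --> 0 ->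
  nrm (fun w => v n w - Y w) @[n --> \oo] --> 0 ->
  (forall n, {ae P, forall w, D (u n w) /\ A (u n w) = v n w}) ->
  {ae P, forall w, D (X w) /\ A (X w) = Y w}.
Proof.
move=> clA hu hv hX hY /cvgr0Pnorm_le cu /cvgr0Pnorm_le cv huv.
have [|phi [_ hphi]] := @fast_subseq (fun k n =>
    nrm (fun w => u n w - X w) <= 2 ^- k /\ nrm (fun w => v n w - Y w) <= 2 ^- k).
  move=> k; near=> n; split.
    by apply: le_trans (ler_norm _) _; near: n; apply: cu; exact: pow2_gt0.
  by apply: le_trans (ler_norm _) _; near: n; apply: cv; exact: pow2_gt0.
have hB Z Z' : M2 mea Z -> M2 mea Z' -> M2 mea (fun w => Z w - Z' w).
  exact: (M2B ipP sepH smea (fun _ => id)).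
have au : {ae P, forall w, u (phi k) w - X w @[k --> \oo] --> 0}.
  by apply: ae_cvg0 => k; [exact: hB|case: (hphi k)].
have av : {ae P, forall w, v (phi k) w - Y w @[k --> \oo] --> 0}.
  by apply: ae_cvg0 => k; [exact: hB|case: (hphi k)].
have /ae_foralln huv' := fun k => huv (phi k).
near=> w.
have cX : u (phi k) w @[k --> \oo] --> X w.
  by apply/subr_cvg0; near: w.
have cY : v (phi k) w @[k --> \oo] --> Y w.
  by apply/subr_cvg0; near: w.
have hw k : D (u (phi k) w) /\ A (u (phi k) w) = v (phi k) w.
  by move: k; near: w.
have : [set p : H * H | D p.1 /\ p.2 = A p.1] (X w, Y w).
  apply: (@closed_cvg _ _ \oo _ (fun k => (u (phi k) w, v (phi k) w)) _ clA).
    by apply: nearW => k /=; have [? ->] := hw k.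
  exact: cvg_pair.
by move=> /= [? ->].
Unshelve. all: by end_near. Qed.

End Completeness.

(** * Wiener increments *)

Section Independence.
Context {d : measure_display} {Omega : measurableType d} {R : realType}.
Variable P : probability Omega R.
Implicit Types X Y : Omega -> R.

(** Independence says that the joint law agrees with the product of the marginal laws on rectangles,
    hence everywhere; Fubini for x * y then gives both the integrability and the factorisation. *)
Lemma indep_mean X Y : integ P X -> integ P Y ->
  (forall A B, measurable A -> measurable B ->
     P (X @^-1` A `&` Y @^-1` B) = (P (X @^-1` A) * P (Y @^-1` B))%E) ->
  integ P (fun w => X w * Y w) /\ mean P (fun w => X w * Y w) = mean P X * mean P Y.
Proof.
move=> iX iY ind.
have /rmeas_measurable mX := integ_meas iX; have /rmeas_measurable mY := integ_meas iY.
have mXY : measurable_fun setT (fun w => (X w, Y w)) by exact/measurable_fun_pair.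
pose X' : {mfun Omega >-> R} := HB.pack X (isMeasurableFun.Build _ _ _ _ X mX).
pose Y' : {mfun Omega >-> R} := HB.pack Y (isMeasurableFun.Build _ _ _ _ Y mY).
pose Z' : {mfun Omega >-> (R * R)%type} := HB.pack (fun w => (X w, Y w)) (isMeasurableFun.Build _ _ _ _ _ mXY).
pose m1 := distribution P X'; pose m2 := distribution P Y'; pose m := distribution P Z'.
have mE A : measurable A -> (m1 \x m2)%E A = m A.
  by move=> mA; apply: product_measure_unique => // B C mB mC; exact: ind.
pose f (z : R * R) := (z.1 * z.2)%:E.
have mf : measurable_fun setT f.
  by apply/measurable_EFinP; apply: measurable_funM; [exact: measurable_fst|exact: measurable_snd].
have intE (g : R * R -> \bar R) : (\int[m1 \x m2]_z g z = \int[m]_z g z)%E.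
  by apply: eq_measure_integral => // A mA _; exact: mE.
have i1 : m1.-integrable setT (EFin : R -> \bar R).
  by apply: integrable_pushforward => //; rewrite preimage_setT.
have i2 : m2.-integrable setT (EFin : R -> \bar R).
  by apply: integrable_pushforward => //; rewrite preimage_setT.
have e1 : (\int[m1]_x x%:E = (mean P X)%:E)%E.
  by rewrite mean_EFin// integral_distribution.
have e2 : (\int[m2]_x x%:E = (mean P Y)%:E)%E.
  by rewrite mean_EFin// integral_distribution.
have iff : (m1 \x m2)%E.-integrable setT f.
  apply/(integrable12ltyP _ _ mf).
  have /integrableP[_ l1] := i1; have /integrableP[_ l2] := i2.
  have hx x : (\int[m2]_y `|f (x, y)| = `|x%:E| * \int[m2]_y `|y%:E|)%E.
    rewrite -ge0_integralZl//; last exact/measurable_EFinP.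
    by apply: eq_integral => y _; rewrite /f /= normrM.
  under eq_integral do rewrite hx.
  rewrite /= ge0_integralZr//; last by exact: integral_ge0.
    by rewrite lte_mul_pinfty ?integral_ge0// ge0_fin_numE ?integral_ge0.
  exact/measurable_EFinP.
have iXY : integ P (fun w => X w * Y w).
  have /integrableP[_ l] := iff; apply/integrableP; split.
    by apply/measurable_EFinP; exact: measurable_funM.
  move: l; rewrite (intE (fun z => `|f z|)%E) ge0_integral_distribution//.
  exact: measurableT_comp.
split => //; apply: EFin_inj; rewrite mean_EFin//.
transitivity (\int[m]_z f z)%E; first by rewrite integral_distribution.
rewrite -intE -integral12_prod_meas1// /fubini_F.
under eq_integral => x _.
  under eq_integral => y _ do rewrite /f /= EFinM.
  rewrite integralZl//= e2. over.
by rewrite /= integralZr//= e1 -EFinM.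
Qed.

End Independence.

(** * Symmetry and second moment of the centred normal law *)

Section NormalMoments.
Context {R : realType} (s : R) (s_gt0 : 0 < s).
Local Notation mu := (@lebesgue_measure R).
Local Notation nu := (normal_prob (0 : R) s).
Local Notation pdf := (normal_pdf (0 : R) s).

Lemma pdfE x : pdf x = normal_peak s * expR (- (2 * s ^+ 2)^-1 * (x * x)).
Proof.
rewrite normal_pdfE ?gt_eqF//; congr (_ * _); rewrite /normal_fun subr0; congr expR.
by rewrite -[s ^+ 2 *+ 2]mulr_natl mulNr mulrC expr2 mulNr.
Qed.

(** The Radon-Nikodym derivative and the explicit density have the same integral over every
    measurable set, so they agree almost everywhere. *)
Lemma normal_change (f : R -> \bar R) : measurable_fun setT f -> (forall x, 0 <= f x)%E ->
  (\int[nu]_x f x = \int[mu]_x (f x * (pdf x)%:E))%E.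
Proof.
move=> mf f0; have dom := @normal_prob_dominates R 0 s.
rewrite -(Radon_Nikodym_SigmaFinite.change_of_variables dom f0 measurableT mf).
have mp : measurable_fun setT (EFin \o pdf) by apply/measurable_EFinP; exact: measurable_normal_pdf.
have ae : ae_eq mu setT (Radon_Nikodym_SigmaFinite.f nu mu) (EFin \o pdf).
  apply: integral_ae_eq => //; first exact: Radon_Nikodym_SigmaFinite.f_integrable.
  by move=> A _ mA; rewrite -Radon_Nikodym_SigmaFinite.f_integral.
apply: ae_eq_integral => //.
- apply: emeasurable_funM => //.
  by have /integrableP[] := Radon_Nikodym_SigmaFinite.f_integrable dom.
- exact: emeasurable_funM.
- by apply: filterS ae => x /(_ Logic.I) h _; rewrite h.
Qed.

Lemma normal_probN (C : set R) : measurable C -> nu (-%R @^-1` C) = nu C.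
Proof.
move=> mC; rewrite /normal_prob.
transitivity (\int[pushforward mu (-%R : _ -> measurableTypeR R)]_(x in C) (pdf x)%:E)%E; last first.
  by apply: eq_measure_integral => A mA _; exact: lebesgue_measureN.
rewrite ge0_integral_pushforward//.
- by apply: eq_integral => x _ /=; rewrite !pdfE mulrNN.
- by apply/measurable_EFinP/measurable_funTS; exact: measurable_normal_pdf.
- by move=> x _; rewrite lee_fin normal_pdf_ge0.
Qed.

Let e x := expR (- (2 * s ^+ 2)^-1 * (x * x)) : R.

Let e_derive (x : R) : is_derive x 1 (e : R^o -> R^o) (- x / s ^+ 2 * e x).
Proof.
have h : is_derive x 1 (fun y : R^o => - (2 * s ^+ 2)^-1 * (y * y) : R^o) (- x / s ^+ 2).
  apply: is_derive_eq; rewrite scaler1 /GRing.scale/=; field.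
  by rewrite gt_eqF.
have := @is_derive1_comp _ expR (fun y : R^o => - (2 * s ^+ 2)^-1 * (y * y) : R^o) x _ _ (is_derive_expR _) h.
by rewrite [X in _ -> is_derive _ _ _ X]mulrC.
Qed.

(** An antiderivative of (x^2 - s^2) e(x), by which the second moment is compared with s^2 times the
    total mass. *)
Let G (x : R) : R := - s ^+ 2 * (x * e x).

Let G_derive (x : R) : is_derive x 1 (G : R^o -> R^o) ((x ^+ 2 - s ^+ 2) * e x).
Proof.
have he := e_derive x.
apply: is_derive_eq; rewrite scaler1 /GRing.scale/=; field.
by rewrite gt_eqF.
Qed.

Let e_cont : continuous (e : R^o -> R^o).
Proof. by move=> x; apply: differentiable_continuous; apply/derivable1_diffP; have [] := e_derive x. Qed.

(** From exp(y) >= 1 + y with y = x^2 / (2 s^2): the Gaussian factor is at most 2 s^2 / x^2. *)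
Let G_bound n : `|G n.+1%:R| <= 2 * s ^+ 4 / n.+1%:R.
Proof.
have n0 : 0 < n.+1%:R :> R by [].
have s2 : 0 < s ^+ 2 by rewrite exprn_gt0.
rewrite /G !normrM normrN !ger0_norm ?expR_ge0 ?sqr_ge0 ?ler0n// /e.
rewrite mulNr expRN -ler_pdivlMl// -ler_pdivlMl//.
rewrite invf_ple ?posrE ?expR_gt0//; last first.
  by rewrite !mulr_gt0 ?invr_gt0// exprn_gt0.
apply: le_trans (expR_ge1Dx _); rewrite -[leLHS]add0r lerD// le_eqVlt; apply/orP; left; apply/eqP.
by field; rewrite gt_eqF// gt_eqF.
Qed.

(** On [-(n+1), n+1] the fundamental theorem of calculus gives s^2 times the mass of the interval
    plus boundary values of [G]; the mass tends to 1 and the boundary values to 0. *)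
Lemma normal_moment2 : (\int[nu]_x (x ^+ 2)%:E = (s ^+ 2)%:E)%E.
Proof.
have mx2 : measurable_fun setT (fun x : R => (x ^+ 2)%:E) by apply/measurable_EFinP; exact: measurable_funX.
have mp : measurable_fun setT (fun x => (pdf x)%:E) by apply/measurable_EFinP; exact: measurable_normal_pdf.
rewrite normal_change//; last by move=> x; rewrite lee_fin sqr_ge0.
pose F n := `[- n.+1%:R, n.+1%:R]%classic : set R.
have ndF : nondecreasing_seq F.
  move=> m n mn; rewrite subsetEset => x; rewrite /F /= !in_itv/= => /andP[h1 h2].
  have : (m.+1%:R : R) <= n.+1%:R by rewrite ler_nat.
  by move: h1 h2; set a := _%:R; set b := _%:R => h1 h2 ab; apply/andP; split; lra.
have UF : \bigcup_i F i = setT.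
  apply/seteqP; split => // x _; exists (Num.truncn `|x|) => //.
  by rewrite /F/= in_itv/= -ler_norml ltW// truncnS_gt.
have c2 : (\int[mu]_(x in F n) ((x ^+ 2)%:E * (pdf x)%:E) @[n --> \oo] -->
    \int[mu]_x ((x ^+ 2)%:E * (pdf x)%:E))%E.
  rewrite -UF; apply: ge0_nondecreasing_set_cvg_integral => //.
  - by move=> n; exact: measurable_itv.
  - by move=> n; apply: measurable_funTS; exact: emeasurable_funM.
  - by move=> n x _; rewrite mule_ge0 ?lee_fin ?sqr_ge0 ?normal_pdf_ge0.
have c0 : (\int[mu]_(x in F n) (pdf x)%:E @[n --> \oo] --> 1%E)%E.
  rewrite -(integral_normal_pdf 0 s) -UF; apply: ge0_nondecreasing_set_cvg_integral => //.
  - by move=> n; exact: measurable_itv.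
  - by move=> n; apply: measurable_funTS.
  - by move=> n x _; rewrite lee_fin normal_pdf_ge0.
have key n : (\int[mu]_(x in F n) ((x ^+ 2)%:E * (pdf x)%:E) =
    (s ^+ 2)%:E * \int[mu]_(x in F n) (pdf x)%:E +
      (normal_peak s * (G n.+1%:R - G (- n.+1%:R)))%:E)%E.
  have mF : measurable (F n) by exact: measurable_itv.
  have cp : continuous (pdf : R^o -> R^o).
    by apply: continuous_normal_pdf; rewrite gt_eqF.
  have iF (f : R^o -> R^o) : continuous f -> mu.-integrable (F n) (EFin \o f).
    move=> cf; apply: continuous_compact_integrable; first exact: segment_compact.
    exact: continuous_subspaceT.
  have i1 : mu.-integrable (F n) (EFin \o (fun x => x ^+ 2 * pdf x)).
    by apply: iF => x; apply: cvgM; [exact: exprn_continuous|exact: cp].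
  have i2 : mu.-integrable (F n) (EFin \o (fun x => s ^+ 2 * pdf x)).
    by apply: iF => x; apply: cvgM; [exact: cvg_cst|exact: cp].
  have h : (\int[mu]_(x in F n) ((x ^+ 2 - s ^+ 2) * e x)%:E =
      (G n.+1%:R)%:E - (G (- n.+1%:R))%:E)%E.
    apply: continuous_FTC2.
    - by rewrite -subr_gt0 opprK addr_gt0.
    - apply: continuous_subspaceT => x; apply: cvgM; last exact: e_cont.
      by apply: cvgB; [exact: exprn_continuous|exact: cvg_cst].
    - have cG : continuous (G : R -> R).
        by move=> x; apply: differentiable_continuous; apply/derivable1_diffP; have [] := G_derive x.
      split; [by move=> x _; have [] := G_derive x|apply: cvg_at_right_filter; exact: cG|].
      by apply: cvg_at_left_filter; exact: cG.
    - by move=> x _; rewrite derive1E; have [_ ->] := G_derive x.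
  have h2 : (\int[mu]_(x in F n) (x ^+ 2 * pdf x)%:E - \int[mu]_(x in F n) (s ^+ 2 * pdf x)%:E =
      (normal_peak s * (G n.+1%:R - G (- n.+1%:R)))%:E)%E.
    transitivity ((normal_peak s)%:E * \int[mu]_(x in F n) ((x ^+ 2 - s ^+ 2) * e x)%:E)%E; last first.
      by rewrite h -EFinB -EFinM.
    rewrite -integralB_EFin// -integralZl//; last first.
      apply: (iF (fun x => (x ^+ 2 - s ^+ 2) * e x)) => x; apply: cvgM; last exact: e_cont.
      by apply: cvgB; [exact: exprn_continuous|exact: cvg_cst].
    by apply: eq_integral => x _; rewrite -EFinM; congr EFin; rewrite pdfE /e; ring.
  have <- : (\int[mu]_(x in F n) (s ^+ 2 * pdf x)%:E = (s ^+ 2)%:E * \int[mu]_(x in F n) (pdf x)%:E)%E.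
    by rewrite -integralZl//; exact: iF.
  by rewrite -h2 [RHS]addeC subeK//; apply: (integrable_fin_num _ i2).
have cG : (fun n => (normal_peak s * (G n.+1%:R - G (- n.+1%:R)))%:E) @ \oo --> 0%:E.
  apply: cvg_EFin; first by near=> n.
  rewrite -(mulr0 (normal_peak s)); apply: cvgMr.
  have GN x : G (- x) = - G x by rewrite /G /e mulrNN; ring.
  have s4 : 0 < 2 * s ^+ 4 + 2 * s ^+ 4 by rewrite addr_gt0// mulr_gt0// exprn_gt0.
  apply/cvgr0Pnorm_le => eps eps0; near=> n.
  rewrite GN opprK; apply: le_trans (ler_normD _ _) _.
  apply: (le_trans (lerD (G_bound n) (G_bound n))).
  rewrite -mulrDl -ler_pdivlMl//.
  near: n; have /cvgrPdist_le := @cvg_harmonic R.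
  move=> /(_ ((2 * s ^+ 4 + 2 * s ^+ 4)^-1 * eps)); rewrite mulr_gt0 ?invr_gt0// => /(_ isT).
  by apply: filterS => n; rewrite /= sub0r normrN ger0_norm.
have c3 : (\int[mu]_(x in F n) ((x ^+ 2)%:E * (pdf x)%:E) @[n --> \oo] --> (s ^+ 2)%:E)%E.
  rewrite (funext key) -[X in _ --> X]adde0 -[X in _ --> (X + _)%E]mule1.
  by apply: cvgeD => //; exact: cvgeZl.
exact: (cvg_unique _ c2 c3).
Unshelve. all: by end_near. Qed.

End NormalMoments.

Section Increments.
Context {d : measure_display} {Omega : measurableType d} {R : realType}.
Variable P : probability Omega R.
Variables (F : R -> set (set Omega)) (filtF : filtration F).
Local Notation mea := (@measurable d Omega).
Local Notation smea := (@sigma_algebra_measurable d Omega).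

Lemma filt_sigma t : 0 <= t -> sigma_algebra setT (F t).
Proof. by case: filtF => h _ _; exact: h. Qed.
Lemma filt_mea t : 0 <= t -> F t `<=` mea.
Proof. by case: filtF => _ h _; exact: h. Qed.
Lemma filt_mono s t : 0 <= s -> s <= t -> F s `<=` F t.
Proof. by case: filtF => _ _ h; exact: h. Qed.

Lemma rmeas_mono (G G' : set (set Omega)) (f : Omega -> R) : G `<=` G' -> rmeas G f -> rmeas G' f.
Proof. by move=> GG h C mC; exact/GG/h. Qed.

Section OneProcess.
Variables (B : R -> Omega -> R) (wB : wiener_process P F B).

Definition inc (s t : R) (w : Omega) : R := B t w - B s w.

Lemma inc_meas s t : 0 <= s -> s <= t -> rmeas (F t) (inc s t).
Proof.
move=> s0 st; have t0 := le_trans s0 st; case: wB => _ mB _ _ _.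
apply: (rmeasB (filt_sigma t0)) => C mC; first exact: mB.
by apply: (filt_mono s0 st); exact: mB.
Qed.

Lemma inc_meas_mea s t : 0 <= s -> s <= t -> rmeas mea (inc s t).
Proof.
by move=> s0 st; apply: rmeas_mono (inc_meas s0 st); apply: filt_mea; exact: le_trans st.
Qed.

Lemma inc_self t : inc t t = fun=> 0.
Proof. by apply/funext => w; rewrite /inc subrr. Qed.

Lemma inc_split s t u w : inc s u w = inc s t w + inc t u w.
Proof. by rewrite /inc; ring. Qed.

(** The mean vanishes because the law is invariant under x |-> -x, so an increment and its opposite
    have the same mean. The Wiener property speaks of s < t only, hence the separate case s = t. *)
Lemma inc_moments s t : 0 <= s -> s <= t ->
  [/\ integ P (inc s t), integ P (fun w => inc s t w ^+ 2), mean P (inc s t) = 0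
    & mean P (fun w => inc s t w ^+ 2) = t - s].
Proof.
move=> s0; rewrite le_eqVlt => /predU1P[<-|st].
  by rewrite inc_self expr0n/= subrr mean_cst; split => //; exact: integ_cst.
have mI := inc_meas_mea s0 (ltW st); have /rmeas_measurable mI' := mI.
have mIN : measurable_fun setT (fun w => - inc s t w) by exact: measurableT_comp.
pose X : {mfun Omega >-> R} := HB.pack (inc s t) (isMeasurableFun.Build _ _ _ _ _ mI').
pose X' : {mfun Omega >-> R} := HB.pack (fun w => - inc s t w) (isMeasurableFun.Build _ _ _ _ _ mIN).
have sg : 0 < Num.sqrt (t - s) by rewrite sqrtr_gt0 subr_gt0.
have law C : measurable C -> distribution P X C = normal_prob 0 (Num.sqrt (t - s)) C.
  by move=> mC; case: wB => _ _ h _ _; exact: h.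
have mJ : measurable_fun setT (inc s t : Omega -> measurableTypeR R) by exact: mI'.
pose Y : {mfun Omega >-> measurableTypeR R} :=
  HB.pack (inc s t : Omega -> measurableTypeR R) (isMeasurableFun.Build _ _ _ _ _ mJ).
have m2 : (\int[P]_w (inc s t w ^+ 2)%:E = (t - s)%:E)%E.
  have mx2 : measurable_fun setT (fun x : measurableTypeR R => ((x : R) ^+ 2)%:E).
    by apply/measurable_EFinP; exact: measurable_funX.
  transitivity (\int[distribution P Y]_x ((x : R) ^+ 2)%:E)%E.
    by rewrite ge0_integral_distribution// => x; rewrite lee_fin sqr_ge0.
  rewrite (@eq_measure_integral _ _ _ _ (normal_prob 0 (Num.sqrt (t - s)))); last first.
    by move=> A mA _; exact: law.
  by rewrite normal_moment2// sqr_sqrtr// subr_ge0 ltW.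
have i2 : integ P (fun w => inc s t w ^+ 2).
  apply/integrableP; split; first by apply/measurable_EFinP; exact: measurable_funX.
  under eq_integral do rewrite /= ger0_norm ?sqr_ge0//.
  by rewrite m2 ltry.
have i1 : integ P (inc s t).
  apply: (@integ_le _ _ _ _ _ (fun w => 1 + inc s t w ^+ 2)) => //.
    by apply: integD => //; exact: integ_cst.
  move=> w; rewrite -[inc s t w ^+ 2]real_normK ?num_real//.
  have := sqr_ge0 (`|inc s t w| - 1); have := normr_ge0 (inc s t w); nra.
have i1N : integ P (fun w => - inc s t w).
  by under eq_fun do rewrite -mulN1r; exact: integZ.
split => //; last by apply: EFin_inj; rewrite mean_EFin.
have e : mean P (fun w => - inc s t w) = mean P (inc s t).
  apply: EFin_inj; rewrite !mean_EFin//.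
  transitivity (\int[distribution P X']_x x%:E)%E; first by rewrite integral_distribution.
  transitivity (\int[distribution P X]_x x%:E)%E; last by rewrite integral_distribution.
  apply: eq_measure_integral => A mA _.
  have mA' : measurable (-%R @^-1` A : set R).
    by rewrite -[X in measurable X]setTI; exact: oppr_measurable.
  transitivity (distribution P X (-%R @^-1` A)) => //.
  rewrite [LHS]law// normal_probN//; exact/esym/law.
have : mean P (fun w => - inc s t w) = - mean P (inc s t).
  by under eq_fun do rewrite -mulN1r; rewrite meanZ// mulN1r.
rewrite e; lra.
Qed.

(** The Wiener property gives independence of events; applied to preimages under Z and under the
    increment or its square, it feeds [indep_mean]. Integrability of the products belongs to the
    conclusion: it rests on independence. *)
Lemma inc_indep s t (Z : Omega -> R) : 0 <= s -> s <= t -> rmeas (F s) Z -> integ P Z ->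
  [/\ integ P (fun w => Z w * inc s t w), mean P (fun w => Z w * inc s t w) = 0,
      integ P (fun w => Z w * inc s t w ^+ 2)
    & mean P (fun w => Z w * inc s t w ^+ 2) = mean P Z * (t - s)].
Proof.
move=> s0; rewrite le_eqVlt => /predU1P[<-|st] mZ iZ.
  rewrite inc_self subrr mulr0; under eq_fun do rewrite mulr0.
  rewrite (_ : (fun w => Z w * 0 ^+ 2) = fun=> 0); last first.
    by apply/funext => w; rewrite expr0n mulr0.
  by rewrite mean_cst; split => //; exact: integ_cst.
have [i1 i2 e1 e2] := inc_moments s0 (ltW st).
have ind A C : measurable A -> measurable C ->
    P (Z @^-1` A `&` inc s t @^-1` C) = (P (Z @^-1` A) * P (inc s t @^-1` C))%E.
  by move=> mA mC; case: wB => _ _ _ h _; apply: h => //; exact: mZ.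
have [] := indep_mean iZ i1 ind; rewrite e1 mulr0 => ? ?.
have [|] := indep_mean iZ i2 _.
  move=> A C mA mC; rewrite -[_ @^-1` C]/(inc s t @^-1` ((fun x => x ^+ 2) @^-1` C)) ind//.
  by rewrite -[X in measurable X]setTI; exact: exprn_measurable.
by rewrite e2.
Qed.

Context {H : completeNormedModType R} (ip : H -> H -> R).
Hypotheses (ipP : inner_product ip) (sepH : separable H).
Implicit Types X Y : Omega -> H.

Lemma M2_mono s t X : 0 <= s -> s <= t -> M2 P (F s) X -> M2 P (F t) X.
Proof. by move=> s0 st [bX iX]; split => // C mC; apply: (filt_mono s0 st); exact: bX. Qed.

Lemma M2_mea s X : 0 <= s -> M2 P (F s) X -> M2 P mea X.
Proof. by move=> s0; apply: M2_sub; exact: filt_mea. Qed.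

Definition term s t X w : H := inc s t w *: X w.

(** A product of two square-integrable functions need not be square-integrable; here |X|^2 is
    independent of the squared increment. *)
Lemma M2_term s t X : 0 <= s -> s <= t -> M2 P (F s) X -> M2 P (F t) (term s t X).
Proof.
move=> s0 st hX; have [bX iX] := hX; have t0 := le_trans s0 st; split.
  by apply: (borelZ (filt_sigma t0) ipP sepH); [exact: inc_meas|case: (M2_mono s0 st hX)].
have mX2 : rmeas (F s) (fun w => `|X w| ^+ 2).
  have mX := borel_norm (filt_sigma s0) bX.
  by under eq_fun do rewrite expr2; exact: (rmeasM (filt_sigma s0)).
have [_ _ h _] := inc_indep s0 st mX2 iX.
by under eq_fun do rewrite normrZ exprMn real_normK ?num_real// mulrC.
Qed.

Lemma M2_term_mea s t X : 0 <= s -> s <= t -> M2 P (F s) X -> M2 P mea (term s t X).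
Proof. by move=> s0 st /(M2_term s0 st); apply: M2_mea; exact: le_trans st. Qed.

Lemma dot_term_same s t X Y : 0 <= s -> s <= t -> M2 P (F s) X -> M2 P (F s) Y ->
  dot P ip (term s t X) (term s t Y) = (t - s) * dot P ip X Y.
Proof.
move=> s0 st hX hY; have [bX _] := hX; have [bY _] := hY.
have [_ _ _ h] := inc_indep s0 st (borel_ip2 (filt_sigma s0) ipP sepH bX bY)
  (ip_integ ipP sepH (M2_mea s0 hX) (M2_mea s0 hY)).
rewrite mulrC -h; congr (mean P _); apply/funext => w.
by rewrite /term (ipZl ipP) (ipZr ipP) mulrA -expr2 mulrC.
Qed.

(** The earlier term and Y are both known at time s', so their product is independent of the later
    increment, which has mean 0. *)
Lemma dot_term_disj s t s' t' X Y : 0 <= s -> s <= t -> t <= s' -> s' <= t' ->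
  M2 P (F s) X -> M2 P (F s') Y -> dot P ip (term s t X) (term s' t' Y) = 0.
Proof.
move=> s0 st ts st' hX hY; have s'0 : 0 <= s' by rewrite (le_trans s0)// (le_trans st).
have hT : M2 P (F s') (term s t X).
  by apply: M2_mono ts _; [exact: le_trans st|exact: M2_term].
have [bT _] := hT; have [bY _] := hY.
have [_ h _ _] := inc_indep s'0 st' (borel_ip2 (filt_sigma s'0) ipP sepH bT bY)
  (ip_integ ipP sepH (M2_mea s'0 hT) (M2_mea s'0 hY)).
rewrite -h; congr (mean P _); apply/funext => w.
by rewrite /term (ipZr ipP) mulrC.
Qed.

(** Length of the intersection of [s, t] and [s', t'], equal to 0 when they do not meet. *)
Definition overlap (s t s' t' : R) : R := Num.max 0 (Num.min t t' - Num.max s s').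

Lemma overlapC s t s' t' : overlap s t s' t' = overlap s' t' s t.
Proof. by rewrite /overlap (minC t) (maxC s). Qed.

(** The intervals are cut at the later of the left ends and at the earlier of the right ends. Pieces
    that follow one another are orthogonal, and the common piece contributes its length. *)
Lemma dot_term s t s' t' X Y : 0 <= s -> s <= t -> 0 <= s' -> s' <= t' ->
  M2 P (F s) X -> M2 P (F s') Y ->
  dot P ip (term s t X) (term s' t' Y) = overlap s t s' t' * dot P ip X Y.
Proof.
wlog ss : s t s' t' X Y / s <= s'.
  move=> h s0 st s'0 st' hX hY; have [ss|/ltW ss] := leP s s'; first exact: h.
  by rewrite dotC// h// overlapC dotC.
move=> s0 st s'0 st' hX hY.
have sum_term a b c Z : term a c Z = (fun w => term a b Z w + term b c Z w).
  by apply/funext => w; rewrite /term (inc_split a b c) scalerDl.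
have [ts|s't] := leP t s'.
  rewrite dot_term_disj// /overlap max_l ?mul0r// subr_le0.
  by rewrite (max_r ss) ge_min ts.
have hX' : M2 P (F s') X by exact: M2_mono hX.
have eqov : overlap s t s' t' = Num.min t t' - s'.
  by rewrite /overlap (max_r ss) max_r// subr_ge0 le_min (ltW s't) st'.
have mT1 := M2_term_mea s0 ss hX; have mT2 := M2_term_mea s'0 (ltW s't) hX'.
have mT3 := M2_term_mea s'0 st' hY.
rewrite (sum_term s s' t) dotDl// dot_term_disj// add0r eqov.
have [tt|/ltW tt] := leP t t'.
  have hY' : M2 P (F t) Y by apply: M2_mono hY => //; exact: ltW.
  have t0 := le_trans s0 st.
  have m1 := M2_term_mea s'0 (ltW s't) hY; have m2 := M2_term_mea t0 tt hY'.
  rewrite (sum_term s' t t' Y) dotC// dotDl// [X in _ + X]dotC// (@dot_term_disj s' t t t')// ?addr0; last exact: ltW.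
  by rewrite dotC// dot_term_same//; exact: ltW.
have t'0 := le_trans s'0 st'.
have hX'' : M2 P (F t') X by exact: M2_mono hX'.
have m1 := M2_term_mea s'0 st' hX'; have m2 := M2_term_mea t'0 tt hX''.
rewrite (sum_term s' t' t X) dotDl// (@dotC _ _ _ _ _ _ ipP (term t' t X))// (@dot_term_disj s' t' t' t)// addr0.
by rewrite dot_term_same.
Qed.

End OneProcess.
End Increments.

(** * Orthogonality of increments of different Wiener processes *)

Section CrossVariation.
Context {d : measure_display} {Omega : measurableType d} {R : realType}.
Variable P : probability Omega R.
Variables (F : R -> set (set Omega)) (filtF : filtration F).
Variables (W : nat -> R -> Omega -> R).
Hypotheses (wW : forall i, wiener_process P F (W i)) (indW : independent_processes P W).
Local Notation mea := (@measurable d Omega).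
Local Notation smea := (@sigma_algebra_measurable d Omega).

Lemma process_sigma_sigma (B : R -> Omega -> R) : sigma_algebra setT (process_sigma B).
Proof. exact: smallest_sigma_algebra. Qed.

Lemma inc_process (B : R -> Omega -> R) s t : 0 <= s -> s <= t -> rmeas (process_sigma B) (inc B s t).
Proof.
move=> s0 st; have h u : 0 <= u -> rmeas (process_sigma B) (B u).
  by move=> u0 C mC; apply: sub_sigma_algebra; exists u, C.
by apply: (rmeasB (process_sigma_sigma B)); apply: h => //; exact: le_trans st.
Qed.

Lemma indep_pair i j (A C : set Omega) : i != j -> process_sigma (W i) A -> process_sigma (W j) C ->
  P (A `&` C) = (P A * P C)%E.
Proof.
move=> ij hA hC; have ji : (j == i) = false by rewrite eq_sym (negbTE ij).
have := indW (J := [:: i; j]) (E := fun k => if k == i then A else C).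
rewrite /= inE ij !big_cons big_nil mule1 eqxx ji => <- //.
  congr (P _); apply/seteqP; split=> w /=.
    by move=> [wA wC] k /=; rewrite !inE => /orP[]/eqP->; rewrite ?eqxx ?ji.
  by move=> h; split; [have := h i|have := h j]; rewrite /= !inE eqxx ?orbT ?ji; exact.
by move=> k; rewrite !inE => /orP[]/eqP->; rewrite ?eqxx ?ji.
Qed.

Lemma mul_integ (f g : Omega -> R) : rmeas mea f -> rmeas mea g ->
  integ P (fun w => f w ^+ 2) -> integ P (fun w => g w ^+ 2) -> integ P (fun w => f w * g w).
Proof.
move=> mf mg i2 j2; apply: (@integ_le _ _ _ _ _ (fun w => f w ^+ 2 + g w ^+ 2)).
- exact: (rmeasM smea).
- exact: integD.
move=> w; rewrite ler_norml; apply/andP; split.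
  have := sqr_ge0 (f w + g w); have := sqr_ge0 (f w - g w); nra.
have := sqr_ge0 (f w + g w); have := sqr_ge0 (f w - g w); nra.
Qed.

Lemma bounded_integ (f Z : Omega -> R) (K : R) : integ P f -> rmeas mea Z -> (forall w, `|Z w| <= K) ->
  integ P (fun w => f w * Z w).
Proof.
move=> i mZ ZK; apply: (@integ_le _ _ _ _ _ (fun w => K * `|f w|)).
- by apply: (rmeasM smea) => //; exact: integ_meas i.
- by apply: integZ; exact: integrable_norm i.
by move=> w; rewrite normrM mulrC ler_wpM2r.
Qed.

Section TwoProcesses.
Variables (i j : nat) (ij : i != j) (s t : R) (s0 : 0 <= s) (st : s <= t).
Local Notation D := (inc (W i)).
Local Notation D' := (inc (W j)).

Let inc_sq k u v : 0 <= u -> u <= v -> integ P (fun w => inc (W k) u v w ^+ 2).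
Proof. by move=> u0 uv; have [] := inc_moments filtF (wW k) u0 uv. Qed.

Let inc_mea k u v : 0 <= u -> u <= v -> rmeas mea (inc (W k) u v).
Proof. by move=> u0 uv; exact: (inc_meas_mea filtF (wW k) u0 uv). Qed.

Let x (n k : nat) := s + k%:R * ((t - s) / n.+1%:R).

Let step_ge0 (n : nat) : 0 <= (t - s) / n.+1%:R.
Proof. by rewrite divr_ge0// subr_ge0. Qed.
Let x_mono n k l : (k <= l)%N -> x n k <= x n l.
Proof. by move=> kl; rewrite lerD2l ler_wpM2r ?step_ge0// ler_nat. Qed.
Let x_ge n k : s <= x n k.
Proof. by rewrite lerDl mulr_ge0 ?step_ge0. Qed.
Let x_ge0 n k : 0 <= x n k.
Proof. exact: le_trans (x_ge n k). Qed.
Let xS n k : x n k.+1 - x n k = (t - s) / n.+1%:R.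
Proof. by rewrite /x -natr1; ring. Qed.
Let xSle n k : x n k <= x n k.+1. Proof. exact: x_mono. Qed.

Let inc_sum (B : R -> Omega -> R) n w : inc B s t w = \sum_(k < n.+1) inc B (x n k) (x n k.+1) w.
Proof.
have e0 : x n 0%N = s by rewrite /x mul0r addr0.
have e1 : x n n.+1 = t by rewrite /x mulrCA divff ?mulr1 1?addrC ?subrK// pnatr_eq0.
have := telescope_sumr (fun k => B (x n k) w) (leq0n n.+1).
by rewrite big_mkord e0 e1 => h; exact: esym h.
Qed.

(* Each W_i is independent of F s, but nothing is assumed on the pair (W_i, W_j).
   Cut [s, t] into n pieces: the products of increments over two different pieces
   integrate to 0 against Z by the Wiener property alone, and the second moment of
   the sum of the remaining products is (t - s)^2 / n. *)
Let Q n w := \sum_(k < n.+1) D (x n k) (x n k.+1) w * D' (x n k) (x n k.+1) w.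

Let DD_integ n (k l : nat) : integ P (fun w => D (x n k) (x n k.+1) w * D' (x n l) (x n l.+1) w).
Proof. by apply: mul_integ; [exact: inc_mea|exact: inc_mea|exact: inc_sq|exact: inc_sq]. Qed.

Let mean_DD a n (k l : nat) : mean P (fun w => inc (W a) (x n k) (x n k.+1) w * inc (W a) (x n l) (x n l.+1) w)
  = (if k == l then (t - s) / n.+1%:R else 0).
Proof.
have [_ _ _ m2] := inc_moments filtF (wW a) (x_ge0 n k) (xSle n k).
case: eqP => [<-|/eqP kl]; first by rewrite -(xS n k) -m2.
wlog lt : k l kl {m2} / (k < l)%N.
  move=> h; case: (ltngtP k l) => [lt|lt|e]; [exact: h|rewrite -(h l k)//|by rewrite e eqxx in kl].
    by congr (mean P _); apply/funext => w; rewrite mulrC.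
  by rewrite eq_sym.
have [i1 _ _ _] := inc_moments filtF (wW a) (x_ge0 n k) (xSle n k).
have [//|_ -> //] := inc_indep filtF (wW a) (x_ge0 n l) (xSle n l) _ i1.
apply: rmeas_mono (inc_meas filtF (wW a) (x_ge0 n k) (xSle n k)).
by apply: (filt_mono filtF) => //; exact: x_mono.
Qed.

Let Q_sq n : integ P (fun w => Q n w ^+ 2) /\ mean P (fun w => Q n w ^+ 2) = (t - s) ^+ 2 / n.+1%:R.
Proof.
(* Grouped by process: the first factor depends on W_i alone and the second on W_j alone, so
   independence of the processes factorises the mean, and only k = l survives. *)
pose q k l w := (D (x n k) (x n k.+1) w * D (x n l) (x n l.+1) w) *
                (D' (x n k) (x n k.+1) w * D' (x n l) (x n l.+1) w).
have Qq w : Q n w ^+ 2 = \sum_(k < n.+1) \sum_(l < n.+1) q k l w.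
  rewrite expr2 /Q mulr_suml; apply: eq_bigr => k _; rewrite mulr_sumr.
  by apply: eq_bigr => l _; rewrite /q; ring.
have hq k l : integ P (q k l) /\ mean P (q k l) = if k == l then ((t - s) / n.+1%:R) ^+ 2 else 0.
  have p a := rmeasM (process_sigma_sigma (W a)) (@inc_process (W a) _ _ (x_ge0 n k) (xSle n k))
     (@inc_process (W a) _ _ (x_ge0 n l) (xSle n l)).
  have i1 a : integ P (fun w => inc (W a) (x n k) (x n k.+1) w * inc (W a) (x n l) (x n l.+1) w).
    by apply: mul_integ; [exact: inc_mea|exact: inc_mea|exact: inc_sq|exact: inc_sq].
  have [|a b] := indep_mean (i1 i) (i1 j) _.
    by move=> A C mA mC; apply: (indep_pair ij); exact: p.
  split => //; rewrite [LHS]b !mean_DD; case: eqP => _; by rewrite ?mulr0 ?expr2.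
have i1 k : integ P (fun w => \sum_(l < n.+1) q k l w).
  by apply: integ_sum => l; case: (hq k l).
under eq_fun do rewrite Qq; split; first exact: integ_sum.
rewrite mean_sum//.
transitivity (\sum_(k < n.+1) ((t - s) / n.+1%:R) ^+ 2).
  apply: eq_bigr => k _; rewrite mean_sum; last by move=> l; case: (hq k l).
  rewrite (bigD1 k)//= big1 ?addr0 => [|l lk].
    by case: (hq k k) => _ ->; rewrite eqxx.
  by case: (hq k l) => _ ->; rewrite ifN_eqC.
rewrite sumr_const card_ord -mulr_natl; field.
by rewrite nat1r pnatr_eq0.
Qed.

Let cross_bounded (Z : Omega -> R) (K : R) : rmeas (F s) Z -> (forall w, `|Z w| <= K) ->
  mean P (fun w => D s t w * D' s t w * Z w) = 0.
Proof.
move=> mZ ZK; have mZ' : rmeas mea Z by apply: rmeas_mono mZ; exact: filt_mea.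
have key n : mean P (fun w => D s t w * D' s t w * Z w) = mean P (fun w => Q n w * Z w).
  pose q k l w := D (x n k) (x n k.+1) w * D' (x n l) (x n l.+1) w * Z w.
  have iq k l : integ P (q k l) by exact: bounded_integ (DD_integ n k l) mZ' ZK.
  transitivity (\sum_(k < n.+1) \sum_(l < n.+1) mean P (q k l)).
    under eq_bigr do rewrite -mean_sum//.
    rewrite -mean_sum; last by move=> k; exact: integ_sum.
    congr (mean P _); apply/funext => w; rewrite (inc_sum _ n) (inc_sum (W j) n).
    rewrite mulr_suml mulr_suml; apply: eq_bigr => k _; rewrite mulr_sumr mulr_suml.
    by apply: eq_bigr.
  transitivity (\sum_(k < n.+1) mean P (q k k)).
    apply: eq_bigr => k _; rewrite (bigD1 k)//= big1 ?addr0// => l lk.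
    have mZk m : rmeas (F (x n m)) Z by apply: rmeas_mono mZ; exact: (filt_mono filtF).
    have [lt|lt|e] := ltngtP k l; last by case/eqP: lk; exact/val_inj/esym.
    - have iZ : integ P (fun w => D (x n k) (x n k.+1) w * Z w).
        by apply: bounded_integ mZ' ZK; case: (inc_moments filtF (wW i) (x_ge0 n k) (xSle n k)).
      have [|_ h _ _] := inc_indep filtF (wW j) (x_ge0 n l) (xSle n l) _ iZ.
        apply: (rmeasM (filt_sigma filtF (x_ge0 n l))) => //.
        apply: rmeas_mono (inc_meas filtF (wW i) (x_ge0 n k) (xSle n k)).
        by apply: (filt_mono filtF) => //; exact: x_mono.
      by rewrite -h; congr (mean P _); apply/funext => w; rewrite /q; ring.
    - have iZ : integ P (fun w => D' (x n l) (x n l.+1) w * Z w).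
        by apply: bounded_integ mZ' ZK; case: (inc_moments filtF (wW j) (x_ge0 n l) (xSle n l)).
      have [|_ h _ _] := inc_indep filtF (wW i) (x_ge0 n k) (xSle n k) _ iZ.
        apply: (rmeasM (filt_sigma filtF (x_ge0 n k))) => //.
        apply: rmeas_mono (inc_meas filtF (wW j) (x_ge0 n l) (xSle n l)).
        by apply: (filt_mono filtF) => //; exact: x_mono.
      by rewrite -h; congr (mean P _); apply/funext => w; rewrite /q; ring.
  rewrite -mean_sum//; congr (mean P _); apply/funext => w.
  by rewrite /Q mulr_suml.
have iQ n : integ P (Q n) by exact: integ_sum.
have K0 : 0 <= K by have := ZK point; exact: le_trans.
have bound n : mean P (fun w => D s t w * D' s t w * Z w) ^+ 2 <= K ^+ 2 * ((t - s) ^+ 2 / n.+1%:R).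
  have [i2 m2] := Q_sq n.
  have iQZ := bounded_integ (iQ n) mZ' ZK.
  rewrite (key n) -m2; have := mean_norm iQZ.
  have iQn : integ P (fun w => `|Q n w|) by exact: integrable_norm (iQ n).
  have := @mean_sqr_le _ _ _ P _ iQn; under eq_fun do rewrite real_normK ?num_real//.
  move=> /(_ i2) h1 h2.
  have h3 : mean P (fun w => `|Q n w * Z w|) <= K * mean P (fun w => `|Q n w|).
    rewrite -meanZ//; apply: mean_le; [exact: integrable_norm|exact: integZ|].
    by move=> w; rewrite normrM mulrC ler_wpM2r.
  have := le_trans h2 h3; rewrite -ler_sqr ?nnegrE ?mulr_ge0// ?mean_ge0// real_normK ?num_real//.
  by move/le_trans; apply; rewrite exprMn ler_wpM2l ?sqr_ge0.
apply/eqP; rewrite -sqrf_eq0 eq_le sqr_ge0 andbT.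
have lim : K ^+ 2 * ((t - s) ^+ 2 * harmonic n) @[n --> \oo] --> K ^+ 2 * ((t - s) ^+ 2 * 0).
  by apply: cvgMr; apply: cvgMr; exact: cvg_harmonic.
rewrite !mulr0 in lim; rewrite -(cvg_lim _ lim)//; apply: limr_ge; first by apply: cvgP lim.
by near=> n; exact: bound.
Unshelve. all: by end_near. Qed.

(** Z is cut off at level n to reach the bounded case, and dominated convergence removes the
    cut-off; the dominating function is the absolute value of the untruncated product, hence the
    integrability hypothesis. *)
Lemma cross_same (Z : Omega -> R) : rmeas (F s) Z ->
  integ P (fun w => D s t w * D' s t w * Z w) -> mean P (fun w => D s t w * D' s t w * Z w) = 0.
Proof.
move=> mZ iZ; pose ZK (n : nat) w := if `|Z w| <= n%:R then Z w else 0.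
have mZK n : rmeas (F s) (ZK n).
  apply: (@rmeas_comp _ _ _ _ (fun z : R => if `|z| <= n%:R then z else 0)) => //.
  by apply: measurable_fun_ifT => //; apply: measurable_fun_ler => //; exact: measurableT_comp.
have m0 n : mean P (fun w => D s t w * D' s t w * ZK n w) = 0.
  apply: (cross_bounded (K := n%:R)) => // w; rewrite /ZK.
  by case: ifP => //; rewrite normr0.
have le n w : `|D s t w * D' s t w * ZK n w| <= `|D s t w * D' s t w * Z w|.
  by rewrite !normrM ler_wpM2l// /ZK; case: ifP => //; rewrite normr0.
have mDD : rmeas mea (fun w => D s t w * D' s t w) by apply: (rmeasM smea); exact: inc_mea.
have mf n : rmeas mea (fun w => D s t w * D' s t w * ZK n w).
  by apply: (rmeasM smea) => //; apply: rmeas_mono (mZK n); exact: filt_mea.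
have iK n : integ P (fun w => D s t w * D' s t w * ZK n w).
  by apply: integ_le (integrable_norm iZ) _ => //.
have [] := @dominated_convergence _ _ _ P setT measurableT
  (fun n w => (D s t w * D' s t w * ZK n w)%:E) (fun w => (D s t w * D' s t w * Z w)%:E)
  (fun w => (`|D s t w * D' s t w * Z w|)%:E).
- by move=> n; apply/measurable_EFinP/rmeas_measurable.
- by case/integrableP: iZ.
- apply: aeW => w _; apply: cvg_near_cst; exists (Num.truncn `|Z w|).+1 => // n /= hn.
  rewrite /ZK ifT// (le_trans (ltW (truncnS_gt _)))// ler_nat//.
- exact: integrable_norm iZ.
- by apply: aeW => w n _; rewrite lee_fin le.
move=> _ _; rewrite (_ : [sequence _]_n = cst 0%E).
  move=> h; apply: EFin_inj; rewrite mean_EFin//.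
  by have /cvg_lim <- // := h; exact: cvg_lim (cvg_cst _).
by apply/funext => n; rewrite /= -mean_EFin// m0.
Qed.

End TwoProcesses.

Context {H : completeNormedModType R} (ip : H -> H -> R).
Hypotheses (ipP : inner_product ip) (sepH : separable H).
Implicit Types X Y : Omega -> H.

Lemma dot_past (B : R -> Omega -> R) s t X Y : wiener_process P F B -> 0 <= s -> s <= t ->
  M2 P (F s) X -> M2 P (F s) Y -> dot P ip X (term B s t Y) = 0.
Proof.
move=> wB s0 st hX hY; have [bX _] := hX; have [bY _] := hY.
have [_ h _ _] := inc_indep filtF wB s0 st (borel_ip2 (filt_sigma filtF s0) ipP sepH bX bY)
  (ip_integ ipP sepH (M2_mea filtF s0 hX) (M2_mea filtF s0 hY)).
rewrite -h; congr (mean P _); apply/funext => w.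
by rewrite /term (ipZr ipP) mulrC.
Qed.

Lemma dot_cross_same i j s t X Y : i != j -> 0 <= s -> s <= t -> M2 P (F s) X -> M2 P (F s) Y ->
  dot P ip (term (W i) s t X) (term (W j) s t Y) = 0.
Proof.
move=> ij s0 st hX hY; have [bX _] := hX; have [bY _] := hY.
have e : (fun w => ip (term (W i) s t X w) (term (W j) s t Y w)) =
    (fun w => inc (W i) s t w * inc (W j) s t w * ip (X w) (Y w)).
  by apply/funext => w; rewrite /term (ipZl ipP) (ipZr ipP) mulrA.
rewrite /dot e; apply: (cross_same ij s0 st).
  exact: (borel_ip2 (filt_sigma filtF s0) ipP sepH bX bY).
rewrite -e; apply: (ip_integ ipP sepH).
  exact: (M2_term_mea filtF (wW i) ipP sepH s0 st hX).
exact: (M2_term_mea filtF (wW j) ipP sepH s0 st hY).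
Qed.

Lemma dot_cross_disj i j s t s' t' X Y : 0 <= s -> s <= t -> t <= s' -> s' <= t' ->
  M2 P (F s) X -> M2 P (F s') Y -> dot P ip (term (W i) s t X) (term (W j) s' t' Y) = 0.
Proof.
move=> s0 st ts st' hX hY; have t0 := le_trans s0 st.
apply: (dot_past (wW j) _ st' _ hY); first exact: le_trans ts.
apply: (M2_mono filtF t0 ts); exact: (M2_term filtF (wW i) ipP sepH s0 st hX).
Qed.

End CrossVariation.

(** * Stochastic integrals as limits of Riemann sums *)

Section Nodes.
Context {R : realType}.
Implicit Types (x y : nat -> R) (n m : nat) (t h c : R).

(** Repeated points are allowed, unlike in [itv_partition]: uniform grids then exist for t = 0, and
    a partition may be continued by a sequence that becomes constant. *)
Definition nodes x n t := [/\ x 0%N = 0, x n = t & forall k, (k < n)%N -> x k <= x k.+1].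
Definition mesh_le x n h := forall k, (k < n)%N -> x k.+1 - x k <= h.
Definition unif t n (k : nat) : R := k%:R * (t / n.+1%:R).

Lemma nodes_mono x n t k l : nodes x n t -> (k <= l)%N -> (l <= n)%N -> x k <= x l.
Proof.
move=> [_ _ h] /subnK <-; elim: (l - k)%N => [|j IH] //= jn.
by apply: le_trans (h _ jn); apply: IH; exact: ltnW.
Qed.

Lemma nodes_in x n t k : nodes x n t -> (k <= n)%N -> 0 <= x k <= t.
Proof.
move=> hx kn; have [x0 xn _] := hx.
by rewrite -{1}x0 -xn !(nodes_mono hx).
Qed.

Lemma nodes_ge0 x n t : nodes x n t -> 0 <= t.
Proof. by move=> hx; have := nodes_in hx (leqnn n) => /andP[]; exact: le_trans. Qed.

Lemma unif_nodes t n : 0 <= t -> nodes (unif t n) n.+1 t.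
Proof.
move=> t0; split; rewrite /unif; first by rewrite mul0r.
  by rewrite mulrCA divff ?mulr1// pnatr_eq0.
by move=> k _; rewrite ler_wpM2r ?divr_ge0// ler_nat.
Qed.

Lemma unif_step t n k : unif t n k.+1 - unif t n k = t / n.+1%:R.
Proof. by rewrite /unif -natr1; ring. Qed.

(** Projection onto [a, b]. The overlap of [p, q] with [a, b] is an increment of this monotone
    function, so sums of overlaps telescope. *)
Definition clamp (a b z : R) := Num.max a (Num.min z b).

Lemma clamp_mono (a b y z : R) : y <= z -> clamp a b y <= clamp a b z.
Proof.
by move=> yz; rewrite /clamp ge_max le_max lexx/= le_max le_min !ge_min lexx yz !orbT.
Qed.

Lemma overlapE (a b p q : R) : a <= b -> p <= q -> overlap a b p q = clamp a b q - clamp a b p.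
Proof.
move=> ab pq; rewrite /overlap /clamp.
have [qa|aq] := leP q a.
  rewrite (min_r (le_trans qa ab)) (max_l (le_trans pq qa)) (min_l (le_trans qa ab)).
  rewrite (min_l (le_trans pq (le_trans qa ab))) (max_l qa) (max_l (le_trans pq qa)).
  by rewrite subrr max_l// subr_le0.
have [bp|pb] := leP b p.
  rewrite (min_l (le_trans bp pq)) (max_r (le_trans ab bp)) (min_r (le_trans bp pq)).
  by rewrite (max_r ab) subrr max_l// subr_le0.
have amb : a <= Num.min b q by rewrite le_min ab ltW.
rewrite (minC q) (max_r amb) max_r// subr_ge0.
by rewrite ge_max amb le_min pq (ltW pb).
Qed.

Lemma overlap_ge0 (a b p q : R) : 0 <= overlap a b p q.
Proof. by rewrite /overlap le_max lexx. Qed.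

Lemma telescope n (u : nat -> R) : \sum_(k < n) (u k.+1 - u k) = u n - u 0%N.
Proof. by rewrite -(big_mkord xpredT (fun k => u k.+1 - u k)) telescope_sumr. Qed.

Lemma overlap_sum (a b : R) y m t : nodes y m t -> 0 <= a -> a <= b -> b <= t ->
  \sum_(l < m) overlap a b (y l) (y l.+1) = b - a.
Proof.
move=> [y0 ym hy] a0 ab bt.
under eq_bigr => l _ do rewrite overlapE ?hy//.
rewrite (telescope m (fun l => clamp a b (y l))) y0 ym /clamp (min_r bt) (max_r ab).
by rewrite (min_l (le_trans a0 ab)) (max_l a0).
Qed.

(** Every interval that starts within h of c and has length at most h lies in [c - h, c + 2 h]. *)
Lemma near_sum x n t c h : nodes x n t -> mesh_le x n h -> 0 <= h ->
  \sum_(k < n) (x k.+1 - x k) * (if `|x k - c| <= h then 1 else 0) <= 3 * h.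
Proof.
move=> [x0 xn hx] mx h0.
apply: (@le_trans _ _ (\sum_(k < n) (clamp (c - h) (c + 2 * h) (x k.+1) - clamp (c - h) (c + 2 * h) (x k)))).
  apply: ler_sum => k _; have xk := hx k (ltn_ord k); have mk := mx k (ltn_ord k).
  case: ifPn => [|_]; last by rewrite mulr0 subr_ge0 clamp_mono.
  rewrite ler_norml mulr1 => /andP[h1 h2]; rewrite /clamp.
  by rewrite !min_l ?max_r//; lra.
rewrite (telescope n (fun k => clamp (c - h) (c + 2 * h) (x k))).
have : clamp (c - h) (c + 2 * h) (x n) <= c + 2 * h by rewrite ge_max ge_min lexx orbT andbT; lra.
have : c - h <= clamp (c - h) (c + 2 * h) (x 0%N) by rewrite le_max lexx.
lra.
Qed.

End Nodes.

Section RiemannSums.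
Context {d : measure_display} {Omega : measurableType d} {R : realType}.
Variable P : probability Omega R.
Variables (F : R -> set (set Omega)) (filtF : filtration F).
Context {H : completeNormedModType R} (ip : H -> H -> R).
Hypotheses (ipP : inner_product ip) (sepH : separable H).
Local Notation mea := (@measurable d Omega).
Local Notation smea := (@sigma_algebra_measurable d Omega).
Implicit Types (x y : nat -> R) (n m : nat) (f g : R -> Omega -> H).

Definition adapted t f := forall tau, 0 <= tau <= t -> M2 P (F tau) (f tau).

Definition RS (B : R -> Omega -> R) x n f (w : Omega) : H :=
  \sum_(k < n) term B (x k) (x k.+1) (f (x k)) w.

Lemma adapted_node t f x n k : nodes x n t -> adapted t f -> (k <= n)%N -> M2 P (F (x k)) (f (x k)).
Proof. by move=> hx hf kn; apply: hf; exact: nodes_in hx kn. Qed.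

Lemma adapted_mea t f tau : adapted t f -> 0 <= tau <= t -> M2 P mea (f tau).
Proof. by move=> hf ht; apply: M2_mea (hf _ ht) => //; case/andP: ht. Qed.

Section One.
Variables (B : R -> Omega -> R) (wB : wiener_process P F B).

Lemma RS_term t x n f k : nodes x n t -> adapted t f -> (k < n)%N ->
  M2 P mea (term B (x k) (x k.+1) (f (x k))).
Proof.
move=> hx hf kn; have /andP[x0 _] := nodes_in hx (ltnW kn).
apply: (M2_term_mea filtF wB ipP sepH x0); first by case: hx => _ _; exact.
exact: adapted_node hx hf (ltnW kn).
Qed.

Lemma RS_M2 t x n f : nodes x n t -> adapted t f -> M2 P mea (RS B x n f).
Proof.
move=> hx hf; rewrite /RS.
have -> : (fun w => \sum_(k < n) term B (x k) (x k.+1) (f (x k)) w) =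
   (fun w => \sum_(k <- index_enum 'I_n | xpredT k) term B (x k) (x k.+1) (f (x k)) w) by [].
apply: (M2_sum ipP sepH smea (fun _ => id)) => k; exact: RS_term hx hf (ltn_ord k).
Qed.

Lemma dot_RS t x n f y m g : nodes x n t -> nodes y m t -> adapted t f -> adapted t g ->
  dot P ip (RS B x n f) (RS B y m g) =
  \sum_(k < n) \sum_(l < m) overlap (x k) (x k.+1) (y l) (y l.+1) * dot P ip (f (x k)) (g (y l)).
Proof.
move=> hx hy hf hg; have hRy := RS_M2 hy hg.
rewrite (dot_suml ipP sepH)//; last by move=> k; exact: RS_term hx hf (ltn_ord k).
apply: eq_bigr => k _; rewrite (dot_sumr ipP sepH); first last.
- exact: RS_term hx hf (ltn_ord k).
- by move=> l; exact: RS_term hy hg (ltn_ord l).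
apply: eq_bigr => l _.
have /andP[x0 _] := nodes_in hx (ltnW (ltn_ord k)); have /andP[y0 _] := nodes_in hy (ltnW (ltn_ord l)).
apply: (dot_term filtF wB ipP sepH) => //.
- by case: hx => _ _; exact.
- by case: hy => _ _; exact.
- exact: adapted_node hx hf (ltnW (ltn_ord k)).
- exact: adapted_node hy hg (ltnW (ltn_ord l)).
Qed.

Lemma RS_isometry t x n f : nodes x n t -> adapted t f ->
  nrm P (RS B x n f) ^+ 2 = \sum_(k < n) (x k.+1 - x k) * nrm P (f (x k)) ^+ 2.
Proof.
move=> hx hf; rewrite -(dotxx P ipP) (dot_RS hx hx hf hf); apply: eq_bigr => k _.
have xS l : (l < n)%N -> x l <= x l.+1 by case: hx => _ _; exact.
rewrite (bigD1 k)//= big1 ?addr0 => [|l lk].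
  rewrite (dotxx P ipP) overlapE ?xS// /clamp (min_l (lexx _)) (max_r (xS _ _))//.
  by rewrite (min_l (xS _ _))// (max_l (lexx _)).
rewrite (_ : overlap _ _ _ _ = 0) ?mul0r//; apply: max_l; rewrite subr_le0.
have [lt|lt|e] := ltngtP k l; last by case/eqP: lk; exact/val_inj/esym.
  by rewrite le_max !ge_min (nodes_mono hx lt (ltnW (ltn_ord l))) !orbT.
by rewrite le_max !ge_min (nodes_mono hx lt (ltnW (ltn_ord k))) !orbT.
Qed.

(** The overlaps play the role of a common refinement: summed over either index they give the
    interval lengths, so both energies become double sums with the same weights as the scalar
    product, and the square is completed term by term. *)
Lemma RS_isometry2 t x n f y m g : nodes x n t -> nodes y m t -> adapted t f -> adapted t g ->
  nrm P (fun w => RS B x n f w - RS B y m g w) ^+ 2 =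
  \sum_(k < n) \sum_(l < m) overlap (x k) (x k.+1) (y l) (y l.+1) *
     nrm P (fun w => f (x k) w - g (y l) w) ^+ 2.
Proof.
move=> hx hy hf hg; have hRx := RS_M2 hx hf; have hRy := RS_M2 hy hg.
have [_ _ xS] := hx; have [_ _ yS] := hy.
have nodx k : (k < n)%N -> 0 <= x k <= t by move=> kn; exact: nodes_in hx (ltnW kn).
have nody k : (k < m)%N -> 0 <= y k <= t by move=> kn; exact: nodes_in hy (ltnW kn).
have nodxS k : (k < n)%N -> x k.+1 <= t by move=> kn; have /andP[] := nodes_in hx kn.
have nodyS k : (k < m)%N -> y k.+1 <= t by move=> kn; have /andP[] := nodes_in hy kn.
rewrite (nrm_subsq ipP sepH)// (dot_RS hx hy hf hg) (RS_isometry hx hf) (RS_isometry hy hg).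
have -> : \sum_(k < n) (x k.+1 - x k) * nrm P (f (x k)) ^+ 2 =
   \sum_(k < n) \sum_(l < m) overlap (x k) (x k.+1) (y l) (y l.+1) * nrm P (f (x k)) ^+ 2.
  apply: eq_bigr => k _; rewrite -mulr_suml (overlap_sum hy)//; [|exact: xS|exact: nodxS].
  by case/andP: (nodx k (ltn_ord k)).
have -> : \sum_(k < m) (y k.+1 - y k) * nrm P (g (y k)) ^+ 2 =
   \sum_(k < n) \sum_(l < m) overlap (x k) (x k.+1) (y l) (y l.+1) * nrm P (g (y l)) ^+ 2.
  rewrite exchange_big/=; apply: eq_bigr => l _; rewrite -mulr_suml.
  under [in RHS]eq_bigr do rewrite overlapC.
  rewrite (overlap_sum hx)//; [|exact: yS|exact: nodyS].
  by case/andP: (nody l (ltn_ord l)).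
rewrite mulr_sumr -sumrB -big_split/=; apply: eq_bigr => k _.
rewrite mulr_sumr -sumrB -big_split/=; apply: eq_bigr => l _.
rewrite (nrm_subsq ipP sepH); first by ring.
  exact: adapted_mea hf (nodx _ (ltn_ord k)).
exact: adapted_mea hg (nody _ (ltn_ord l)).
Qed.

(* The points of p are the allowed discontinuities: f a and f b are compared only
   when no point of p lies between a and b, endpoints included. *)
Definition modulus (p : seq R) t f (eta eps : R) := forall a b, 0 <= a <= t -> 0 <= b <= t ->
  `|a - b| < eta -> (forall c, c \in p -> ~~ (Num.min a b <= c <= Num.max a b)) ->
  nrm P (fun w => f a w - f b w) <= eps.

Definition bounded t f (C : R) := forall a, 0 <= a <= t -> nrm P (f a) <= C.

(* Two Riemann sums are compared on the common refinement of their partitions;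
   the intervals touching a point of p have total length at most 3 h per point. *)
Lemma RS_close p t f eta eps C h x n y m : adapted t f -> modulus p t f eta eps -> bounded t f C ->
  nodes x n t -> nodes y m t -> mesh_le x n h -> mesh_le y m h -> 0 <= h -> h < eta -> 0 <= eps ->
  nrm P (fun w => RS B x n f w - RS B y m f w) ^+ 2 <=
    t * eps ^+ 2 + 4 * C ^+ 2 * ((size p)%:R * (3 * h)).
Proof.
move=> hf hm hC hx hy mx my h0 heta eps0.
have [_ _ xS] := hx; have [_ _ yS] := hy.
have t0 := nodes_ge0 hx.
have C0 : 0 <= C by apply: le_trans (nrm_ge0 _ _) (hC 0 _); rewrite lexx t0.
rewrite (RS_isometry2 hx hy hf hf).
pose near c k : R := if `|x k - c| <= h then 1 else 0.
apply: (@le_trans _ _ (\sum_(k < n) \sum_(l < m) overlap (x k) (x k.+1) (y l) (y l.+1) *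
    (eps ^+ 2 + 4 * C ^+ 2 * \sum_(c <- p) near c k))).
  apply: ler_sum => k _; apply: ler_sum => l _.
  have kx := nodes_in hx (ltnW (ltn_ord k)); have ly := nodes_in hy (ltnW (ltn_ord l)).
  have [->|ov0] := eqVneq (overlap (x k) (x k.+1) (y l) (y l.+1)) 0; first by rewrite !mul0r.
  have ov : 0 < overlap (x k) (x k.+1) (y l) (y l.+1) by rewrite lt0r ov0 overlap_ge0.
  rewrite ler_wpM2l ?overlap_ge0//.
  have dist : `|x k - y l| <= h.
    move: ov; rewrite /overlap lt_max ltxx/= subr_gt0 lt_min !gt_max => /andP[/andP[a1 a2] /andP[a3 a4]].
    have := mx k (ltn_ord k); have := my l (ltn_ord l); rewrite ler_norml; lra.
  have sum0 : 0 <= \sum_(c <- p) near c k by apply: sumr_ge0 => c _; rewrite /near; case: ifP.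
  have [/hasP[c cp cb]|/hasPn hno] := boolP (has (fun c => Num.min (x k) (y l) <= c <= Num.max (x k) (y l)) p).
    have one : 1 <= \sum_(c <- p) near c k.
      have nc : `|x k - c| <= h.
        move: cb dist; rewrite !ler_norml; case: (leP (x k) (y l)) => xy /andP[c1 c2] /andP[d1 d2].
          by apply/andP; split; lra.
        by apply/andP; split; lra.
      rewrite (big_rem c)//= {1}/near nc lerDl.
      by apply: sumr_ge0 => c' _; rewrite /near; case: ifP.
    have le2C : nrm P (fun w => f (x k) w - f (y l) w) <= C + C.
      apply: le_trans (nrmB_le ipP sepH (adapted_mea hf kx) (adapted_mea hf ly)) _.
      by rewrite lerD// hC.
    have := sqr_ge0 eps.
    have : nrm P (fun w => f (x k) w - f (y l) w) ^+ 2 <= (C + C) ^+ 2.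
      by rewrite ler_sqr ?nnegrE ?nrm_ge0 ?addr_ge0.
    have := sqr_ge0 C; nra.
  have : nrm P (fun w => f (x k) w - f (y l) w) <= eps.
    by apply: hm => //; apply: le_lt_trans heta.
  move=> h1; apply: (@le_trans _ _ (eps ^+ 2)); first by rewrite ler_sqr ?nnegrE ?nrm_ge0.
  by rewrite lerDl; apply: mulr_ge0 => //; apply: mulr_ge0 => //; exact: sqr_ge0.
under eq_bigr => k _.
  rewrite -mulr_suml (overlap_sum hy) ?xS//; last 2 first.
  - by have /andP[] := nodes_in hx (ltnW (ltn_ord k)).
  - by have /andP[] := nodes_in hx (ltn_ord k).
  rewrite mulrDr; over.
rewrite big_split/= lerD//.
  rewrite -mulr_suml (telescope n x); case: (hx) => -> -> _; rewrite subr0//.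
under eq_bigr => k _ do rewrite mulrCA mulr_sumr.
rewrite -mulr_sumr ler_wpM2l ?mulr_ge0 ?sqr_ge0// exchange_big/=.
apply: (@le_trans _ _ (\sum_(c <- p) 3 * h)).
  by apply: ler_sum => c _; exact: near_sum hx mx h0.
by rewrite big_const_seq count_predT iter_addr_0 [leRHS]mulr_natl.
Qed.

Definition stoch_lim t f (I : Omega -> H) := forall eps : R, 0 < eps -> exists2 delta : R, 0 < delta &
  forall x n, nodes x n t -> mesh_le x n delta -> nrm P (fun w => RS B x n f w - I w) <= eps.

Definition puc (p : seq R) t f := forall eps : R, 0 < eps -> exists2 eta : R, 0 < eta & modulus p t f eta eps.

Lemma unif_mesh t (h : R) : 0 <= t -> 0 < h -> \forall n \near \oo, mesh_le (unif t n) n.+1 h.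
Proof.
move=> t0 h0; near=> n; move=> k _; rewrite unif_step ler_pdivrMr// mulrC -ler_pdivrMr//.
rewrite (le_trans (ltW (truncnS_gt _)))// ler_nat; near: n.
by exists (Num.truncn (t / h)).+1 => // n /=; apply: leq_trans.
Unshelve. all: by end_near. Qed.

Lemma stoch_lim_unif t f I : 0 <= t -> stoch_lim t f I ->
  nrm P (fun w => RS B (unif t n) n.+1 f w - I w) @[n --> \oo] --> 0.
Proof.
move=> t0 hI; apply/cvgr0Pnorm_le => e e0; have [dl dl0 hd] := hI e e0.
near=> n; rewrite ger0_norm ?nrm_ge0//; apply: hd; first exact: unif_nodes.
by near: n; exact: unif_mesh.
Unshelve. all: by end_near. Qed.

(** The bound of [RS_close] survives in the limit. It involves the integrand only through its
    modulus, its bound and the number of exceptional times, and is therefore uniform over the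
    convolution integrands with varying endpoint. *)
Lemma stoch_lim_close p t f I eta eps C h x n : adapted t f -> M2 P mea I -> stoch_lim t f I ->
  modulus p t f eta eps -> bounded t f C ->
  nodes x n t -> mesh_le x n h -> 0 < h -> h < eta -> 0 <= eps ->
  nrm P (fun w => RS B x n f w - I w) ^+ 2 <=
    t * eps ^+ 2 + 4 * C ^+ 2 * ((size p)%:R * (3 * h)).
Proof.
move=> hf MI hI hm hC hx mx h0 heta eps0; have t0 := nodes_ge0 hx.
set r := _ + _.
have r0 : 0 <= r.
  apply: addr_ge0; first by apply: mulr_ge0 => //; exact: sqr_ge0.
  apply: mulr_ge0; first by apply: mulr_ge0 => //; exact: sqr_ge0.
  by apply: mulr_ge0 => //; apply: mulr_ge0 => //; exact: ltW.
rewrite -[r]sqr_sqrtr// ler_sqr ?nnegrE ?nrm_ge0 ?sqrtr_ge0//.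
apply/ler_addgt0Pr => e e0; have [dl dl0 hd] := hI e e0.
near \oo => m.
have my : mesh_le (unif t m) m.+1 h by near: m; exact: unif_mesh.
have my' : mesh_le (unif t m) m.+1 dl by near: m; exact: unif_mesh.
have hy := unif_nodes m t0.
apply: le_trans (nrm_tri ipP sepH (RS_M2 hx hf) (RS_M2 hy hf) MI) _.
apply: lerD; last exact: hd.
rewrite -ler_sqr ?nnegrE ?nrm_ge0 ?sqrtr_ge0// [leRHS]sqr_sqrtr//.
by apply: (RS_close hf hm hC hx hy mx my) => //; exact: ltW.
Unshelve. all: by end_near. Qed.

Lemma stoch_exists p t f C : 0 <= t -> adapted t f -> puc p t f -> bounded t f C ->
  exists I, M2 P mea I /\ stoch_lim t f I.
Proof.
move=> t0 hf hp hC.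
have small (e : R) : 0 < e -> exists2 dl : R, 0 < dl & forall x n y m, nodes x n t -> nodes y m t ->
    mesh_le x n dl -> mesh_le y m dl -> nrm P (fun w => RS B x n f w - RS B y m f w) <= e.
  (* [eps] and [dl] make each of the two terms of [RS_close] at most e^2 / 2; the summands 1 in t +
     1 and in [K] exclude zero denominators. *)
  move=> e0; pose eps := Num.sqrt (e ^+ 2 / (2 * (t + 1))).
  have t1 : 0 < t + 1 by rewrite ltr_wpDl.
  have eps0 : 0 < eps by rewrite sqrtr_gt0 divr_gt0 ?exprn_gt0// mulr_gt0.
  have [eta eta0 hm] := hp eps eps0.
  pose K := 4 * C ^+ 2 * ((size p)%:R * 3) + 1.
  have K0 : 0 < K.
    apply: ltr_wpDl => //; apply: mulr_ge0; last exact: mulr_ge0.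
    by apply: mulr_ge0 => //; exact: sqr_ge0.
  pose dl := Num.min (eta / 2) (e ^+ 2 / (2 * K)).
  have dl0 : 0 < dl by rewrite lt_min !divr_gt0 ?exprn_gt0 ?mulr_gt0.
  exists dl => // x n y m hx hy mx my.
  rewrite -ler_sqr ?nnegrE ?nrm_ge0 ?(ltW e0)//.
  have dle : dl < eta by rewrite gt_min ltr_pdivrMr// ltr_pMr// ltr1n.
  apply: le_trans (RS_close hf hm hC hx hy mx my (ltW dl0) dle (ltW eps0)) _.
  rewrite [eps ^+ 2]sqr_sqrtr; last by rewrite divr_ge0 ?sqr_ge0// mulr_ge0// ltW.
  have h1 : t * (e ^+ 2 / (2 * (t + 1))) <= e ^+ 2 / 2.
    rewrite mulrA ler_pdivrMr ?mulr_gt0// (_ : e ^+ 2 / 2 * _ = e ^+ 2 * (t + 1)); last by field.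
    by have := sqr_ge0 e; nra.
  have h2 : K * dl <= e ^+ 2 / 2.
    have : dl <= e ^+ 2 / (2 * K) by rewrite ge_min lexx orbT.
    by rewrite invfM mulrA ler_pdivlMr// mulrC.
  have : 4 * C ^+ 2 * ((size p)%:R * (3 * dl)) <= K * dl.
    rewrite (_ : K * dl = 4 * C ^+ 2 * ((size p)%:R * (3 * dl)) + dl); last by rewrite /K; ring.
    by rewrite lerDl ltW.
  lra.
have hU n := RS_M2 (unif_nodes n t0) hf.
have [|I [MI cI]] := L2_complete ipP sepH hU.
  move=> e e0; have [dl dl0 hd] := small e e0.
  have [K _ hK] := unif_mesh t0 dl0.
  by exists K => m n Km Kn; apply: hd => //; [exact: unif_nodes|exact: unif_nodes|exact: hK|exact: hK].
exists I; split => // e e0.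
have [dl dl0 hd] := small (e / 2) (divr_gt0 e0 (ltr0Sn _ 1)).
exists dl => // x n hx mx.
near \oo => m.
apply: le_trans (nrm_tri ipP sepH (RS_M2 hx hf) (hU m) MI) _.
rewrite [leRHS]splitr lerD//.
  by apply: hd => //; [exact: unif_nodes|near: m; exact: unif_mesh].
apply: le_trans (ler_norm _) _; near: m.
by move/cvgr0Pnorm_le: cI; apply; rewrite divr_gt0.
Unshelve. all: by end_near. Qed.

End One.
End RiemannSums.

(** * The resolvent equation on a grid *)

Section OperatorFamily.
Context {R : realType} {H : completeNormedModType R}.
Variables (S : R -> H -> H) (T : R) (T_gt0 : 0 < T).
Hypotheses (bS : forall t, 0 <= t -> bounded_operator (S t))
  (cS : forall x, {within `[0, +oo[, continuous (fun t : R => S t x)}).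

Lemma opB t x y : 0 <= t -> S t (x - y) = S t x - S t y.
Proof.
by move=> t0; have [L _] := bS t0; have := L (-1) y x; rewrite !scaleN1r addrC => ->; rewrite addrC.
Qed.
Lemma op0 t : 0 <= t -> S t 0 = 0.
Proof. by move=> t0; have := opB 0 0 t0; rewrite !subrr. Qed.
Lemma opZ t k x : 0 <= t -> S t (k *: x) = k *: S t x.
Proof. by move=> t0; have [L _] := bS t0; rewrite -[k *: x]addr0 L op0// addr0. Qed.
Lemma op_unif_continuous x (e : R) : 0 < e -> \forall n \near \oo, forall a b,
  0 <= a <= T -> 0 <= b <= T -> `|a - b| <= n.+1%:R^-1 -> `|S a x - S b x| <= e.
Proof.
move=> e0.
have := @segment_compact R 0 T; rewrite compact_near_coveringP -near_covering_withinP.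
move=> /(_ nat \oo (fun n a => forall b, 0 <= b <= T -> `|a - b| <= n.+1%:R^-1 -> `|S a x - S b x| <= e)).
case=> [|n0 _ hn0]; last first.
  exists n0 => // n hn a b ha hb ab; apply: (hn0 n hn a) => //=.
move=> a /= aT; have a0 : 0 <= a by move: aT; rewrite in_itv/= => /andP[].
have /subspace_continuousP cSx := @cS x; move: (cSx a); rewrite /= in_itv/= a0 => /(_ isT)/cvgrPdist_le.
move=> /(_ (e / 2)); rewrite divr_gt0// => /(_ isT)[dl /= dl0 hd].
have hd' b : 0 <= b -> `|a - b| < dl -> `|S a x - S b x| <= e / 2.
  by move=> b0 ab; apply: hd => //=; rewrite in_itv/= b0.
near=> a' n => /= a'T b /andP[b0 bT] ab.
have a'0 : 0 <= a' by move: a'T; rewrite in_itv/= => /andP[].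
have aa' : `|a - a'| < dl / 2.
  by near: a'; apply: cvgr_dist_lt => //; rewrite divr_gt0.
have ndl : n.+1%:R^-1 <= dl / 2.
  near: n; have /cvgrPdist_le := @cvg_harmonic R => /(_ (dl / 2)).
  rewrite divr_gt0// => /(_ isT); apply: filterS => n.
  by rewrite /= sub0r normrN ger0_norm.
rewrite [leRHS]splitr; apply: le_trans (ler_distD (S a x) _ _) _.
apply: lerD; first by rewrite distrC hd'// (lt_trans aa')// ltr_pdivrMr// ltr_pMr// ltr1n.
apply: hd' => //; rewrite [ltRHS]splitr; apply: le_lt_trans (ler_distD a' _ _) _.
by rewrite ltr_leD// (le_trans ab).
Unshelve. all: by end_near. Qed.

(** The uniform boundedness principle. Pointwise bounds come from uniform continuity of an orbit: at
    a scale 1/(n+1) where it varies by at most 1, walking from 0 to t costs at most 1 per step. *)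
Lemma op_bounded : exists2 M : R, 0 <= M & forall t x, 0 <= t <= T -> `|S t x| <= M * `|x|.
Proof.
pose FS := [set f : H -> H | exists2 t, 0 <= t <= T & f = S t].
have [||M hM] := @Banach_Steinhauss R H H FS _ _ 1.
- move=> _ [t /andP[t0 _] ->]; have [L [M hM]] := bS t0; split => [r|k x y].
    exists (`|M| * r) => x xr; apply: le_trans (hM x) _.
    by rewrite (le_trans (ler_wpM2r _ (ler_norm M)))// ler_wpM2l.
  exact: L.
- move=> x; have [n _ /(_ n (leqnn n)) hn] := op_unif_continuous x ltr01.
  suff h k : (forall t, 0 <= t <= T -> t <= k%:R * n.+1%:R^-1 -> `|S t x| <= `|S 0 x| + k%:R).
    exists (`|S 0 x| + (Num.truncn (T * n.+1%:R)).+1%:R) => _ [t tT ->]; apply: h => //.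
    case/andP: tT => _ tT; rewrite ler_pdivlMr//; apply: le_trans (ltW (truncnS_gt _)).
    by rewrite ler_wpM2r.
  elim: k => [t /andP[t0 _]|k IH t /andP[t0 tT] tk].
    by rewrite mul0r => t0'; rewrite (le_anti (_ : t <= 0 <= t)) ?addr0// t0' t0.
  have n1 : 0 < (n.+1%:R^-1 : R) by rewrite invr_gt0.
  have [tk'|tk'] := leP t (k%:R * n.+1%:R^-1).
    by apply: le_trans (IH t _ tk') _; rewrite ?t0// lerD2l ler_nat.
  have k0 : 0 <= k%:R * n.+1%:R^-1 :> R by rewrite mulr_ge0// ltW.
  have kT : k%:R * n.+1%:R^-1 <= T by rewrite ltW// (lt_le_trans tk').
  have := IH (k%:R * n.+1%:R^-1); rewrite k0 kT lexx => /(_ isT isT) h1.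
  have : `|S t x - S (k%:R * n.+1%:R^-1) x| <= 1.
    apply: hn; rewrite ?t0 ?k0//; rewrite ger0_norm ?subr_ge0 ?(ltW tk')// lerBlDl.
    by move: tk; rewrite -natr1 mulrDl mul1r.
  move=> h2; rewrite -natr1 addrA; apply: le_trans (lerD h1 h2).
  by rewrite -{1}[S t x](subrKC (S (k%:R * n.+1%:R^-1) x)); exact: ler_normD.
exists (Num.max M 0) => [|t x /andP[t0 tT]]; first by rewrite le_max lexx orbT.
have [->|x0] := eqVneq x 0; first by rewrite op0// !normr0 mulr0.
have nx : 0 < `|x| by rewrite normr_gt0.
have : `|S t (`|x|^-1 *: x)| <= M.
  apply: (hM (S t)); first by exists t => //; rewrite t0.
  by rewrite normrZ ger0_norm ?invr_ge0// mulVf// gt_eqF.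
rewrite opZ// normrZ ger0_norm ?invr_ge0// ler_pdivrMl// mulrC => h.
by apply: le_trans h _; rewrite ler_wpM2r// le_max lexx.
Qed.

Section Oscillation.
Variables (M : R) (M0 : 0 <= M) (hM : forall t x, 0 <= t <= T -> `|S t x| <= M * `|x|).

Lemma op_cont t : 0 <= t <= T -> continuous (S t).
Proof.
move=> tT x; have /andP[t0 _] := tT; apply/cvgrPdist_le => e e0; near=> y.
rewrite -opB//; apply: le_trans (hM _ tT) _.
apply: (@le_trans _ _ ((M + 1) * `|x - y|)); first by rewrite ler_wpM2r// lerDl.
rewrite -ler_pdivlMl ?ltr_wpDl//; near: y.
by apply: cvgr_dist_le => //; rewrite mulr_gt0 ?invr_gt0// ltr_wpDl.
Unshelve. all: by end_near. Qed.

Definition osc_set (h : R) x := [set r : R | exists a b,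
  [/\ 0 <= a <= T, 0 <= b <= T, `|a - b| <= h & r = `|S a x - S b x|]].
(** Modulus of continuity on [0, T], at scale h, of the orbit t |-> S(t) x. As a function of x it is
    Lipschitz, so that its composition with a random variable is measurable. *)
Definition osc (h : R) x : R := sup (osc_set h x).

Lemma osc_set_ub h x : ubound (osc_set h x) (2 * M * `|x|).
Proof.
move=> _ [a [b [aT bT _ ->]]]; apply: le_trans (ler_normB _ _) _.
by apply: le_trans (lerD (hM _ aT) (hM _ bT)) _; rewrite -mulrA mulr_natl mulr2n.
Qed.

Lemma osc_set_neq0 h x : 0 <= h -> osc_set h x !=set0.
Proof.
move=> h0; exists `|S 0 x - S 0 x|, 0, 0; rewrite subrr normr0 lexx ltW//.
Qed.

Lemma le_osc h x a b : 0 <= a <= T -> 0 <= b <= T -> `|a - b| <= h -> `|S a x - S b x| <= osc h x.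
Proof.
move=> aT bT ab; apply: ub_le_sup; first by exists (2 * M * `|x|); exact: osc_set_ub.
by exists a, b.
Qed.

Lemma osc_le h x (r : R) : 0 <= h ->
  (forall a b, 0 <= a <= T -> 0 <= b <= T -> `|a - b| <= h -> `|S a x - S b x| <= r) -> osc h x <= r.
Proof.
move=> h0 hr; apply: ge_sup; first exact: osc_set_neq0.
by move=> _ [a [b [aT bT ab ->]]]; exact: hr.
Qed.

Lemma osc_ge0 h x : 0 <= h -> 0 <= osc h x.
Proof.
move=> h0; have T0 := ltW T_gt0.
by apply: le_trans (@le_osc h x 0 0 _ _ _); rewrite ?normr_ge0 ?lexx ?T0// subrr normr0.
Qed.

Lemma osc_bound h x : 0 <= h -> osc h x <= 2 * M * `|x|.
Proof. by move=> h0; apply: ge_sup; [exact: osc_set_neq0|exact: osc_set_ub]. Qed.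

Lemma osc_mono h h' x : 0 <= h -> h <= h' -> osc h x <= osc h' x.
Proof.
move=> h0 hh; apply: osc_le => // a b aT bT ab; apply: le_osc => //.
exact: le_trans hh.
Qed.

Lemma osc_lip h x y : 0 <= h -> osc h x <= osc h y + 2 * M * `|x - y|.
Proof.
move=> h0; apply: osc_le => // a b aT bT ab.
have [a0 b0] : 0 <= a /\ 0 <= b by case/andP: aT; case/andP: bT.
have -> : S a x - S b x = (S a y - S b y) + (S a (x - y) - S b (x - y)).
  by rewrite !opB// addrACA -!opprD !subrKC.
apply: le_trans (ler_normD _ _) _; rewrite lerD//; first exact: le_osc.
apply: le_trans (ler_normB _ _) _.
by apply: le_trans (lerD (hM _ aT) (hM _ bT)) _; rewrite -mulrA mulr_natl mulr2n.
Qed.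

Lemma osc_cont h : 0 <= h -> continuous (osc h).
Proof.
move=> h0 x; apply/cvgrPdist_le => e e0; near=> y.
apply: (@le_trans _ _ ((2 * M + 1) * `|x - y|)).
  have h1 := osc_lip x y h0; have h2 := osc_lip y x h0; rewrite distrC in h2.
  by have n0 := normr_ge0 (x - y); rewrite ler_norml; apply/andP; split; lra.
rewrite -ler_pdivlMl ?ltr_wpDl ?mulr_ge0//; near: y.
by apply: cvgr_dist_le => //; rewrite mulr_gt0 ?invr_gt0// ltr_wpDl ?mulr_ge0.
Unshelve. all: by end_near. Qed.

Lemma osc_cvg x : osc n.+1%:R^-1 x @[n --> \oo] --> 0.
Proof.
apply/cvgr0Pnorm_le => e e0; apply: filterS (op_unif_continuous x e0) => n hn.
by rewrite ger0_norm ?osc_ge0 ?invr_ge0//; apply: osc_le; rewrite ?invr_ge0.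
Qed.

End Oscillation.
End OperatorFamily.

Section StepFunctions.
Context {R : realType}.
Local Notation mu := (@lebesgue_measure R).

Definition reflect (r : R) (x : measurableTypeR R) : measurableTypeR R := r - x.

Lemma reflect_measurable r : measurable_fun setT (reflect r).
Proof. by apply: measurable_funB. Qed.

(** By uniqueness of Lebesgue measure it is enough to look at intervals ]a, b], whose preimages [r -
    b, r - a[ have the same length. *)
Lemma reflect_measure r (A : set (measurableTypeR R)) : measurable A -> pushforward mu (reflect r) A = mu A.
Proof.
pose nu := measure_function_pushforward__canonical__measure_function_Measure mu (reflect_measurable r).
move=> mA; apply/esym/(@lebesgue_measure_unique R nu) => //= _ [[a b]] _ <-.
rewrite /nu /= /pushforward (_ : _ @^-1` _ = `[r - b, r - a[%classic).
  rewrite !lebesgue_measure_itv/= !lte_fin ltrD2l ltrN2; case: ifP => // _.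
  by rewrite -!EFinB; congr EFin; ring.
by apply/seteqP; split => x /=; rewrite /reflect !in_itv/= => /andP[h1 h2]; apply/andP; split; lra.
Qed.

Lemma reflect_integrable (r : R) (f : R -> R) : mu.-integrable setT (EFin \o f) ->
  mu.-integrable setT (EFin \o (fun x => f (r - x))).
Proof.
move=> /integrableP[mf lf]; have mr := reflect_measurable r.
have mf' : measurable_fun setT f by exact/measurable_EFinP.
have mfr : measurable_fun setT (f \o reflect r) by apply: measurableT_comp.
apply/integrableP; split; first by apply/measurable_EFinP; exact: mfr.
have := @ge0_integral_pushforward _ _ _ _ _ _ mr mu setT (fun x => (`|f x|)%:E) measurableT.
move=> /(_ _ _)/esym h; apply: le_lt_trans lf; rewrite le_eqVlt; apply/orP; left; apply/eqP.
transitivity (\int[mu]_(x in reflect r @^-1` setT) ((fun x => (`|f x|)%:E) \o reflect r) x)%E => //.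
rewrite h//; last by apply/measurable_EFinP; exact: measurableT_comp.
by apply: eq_measure_integral => A mA _; exact: reflect_measure.
Qed.

Lemma reflect_integral (r : R) (f : R -> R) (D : set R) : mu.-integrable setT (EFin \o f) ->
  measurable D ->
  (\int[mu]_(x in [set x | D (r - x)%R]) (f (r - x)%R)%:E = \int[mu]_(x in D) (f x)%:E)%E.
Proof.
move=> fi mD; have mr := reflect_measurable r; have /integrableP[mf _] := fi.
have := @integral_pushforward _ _ _ _ _ _ mr mu D (EFin \o f) mf _ mD.
move=> /(_ _)/esym h.
transitivity (\int[mu]_(x in reflect r @^-1` D) ((EFin \o f) \o reflect r) x)%E => //.
rewrite h; first by apply: eq_measure_integral => A mA _; exact: reflect_measure.
apply: (@integrableS _ _ _ _ setT) => //; last exact: reflect_integrable.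
by rewrite -[X in measurable X]setTI; exact: mr.
Qed.

Lemma step_index (h tau : R) m : 0 < h -> 0 <= tau -> tau < m%:R * h -> exists2 j : 'I_m,
  j%:R * h <= tau < j.+1%:R * h & `|j%:R * h - tau| <= h.
Proof.
move=> h0 t0 tm; pose j := Num.truncn (tau / h).
have th0 : 0 <= tau / h by rewrite divr_ge0// ltW.
have jm : (j < m)%N by rewrite truncn_lt_nat// ltr_pdivrMr.
have /andP[j1 j2] := truncn_itv th0.
rewrite ler_pdivlMr// in j1; rewrite ltr_pdivrMr// in j2.
exists (Ordinal jm) => /=; first by rewrite j1.
move: j2; rewrite -natr1 mulrDl mul1r => j2; rewrite ler_norml; apply/andP; split; lra.
Qed.

(** Half-open, so that different cells are disjoint. The right end of [0, n h] lies in none of the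
    first n cells, which is why integrals are moved to the interval without its right end. *)
Definition cell (h : R) (j : nat) : set R := [set tau | j%:R * h <= tau < j.+1%:R * h].

Lemma cellE h j : cell h j = `[j%:R * h, j.+1%:R * h[%classic.
Proof. by apply/seteqP; split => x; rewrite /cell /= in_itv. Qed.

Lemma measurable_cell h j : measurable (cell h j).
Proof. by rewrite cellE; exact: measurable_itv. Qed.

Lemma cell_inj h i j tau : 0 < h -> cell h i tau -> cell h j tau -> i = j.
Proof.
move=> h0 /andP[i1 i2] /andP[j1 j2]; apply/eqP; rewrite eqn_leq.
have := le_lt_trans i1 j2; have := le_lt_trans j1 i2.
by rewrite !ltr_pM2r// !ltr_nat !ltnS => -> ->.
Qed.

End StepFunctions.

Section Kernel.
Context {R : realType}.
Local Notation mu := (@lebesgue_measure R).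

Lemma integrable_dom (D : set (measurableTypeR R)) (f g : R -> R) : measurable D -> measurable_fun D f ->
  mu.-integrable D (EFin \o g) -> (forall x, D x -> `|f x| <= g x) ->
  mu.-integrable D (EFin \o f).
Proof.
move=> mD mf ig h; apply: (@le_integrable _ _ _ mu D _ (EFin \o f) (EFin \o g)) => //.
  exact/measurable_EFinP.
by move=> x Dx /=; rewrite lee_fin (le_trans (h x Dx))// ler_norm.
Qed.

Lemma Rintegral_norm_le (D : set (measurableTypeR R)) (f g : R -> R) : measurable D ->
  mu.-integrable D (EFin \o f) -> mu.-integrable D (EFin \o g) ->
  (forall x, D x -> `|f x| <= g x) -> `|\int[mu]_(x in D) f x| <= \int[mu]_(x in D) g x.
Proof.
move=> mD jf ig h; apply: le_trans (le_normr_Rintegral mD jf) _.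
by apply: le_Rintegral => //; exact: (integrable_norm jf).
Qed.

Lemma Rintegral_sum (D : set (measurableTypeR R)) I (s : seq I) (f : I -> R -> R) : measurable D ->
  (forall j, mu.-integrable D (EFin \o f j)) ->
  mu.-integrable D (EFin \o (fun x => \sum_(j <- s) f j x)) /\
  \int[mu]_(x in D) (\sum_(j <- s) f j x) = \sum_(j <- s) \int[mu]_(x in D) f j x.
Proof.
move=> mD jf; elim: s => [|i s [IH1 IH2]].
  rewrite big_nil (_ : (fun x => _) = (fun=> 0)); last by apply/funext => x; rewrite big_nil.
  by rewrite Rintegral_cst// mul0r; split => //; exact: integrable0.
rewrite big_cons (_ : (fun x => \sum_(j <- i :: s) f j x) = (fun x => f i x + \sum_(j <- s) f j x)).
  by rewrite RintegralD// IH2; split => //; exact: (integrableD mD (jf i) IH1).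
by apply/funext => x; rewrite big_cons.
Qed.

Lemma integrable_indicator (D E : set (measurableTypeR R)) : measurable D -> measurable E -> (mu D < +oo)%E ->
  mu.-integrable D (EFin \o (\1_E : R -> R)).
Proof.
move=> mD mE fD; apply: (@integrable_dom D _ (fun=> 1)) => //.
- apply/integrableP; split; first by apply/measurable_EFinP.
  under eq_integral do rewrite /= normr1.
  by rewrite integral_cst// mul1e.
- by move=> x _; rewrite indicE; case: (_ \in _); rewrite ?normr1 ?normr0.
Qed.

End Kernel.

(** * The resolvent equation through scalar products *)

Section WeakBochner.
Context {R : realType} {H : completeNormedModType R} (ip : H -> H -> R).
Hypothesis ipP : inner_product ip.
Local Notation mu := (@lebesgue_measure R).

(** The same simple function approximates f in mean and, after integration, v in norm; pairing with
    k costs at most a factor |k| in both places. *)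
Lemma bochner_ip (D : set (measurableTypeR R)) (f : R -> H) v k : measurable D -> (mu D < +oo)%E ->
  bochner_H D f v -> mu.-integrable D (EFin \o (fun tau => ip (f tau) k)) ->
  ip v k = \int[mu]_(tau in D) ip (f tau) k.
Proof.
move=> mD fD [_ _ ap] jf; apply/eqP; rewrite -subr_eq0 -normr_le0.
apply/ler_addgt0Pr => e e0; rewrite add0r.
(* Two errors of size at most e' |k| are to stay below e; the summand 1 covers k = 0. *)
have k1 : 0 < 2 * (`|k| + 1) by rewrite mulr_gt0// ltr_wpDl.
have [n [E [x [hE mf lf lv]]]] := ap _ (divr_gt0 e0 k1).
set e' := e / _ in lf lv.
pose psi tau := \sum_(j < n) (\1_(E j) tau : R) * ip (x j) k.
have jE j : mu.-integrable D (EFin \o (\1_(E j) : R -> R)).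
  by apply: integrable_indicator => //; case: (hE j).
have jE' j : mu.-integrable D (EFin \o (fun tau => (\1_(E j) tau : R) * ip (x j) k)).
  exact: (integrableZr mD _ (jE j)).
have [jpsi Epsi] := @Rintegral_sum R D _ (index_enum 'I_n) _ mD jE'.
have EE j : \int[mu]_(tau in D) (\1_(E j) tau : R) = fine (mu (E j)).
  have [mE ED _] := hE j.
  by rewrite /Rintegral integral_indic// (setIidl ED).
have Epsi' : \int[mu]_(tau in D) psi tau = ip (\sum_(j < n) fine (mu (E j)) *: x j) k.
  rewrite /psi Epsi (ip_suml ipP); apply: eq_bigr => j _.
  by rewrite RintegralZr// EE (ipZl ipP).
pose er tau := `|f tau - \sum_(j < n) (\1_(E j) tau : R) *: x j|.
have jer : mu.-integrable D (EFin \o er).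
  apply/integrableP; split => //; rewrite (_ : (fun x0 => _) = (fun tau => (er tau)%:E)).
    exact: lt_trans lf (ltry _).
  by apply/funext => tau; rewrite gee0_abs ?lee_fin// normr_ge0.
have jker : mu.-integrable D (EFin \o (fun tau => er tau * `|k|)).
  exact: (integrableZr mD _ jer).
have bound : `|\int[mu]_(tau in D) (ip (f tau) k - psi tau)| <= e' * `|k|.
  apply: (@le_trans _ _ (\int[mu]_(tau in D) (er tau * `|k|))).
    apply: Rintegral_norm_le => //; first exact: (integrableB mD jf jpsi).
    move=> tau _; rewrite /psi (_ : _ - _ = ip (f tau - \sum_(j < n) (\1_(E j) tau : R) *: x j) k).
      exact: (ip_le ipP).
    by rewrite (ipBl ipP) (ip_suml ipP); under [in RHS]eq_bigr do rewrite (ipZl ipP).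
  rewrite RintegralZr// ler_wpM2r// -lee_fin /Rintegral fineK; first exact: ltW lf.
  exact: integrable_fin_num jer.
rewrite RintegralB// Epsi' in bound.
have b2 : `|ip v k - ip (\sum_(j < n) fine (mu (E j)) *: x j) k| <= e' * `|k|.
  rewrite -(ipBl ipP); apply: le_trans (ip_le ipP _ _) _.
  by rewrite ler_wpM2r//; move: lv; rewrite lte_fin => /ltW.
rewrite distrC in bound.
apply: le_trans (ler_distD (ip (\sum_(j < n) fine (mu (E j)) *: x j) k) _ _) _.
apply: le_trans (lerD b2 bound) _.
have e'E : e' * (2 * (`|k| + 1)) = e by rewrite /e' divfK// gt_eqF.
have e'0 : 0 < e' by rewrite divr_gt0.
rewrite -[leRHS]e'E; nra.
Qed.

Variables (D : set H) (A : H -> H) (a a0 : R -> R) (S : R -> H -> H) (T M : R).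
Hypotheses (T_gt0 : 0 < T) (resS : resolvent D A a S).
Hypotheses (M0 : 0 <= M) (hM : forall t x, 0 <= t <= T -> `|S t x| <= M * `|x|).
Hypotheses (a0E : forall tau, 0 <= tau <= T -> a0 tau = a tau)
  (ia0 : mu.-integrable setT (EFin \o a0)).

Definition mass (u v : R) : R := \int[mu]_(x in `]u, v]) a0 x.
Definition tmass : R := \int[mu]_x `|a0 x|.

Lemma tmass_ge0 : 0 <= tmass.
Proof. by apply: Rintegral_ge0 => x _; exact: normr_ge0. Qed.

(** Reflection turns a cell closed on the left into an interval closed on the right, which fixes the
    shape of the interval in [mass]. *)
Lemma cell_mass r h j : 0 < h ->
  \int[mu]_(tau in cell h j) a0 (r - tau) = mass (r - j.+1%:R * h) (r - j%:R * h).
Proof.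
move=> h0; rewrite /mass /Rintegral -(reflect_integral r ia0)//; congr fine; congr integral.
by apply/seteqP; split => x /=; rewrite /cell /= in_itv/= => /andP[h1 h2]; apply/andP; split; lra.
Qed.

Lemma op_measurable (r : R) x k : measurable_fun `[0, r] (fun tau => ip (S tau x) k).
Proof.
have [_ [cS _] _ _] := resS.
apply: subspace_continuous_measurable_fun => //.
have c1 : {within `[0, +oo[, continuous (fun tau => ip (S tau x) k)}.
  apply/subspace_continuousP => t tA; have /subspace_continuousP cx := @cS x.
  exact: (@cvg_comp _ _ _ (fun tau => S tau x) (fun z => ip z k) _ _ _ (cx t tA)
    (@ip_continuous _ _ _ ipP k (S t x))).
apply: continuous_subspaceW c1.
by move=> t; rewrite /= !in_itv/= => /andP[-> _].
Qed.

(* Pairing the defect w with w itself leaves only scalar integrals. *)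
Lemma resolvent_step x r h m : D x -> 0 < h -> r = m%:R * h -> r <= T ->
  `|S r x - x - \sum_(j < m) mass (r - j.+1%:R * h) (r - j%:R * h) *: S (j%:R * h) (A x)|
    <= tmass * osc S T h (A x).
Proof.
move=> Dx h0 rE rT; have [bS [cS S0] SA eqS] := resS.
have r0 : 0 <= r by rewrite rE mulr_ge0// ltW.
set sm := \sum_(j < m) _; set w := _ - _; set y := A x in sm w *.
have os0 : 0 <= osc S T h y by exact: (osc_ge0 T_gt0 hM y (ltW h0)).
have [->|w0] := eqVneq w 0; first by rewrite normr0 mulr_ge0// tmass_ge0.
have nw : 0 < `|w| by rewrite normr_gt0.
rewrite -(ler_pM2r nw) -expr2 -(ipxx ipP) {1}/w (ipBl ipP).
pose I := `[0, r]%classic; pose I' := `[0, r[%classic.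
have mI' : measurable (I' : set (measurableTypeR R)) by exact: measurable_itv.
have mI : measurable (I : set (measurableTypeR R)) by exact: measurable_itv.
have I'I : I' `<=` I by move=> t; rewrite /I /I' /= !in_itv/= => /andP[-> /ltW].
have IT t : I t -> 0 <= t <= T.
  by rewrite /I /= in_itv/= => /andP[-> tr]; exact: le_trans rT.
have jr : mu.-integrable setT (EFin \o (fun t => a0 (r - t))) by exact: reflect_integrable.
have jrI (B : set (measurableTypeR R)) : measurable B -> mu.-integrable B (EFin \o (fun t => a0 (r - t))).
  by move=> mB; apply: integrableS jr.
have jnI (B : set (measurableTypeR R)) : measurable B -> mu.-integrable B (EFin \o (fun t => `|a0 (r - t)|)).
  by move=> mB; exact: (integrable_norm (jrI B mB)).
have jg : mu.-integrable I (EFin \o (fun t => a0 (r - t) * ip (S t y) w)).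
  apply: (@integrable_dom _ _ _ (fun t => `|a0 (r - t)| * (M * `|y| * `|w|))) => //.
  - apply: measurable_funM; last exact: op_measurable.
    by have /integrableP[/measurable_EFinP] := jrI _ mI.
  - exact: (integrableZr mI _ (jnI _ mI)).
  - move=> t It; rewrite normrM ler_wpM2l//; apply: le_trans (ip_le ipP _ _) _.
    by rewrite ler_wpM2r// hM// IT.
have gE t : I t -> ip (a (r - t) *: A (S t x)) w = a0 (r - t) * ip (S t y) w.
  rewrite /I /= in_itv/= => /andP[t0 tr]; have [_ ->] := SA t x t0 Dx.
  rewrite (ipZl ipP) a0E// subr_ge0 tr/=; lra.
have Ev : ip (S r x - x) w = \int[mu]_(t in I') (a0 (r - t) * ip (S t y) w).
  rewrite (Rintegral_itv_bndo_bndc (a := BLeft 0)); last exact: integrableS jg.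
  rewrite (bochner_ip mI _ (eqS r x r0 Dx)).
  - by apply: eq_Rintegral => t; rewrite inE => It; rewrite gE.
  - by rewrite /I lebesgue_measure_itv/=; case: ifP => // _; rewrite -EFinB ltry.
  - by apply: eq_integrable jg => // t; rewrite inE => It /=; rewrite gE.
(* The integrand with the orbit frozen at the left end of each cell. Its integral is [ip sm w], and
   its distance to the true integrand is at most [|a0 (r - t)|] times the oscillation times |w|. *)
pose st t := \sum_(j < m) ip (S (j%:R * h) y) w * (a0 (r - t) * (\1_(cell h j) t : R)).
have cI' j : (j < m)%N -> cell h j `<=` I'.
  move=> jm t /andP[t1 t2]; rewrite /I' /= in_itv/=; apply/andP; split.
    by apply: le_trans t1; rewrite mulr_ge0// ltW.
  by apply: lt_le_trans t2 _; rewrite rE ler_pM2r// ler_nat.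
have jc j : mu.-integrable I' (EFin \o (fun t => a0 (r - t) * (\1_(cell h j) t : R))).
  apply: (@integrable_dom _ _ _ (fun t => `|a0 (r - t)|)) => //; last 2 first.
  - exact: jnI.
  - move=> t _; rewrite normrM indicE; case: (_ \in _); rewrite ?normr1 ?normr0 ?mulr1//.
    by rewrite mulr0.
  apply: measurable_funM; first by have /integrableP[/measurable_EFinP] := jrI _ mI'.
  by apply: measurable_indic; exact: measurable_cell.
have jc' j : mu.-integrable I' (EFin \o (fun t => ip (S (j%:R * h) y) w * (a0 (r - t) * (\1_(cell h j) t : R)))).
  exact: (integrableZl mI' _ (jc j)).
have [jst Est] := @Rintegral_sum R I' _ (index_enum 'I_m) _ mI' jc'.
have Es : ip sm w = \int[mu]_(t in I') st t.
  rewrite /st Est /sm (ip_suml ipP); apply: eq_bigr => j _.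
  rewrite RintegralZl// (ipZl ipP) mulrC -cell_mass//; congr (_ * _).
  transitivity (\int[mu]_(t in I' `&` cell h j) a0 (r - t)).
    by rewrite (setIidr (cI' _ (ltn_ord j))).
  rewrite Rintegral_mkcondr; apply: eq_Rintegral => t _.
  by rewrite patch_indic.
rewrite Ev Es -RintegralB//; last by apply: integrableS jg.
apply: le_trans (ler_norm _) _.
apply: (@le_trans _ _ (\int[mu]_(t in I') (`|a0 (r - t)| * (osc S T h y * `|w|)))).
  apply: Rintegral_norm_le => //.
  - have jgI' : mu.-integrable I' (EFin \o (fun t => a0 (r - t) * ip (S t y) w)).
      by apply: integrableS jg.
    exact: (integrableB mI' jgI' jst).
  - exact: (integrableZr mI' _ (jnI _ mI')).
  - move=> t I't; move: (I't); rewrite /I' /= in_itv/= => /andP[t0 tr].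
    have [|j ct dj] := @step_index R h t m h0 t0; first by rewrite -rE.
    have -> : st t = a0 (r - t) * ip (S (j%:R * h) y) w.
      rewrite /st (bigD1 j)//= big1 ?addr0 => [|i ij].
        by rewrite indicE mem_set// mulr1 mulrC.
      rewrite indicE memNset ?mulr0// => ci; case/eqP: ij; apply/val_inj.
      exact: (cell_inj h0 ci ct).
    rewrite -mulrBr normrM ler_wpM2l// -(ipBl ipP); apply: le_trans (ip_le ipP _ _) _.
    rewrite ler_wpM2r//; apply: (le_osc hM); last by rewrite distrC.
      exact: IT (I'I _ I't).
    apply: IT; apply: I'I; apply: (cI' j) => //; rewrite /cell /= lexx/=.
    by rewrite ltr_pM2r// ltr_nat.
rewrite RintegralZr//; last exact: jnI.
rewrite mulrA ler_wpM2r// ler_wpM2r// /tmass.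
have := reflect_integral r (f := fun t => `|a0 t|) _ measurableT.
have jn : mu.-integrable setT (EFin \o (fun t => `|a0 t|)) by exact: (integrable_norm ia0).
move=> /(_ jn); rewrite (_ : [set x0 | _] = setT); last by apply/seteqP; split.
rewrite /Rintegral => <-.
apply: fine_le.
- exact: integrable_fin_num (jnI _ mI').
- exact: integrable_fin_num (jnI _ measurableT).
- apply: ge0_subset_integral => //.
  by have /integrableP[] := jnI _ measurableT.
Qed.

End WeakBochner.

(** * Stochastic convolutions *)

Section Regular.
Context {d : measure_display} {Omega : measurableType d} {R : realType}.
Variable P : probability Omega R.
Variables (F : R -> set (set Omega)) (filtF : filtration F).
Context {H : completeNormedModType R} (ip : H -> H -> R).
Hypotheses (ipP : inner_product ip) (sepH : separable H).
Variables (T : R) (T_gt0 : 0 < T).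
Local Notation mea := (@measurable d Omega).
Local Notation smea := (@sigma_algebra_measurable d Omega).
Implicit Types (p : seq R) (f : R -> Omega -> H).

(* Two times with the same code lie in a common interval of length eta / 2 and
   either coincide or are not separated by a point of p. *)
Lemma finite_net p f (eta eps : R) : 0 < eta -> 0 <= eps -> modulus P p T f eta eps ->
  exists L : seq R, (forall s, s \in L -> 0 <= s <= T) /\
    forall tau, 0 <= tau <= T -> exists2 s, s \in L & nrm P (fun w => f tau w - f s w) <= eps.
Proof.
move=> eta0 eps0 hm; pose h := eta / 2; pose K := Num.truncn (T / h).
have h0 : 0 < h by rewrite divr_gt0.
(* The third component equals [size p] exactly when tau is not in p, so it tells the exceptional
   times apart from each other and from all other times. *)
pose code tau : 'I_K.+1 * 'I_(size p).+1 * 'I_(size p).+1 :=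
  (inord (Num.truncn (tau / h)), inord (count (fun c => c < tau) p), inord (index tau p)).
pose rep c := xget 0 [set tau | 0 <= tau <= T /\ code tau = c].
have claim x y : 0 <= x <= T -> 0 <= y <= T -> x <= y -> code x = code y ->
    nrm P (fun w => f x w - f y w) <= eps.
  move=> xT yT xy cE; have /andP[x0 xT'] := xT; have /andP[y0 yT'] := yT.
  have bnd z : 0 <= z <= T -> (Num.truncn (z / h) < K.+1)%N.
    move=> /andP[z0 zT]; rewrite truncn_lt_nat; last by rewrite divr_ge0// ltW.
    apply: le_lt_trans (truncnS_gt _); by rewrite ler_pM2r// invr_gt0.
  have e1 : Num.truncn (x / h) = Num.truncn (y / h).
    have /(congr1 (fun c => val c.1.1)) := cE; by rewrite /= !inordK ?bnd.
  have e2 : count (fun c => c < x) p = count (fun c => c < y) p.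
    have /(congr1 (fun c => val c.1.2)) := cE; by rewrite /= !inordK ?ltnS ?count_size.
  have e3 : index x p = index y p.
    have /(congr1 (fun c => val c.2)) := cE; by rewrite /= !inordK ?ltnS ?index_size.
  have [<-|nxy] := eqVneq x y.
    by rewrite (_ : (fun w => _) = fun=> 0) ?nrm0//; apply/funext => w; rewrite subrr.
  have xp : x \notin p.
    apply/negP => xp; move: (xp); rewrite -index_mem e3 index_mem => yp.
    by case/eqP: nxy; rewrite -(nth_index 0 xp) e3 nth_index.
  have yp : y \notin p by move: xp; rewrite -index_mem e3 index_mem.
  apply: hm => //.
    have /truncn_itv/andP[a1 a2] : 0 <= x / h by rewrite divr_ge0// ltW.
    have /truncn_itv/andP[b1 b2] : 0 <= y / h by rewrite divr_ge0// ltW.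
    rewrite e1 in a1 a2; rewrite ler_pdivlMr// in a1; rewrite ltr_pdivrMr// in b2.
    rewrite ler0_norm ?subr_le0// opprB ltrBlDr; apply: lt_le_trans b2 _.
    rewrite -natr1 mulrDl mul1r addrC lerD//; rewrite /h; lra.
  move=> c cp; rewrite (min_l xy) (max_r xy); apply/negP => /andP[c1 c2].
  have xc : x < c by rewrite lt_neqAle c1 andbT; apply: contraNneq xp => ->.
  have cy : c < y by rewrite lt_neqAle c2 andbT; apply: contraNneq yp => <-.
  (* A point of p strictly between x and y would be counted below y but not below x, contradicting
     the equality of the codes. *)
  have : (count (fun c => (c < x)%R) p + count (pred1 c) p <= count (fun c => (c < y)%R) p)%N.
    rewrite -count_predUI (_ : count (predI _ _) p = 0%N) ?addn0.
      apply: sub_count => z /= /orP[zx|/eqP->//]; exact: lt_le_trans zx xy.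
    apply/eqP; rewrite -leqn0 leqNgt -has_count; apply/hasPn => z _ /=.
    by apply/negP => /andP[zx /eqP zc]; move: zx; rewrite zc => /(lt_trans xc); rewrite ltxx.
  rewrite e2 -[X in (_ <= X)%N]addn0 leq_add2l leqn0 => /eqP c0.
  by have : has (pred1 c) p by [apply/hasP; exists c => /=]; rewrite has_count c0.
exists [seq rep c | c <- enum {: 'I_K.+1 * 'I_(size p).+1 * 'I_(size p).+1}]; split.
  move=> _ /mapP[c _ ->]; rewrite /rep; case: xgetP => [y _ [] //|_].
  by rewrite lexx ltW.
move=> tau tT; exists (rep (code tau)); first by apply: map_f; rewrite mem_enum.
have [sT cs] : 0 <= rep (code tau) <= T /\ code (rep (code tau)) = code tau.
  by apply: (@xgetPex _ 0 [set x | 0 <= x <= T /\ code x = code tau]); exists tau.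
have [st|ts] := leP (rep (code tau)) tau; last by apply: claim => //; exact: ltW.
by rewrite nrmBC; apply: claim.
Qed.

Definition regular p f := adapted P F T f /\ puc P p T f.

Lemma regular_mea p f tau : regular p f -> 0 <= tau <= T -> M2 P mea (f tau).
Proof. by move=> [hf _]; exact: (adapted_mea filtF hf). Qed.

(** Every value lies within 1 of one of the finitely many values on the net, so 1 plus the sum of
    their norms is a bound. *)
Lemma modulus_bounded p f (eta : R) : (forall tau, 0 <= tau <= T -> M2 P mea (f tau)) -> 0 < eta ->
  modulus P p T f eta 1 -> exists2 C : R, 0 <= C & bounded P T f C.
Proof.
move=> hM eta0 hm; have [L [LT hL]] := finite_net eta0 ler01 hm.
have S0 s : 0 <= \sum_(s <- s) nrm P (f s) by apply: sumr_ge0 => ? _; exact: nrm_ge0.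
exists (1 + \sum_(s <- L) nrm P (f s)); first by rewrite addr_ge0.
move=> tau tT; have [s sL hs] := hL tau tT; have sT := LT s sL.
have -> : f tau = (fun w => (f tau w - f s w) + f s w) by apply/funext => w; rewrite subrK.
have Mt := hM tau tT; have Ms := hM s sT.
apply: le_trans (nrmD_le ipP sepH (M2B ipP sepH smea (fun _ => id) Mt Ms) Ms) _.
by rewrite lerD// (big_rem s)//= lerDl.
Qed.

Lemma regular_bounded p f : regular p f -> exists2 C : R, 0 <= C & bounded P T f C.
Proof.
move=> hr; have [hf hp] := hr; have [eta eta0 hm] := hp 1 ltr01.
by apply: modulus_bounded eta0 hm => tau; exact: (regular_mea hr).
Qed.

Lemma filt_sub t : 0 <= t -> F t `<=` mea.
Proof. by case: filtF => _ h _; exact: h. Qed.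

Section Family.
Variables (U : R -> H -> H) (M : R) (M0 : 0 <= M).
Hypotheses (bU : forall t, 0 <= t -> bounded_operator (U t))
  (cU : forall x, {within `[0, +oo[, continuous (fun t : R => U t x)})
  (hM : forall t x, 0 <= t <= T -> `|U t x| <= M * `|x|).

Lemma M2_op G t X : sigma_algebra setT G -> G `<=` mea -> 0 <= t <= T -> M2 P G X ->
  M2 P G (fun w => U t (X w)).
Proof.
move=> sG GM tT; apply: (M2_comp sG GM (op_cont bU M0 hM tT) M0).
by move=> x; exact: hM.
Qed.

Lemma nrm_op t X : 0 <= t <= T -> M2 P mea X -> nrm P (fun w => U t (X w)) <= M * nrm P X.
Proof.
move=> tT hX; apply: nrm_le_op => //; first exact: (M2_op smea (fun _ => id)).
by apply: nearW => w; exact: hM.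
Qed.

Lemma osc_integ h X : 0 <= h -> M2 P mea X -> integ P (fun w => osc U T h (X w) ^+ 2).
Proof.
move=> h0 [bX iX]; have mo : rmeas mea (fun w => osc U T h (X w)).
  by apply: (borel_contR smea _ bX); exact: (osc_cont T_gt0 bU M0 hM h0).
apply: (@integ_le _ _ _ _ _ (fun w => (2 * M) ^+ 2 * `|X w| ^+ 2)).
- exact: rmeas_sqr.
- exact: integZ.
- move=> w; rewrite ger0_norm ?sqr_ge0// -exprMn ler_sqr ?nnegrE; first exact: (osc_bound T_gt0 hM).
    exact: (osc_ge0 T_gt0 hM).
  by rewrite !mulr_ge0.
Qed.

Lemma osc_mean_cvg X : M2 P mea X ->
  mean P (fun w => osc U T n.+1%:R^-1 (X w) ^+ 2) @[n --> \oo] --> 0.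
Proof.
move=> hX; have [bX iX] := hX; pose g n w := osc U T n.+1%:R^-1 (X w) ^+ 2.
have n0 n : 0 <= n.+1%:R^-1 :> R by rewrite invr_ge0.
have jg n : integ P (g n) by exact: osc_integ.
have [||||| _ _ h] := @dominated_convergence _ _ _ P setT measurableT (fun n w => (g n w)%:E)
    (fun=> 0%E) (fun w => ((2 * M) ^+ 2 * `|X w| ^+ 2)%:E).
- by move=> n; case/integrableP: (jg n).
- exact: measurable_cst.
- apply: nearW => w _; apply: cvg_EFin; first exact: nearW.
  have := @osc_cvg _ _ _ _ T_gt0 cU _ hM (X w) => c.
  by rewrite -[0](mulr0 0); under eq_fun do rewrite /= /g expr2; exact: cvgM.
- exact: integZ.
- apply: nearW => w n _; rewrite gee0_abs ?lee_fin ?sqr_ge0// /g -exprMn ler_sqr ?nnegrE.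
  + exact: (osc_bound T_gt0 hM).
  + exact: (osc_ge0 T_gt0 hM).
  + by rewrite !mulr_ge0.
have -> : (fun n => mean P (fun w => osc U T n.+1%:R^-1 (X w) ^+ 2)) =
    fine \o (fun n => \int[P]_w (g n w)%:E)%E by [].
by apply: fine_cvg; rewrite integral0 in h; exact: h.
Qed.

(** Dominated convergence handles finitely many times; the net and the Lipschitz property of [osc]
    carry the estimate to all times, so that h does not depend on tau. *)
Lemma osc_small p f (e : R) : regular p f -> 0 < e -> exists2 h : R, 0 < h &
  forall tau, 0 <= tau <= T -> mean P (fun w => osc U T h (f tau w) ^+ 2) <= e ^+ 2.
Proof.
move=> hr e0; have [hf hp] := hr.
(* With u <= v + 2 z one has u^2 <= 2 v^2 + 8 z^2; the means are at most 2 (e^2 / 4) and 8 (e /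
   4)^2, which add up to e^2. *)
pose ep := e / (4 * (M + 1)).
have M1 : 0 < M + 1 by rewrite ltr_wpDl.
have ep0 : 0 < ep by rewrite divr_gt0// mulr_gt0.
have [eta eta0 hm] := hp ep ep0.
have [L [LT hL]] := finite_net eta0 (ltW ep0) hm.
have : \forall n \near \oo, forall s, s \in L ->
    mean P (fun w => osc U T n.+1%:R^-1 (f s w) ^+ 2) <= e ^+ 2 / 4.
  elim: L LT {hL} => [_|s L IH LT]; first by apply: nearW => n s.
  have hs : M2 P mea (f s) by apply: (regular_mea hr); apply: LT; rewrite mem_head.
  near=> n => s'; rewrite in_cons => /orP[/eqP->|]; last first.
    by move: s'; near: n; apply: IH => s' s'L; apply: LT; rewrite in_cons s'L orbT.
  apply: le_trans (ler_norm _) _; near: n.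
  by move/cvgr0Pnorm_le: (osc_mean_cvg hs); apply; rewrite divr_gt0 ?exprn_gt0.
move=> [n _ /(_ n (leqnn n)) hn].
exists n.+1%:R^-1 => [|tau tT]; first by rewrite invr_gt0.
have h0 : 0 <= n.+1%:R^-1 :> R by rewrite invr_ge0.
have [s sL hs] := hL tau tT; have sT := LT s sL; have {}hn := hn s sL.
have Mt := regular_mea hr tT; have Ms := regular_mea hr sT.
have [bD iD] := M2B ipP sepH smea (fun _ => id) Mt Ms.
have j1 := osc_integ h0 Mt; have j2 := osc_integ h0 Ms.
apply: (@le_trans _ _ (mean P (fun w => 2 * osc U T n.+1%:R^-1 (f s w) ^+ 2 +
    8 * M ^+ 2 * `|f tau w - f s w| ^+ 2))).
  apply: mean_le => //; first by apply: integD; exact: integZ.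
  move=> w; have l1 := osc_lip T_gt0 bU hM (f tau w) (f s w) h0.
  have p1 := osc_ge0 T_gt0 hM (f tau w) h0; have p2 := osc_ge0 T_gt0 hM (f s w) h0.
  have p3 : 0 <= M * `|f tau w - f s w| by rewrite mulr_ge0.
  set u := osc _ _ _ (f tau w) in l1 p1 *; set v := osc _ _ _ (f s w) in l1 p2 *.
  rewrite -[8 * _ * _]mulrA -exprMn; set z := M * _ in p3 *.
  have l2 : u <= v + 2 * z by rewrite /z mulrA.
  apply: (@le_trans _ _ ((v + 2 * z) ^+ 2)); first by rewrite ler_sqr ?nnegrE// (le_trans p1).
  have := sqr_ge0 (v - 2 * z); lra.
rewrite meanD ?meanZ//; [|exact: integZ..].
rewrite -nrm_sqE.
have : M ^+ 2 * nrm P (fun w => f tau w - f s w) ^+ 2 <= (e / 4) ^+ 2.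
  rewrite -exprMn ler_sqr ?nnegrE ?mulr_ge0 ?nrm_ge0// ?divr_ge0 ?(ltW e0)//.
  apply: (@le_trans _ _ ((M + 1) * ep)).
    by rewrite ler_pM ?nrm_ge0// lerDl.
  by rewrite /ep le_eqVlt; apply/orP; left; apply/eqP; field; rewrite gt_eqF.
have := sqr_ge0 e; lra.
Unshelve. all: by end_near. Qed.

(* Truncation at tau makes tau a parameter of integrals over the fixed interval
   [0, T], at the cost of tau becoming a discontinuity. *)
Definition cv f (tau sigma : R) (w : Omega) : H :=
  if sigma < tau then U (tau - sigma) (f sigma w) else 0.

Lemma cv_adapted f tau : adapted P F T f -> tau <= T -> adapted P F T (cv f tau).
Proof.
move=> hf tT s /andP[s0 sT]; rewrite /cv; have [st|ts] := ltP s tau; last first.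
  exact: (M2_cst P ipP sepH (filt_sigma filtF s0) 0).
apply: M2_op; [exact: (filt_sigma filtF s0)|exact: filt_sub| |by apply: hf; rewrite s0].
rewrite subr_ge0 (ltW st)/=; lra.
Qed.

Lemma cv_bounded f tau C : adapted P F T f -> tau <= T -> bounded P T f C -> 0 <= C ->
  bounded P T (cv f tau) (M * C).
Proof.
move=> hf tT hC C0 s sT; have /andP[s0 s1] := sT; rewrite /cv; have [st|ts] := ltP s tau; last first.
  by rewrite nrm0 mulr_ge0.
apply: le_trans (nrm_op _ (adapted_mea filtF hf sT)) _; last by rewrite ler_wpM2l// hC.
rewrite subr_ge0 (ltW st)/=; lra.
Qed.

(** A change of time moves the argument under a fixed operator and then the operator at a fixed
    argument. The first is controlled by the modulus of f and the second by [osc_small], neither of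
    which depends on tau; hence eta is chosen before tau. *)
Lemma cv_modulus p f (e : R) : regular p f -> 0 < e -> exists2 eta : R, 0 < eta &
  forall tau, tau <= T -> modulus P (tau :: p) T (cv f tau) eta e.
Proof.
move=> hr e0; have [hf hp] := hr.
have M1 : 0 < M + 1 by rewrite ltr_wpDl.
have e1 : 0 < e / (2 * (M + 1)) by rewrite divr_gt0// mulr_gt0.
have e2 : 0 < e / 2 by rewrite divr_gt0.
have [eta1 eta10 hm] := hp _ e1.
have [eta2 eta20 ho] := osc_small hr e2.
exists (Num.min eta1 eta2) => [|tau tT a b aT bT ab nc]; first by rewrite lt_min eta10.
have [ab1 ab2] : `|a - b| < eta1 /\ `|a - b| < eta2 by move: ab; rewrite lt_min => /andP[].
have /negP nct := nc tau (mem_head _ _).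
rewrite /cv; have [at_|ta] := ltP a tau; have [bt|tb] := ltP b tau; last 3 first.
- by case: nct; rewrite ge_min le_max (ltW at_) tb orbT.
- by case: nct; rewrite ge_min le_max (ltW bt) ta orbT.
- by rewrite (_ : (fun w => _) = fun=> 0) ?nrm0 ?(ltW e0)//; apply/funext => w; rewrite subrr.
have /andP[a0 _] := aT; have /andP[b0 _] := bT.
have taT : 0 <= tau - a <= T by rewrite subr_ge0 (ltW at_)/=; lra.
have tbT : 0 <= tau - b <= T by rewrite subr_ge0 (ltW bt)/=; lra.
have Ma := regular_mea hr aT; have Mb := regular_mea hr bT.
have Maa := M2_op smea (fun _ => id) taT Ma.
have Mab := M2_op smea (fun _ => id) taT Mb.
have Mbb := M2_op smea (fun _ => id) tbT Mb.
rewrite [leRHS]splitr; apply: le_trans (nrm_tri ipP sepH Maa Mab Mbb) _; apply: lerD.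
  have -> : (fun w => U (tau - a) (f a w) - U (tau - a) (f b w)) =
      (fun w => U (tau - a) (f a w - f b w)).
    by apply/funext => w; rewrite (opB bU)//; case/andP: taT.
  apply: le_trans (nrm_op taT (M2B ipP sepH smea (fun _ => id) Ma Mb)) _.
  apply: (@le_trans _ _ ((M + 1) * (e / (2 * (M + 1))))).
    rewrite ler_pM ?nrm_ge0 ?lerDl//; apply: hm => // c cp.
    by apply: nc; rewrite in_cons cp orbT.
  by rewrite le_eqVlt; apply/orP; left; apply/eqP; field; rewrite gt_eqF.
apply: (nrm_le_fun (g := fun w => osc U T eta2 (f b w))) => //.
- exact: (M2B ipP sepH smea (fun _ => id) Mab Mbb).
- exact: osc_integ (ltW eta20) Mb.
- exact: ltW.
- exact: ho.
- move=> w; apply: (le_osc hM) => //; have -> : tau - a - (tau - b) = b - a by ring.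
  by rewrite distrC ltW.
Qed.

End Family.
End Regular.

(** * Continuity of the scalar product and orthogonal series in L2 *)

Section Limits.
Context {d : measure_display} {Omega : measurableType d} {R : realType}.
Variable P : probability Omega R.
Context {H : completeNormedModType R} (ip : H -> H -> R).
Hypotheses (ipP : inner_product ip) (sepH : separable H).
Local Notation mea := (@measurable d Omega).
Local Notation smea := (@sigma_algebra_measurable d Omega).
Local Notation M2 := (@M2 d Omega R P H).
Local Notation nrm := (@nrm d Omega R P H).
Local Notation dot := (dot P ip).

Lemma M2m_B X Y : M2 mea X -> M2 mea Y -> M2 mea (fun w => X w - Y w).
Proof. exact: (M2B ipP sepH smea (fun _ => id)). Qed.

Lemma M2m_sum I (r : seq I) (X : I -> Omega -> H) : (forall i, M2 mea (X i)) ->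
  M2 mea (fun w => \sum_(i <- r) X i w).
Proof. exact: (M2_sum ipP sepH smea (fun _ => id)). Qed.

Lemma nrm_le_shift X Y : M2 mea X -> M2 mea Y -> nrm X <= nrm Y + nrm (fun w => X w - Y w).
Proof.
move=> hX hY; apply: le_trans (nrmD_le ipP sepH hY (M2m_B hX hY)).
by rewrite (_ : (fun w => Y w + _) = X)//; apply/funext => w; rewrite addrC subrK.
Qed.

Lemma dot_cvg (u v : nat -> Omega -> H) X Y : (forall n, M2 mea (u n)) -> (forall n, M2 mea (v n)) ->
  M2 mea X -> M2 mea Y -> nrm (fun w => u n w - X w) @[n --> \oo] --> 0 ->
  nrm (fun w => v n w - Y w) @[n --> \oo] --> 0 -> dot (u n) (v n) @[n --> \oo] --> dot X Y.
Proof.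
move=> hu hv hX hY cu cv.
have h : (fun n => nrm (fun w => u n w - X w) * (nrm Y + nrm (fun w => v n w - Y w)) +
    nrm X * nrm (fun w => v n w - Y w)) @ \oo --> (0 : R).
  rewrite (_ : 0 = 0 * (nrm Y + 0) + nrm X * 0 :> R); last by rewrite mul0r mulr0 addr0.
  by apply: cvgD; apply: cvgM => //; [apply: cvgD => //|]; exact: cvg_cst.
apply/cvgrPdist_le => e e0; move/cvgr0Pnorm_le/(_ e e0): h; apply: filterS => n.
apply: le_trans; apply: le_trans (ler_norm _); rewrite distrC.
have -> : dot (u n) (v n) - dot X Y =
    dot (fun w => u n w - X w) (v n) + dot X (fun w => v n w - Y w).
  by rewrite (dotBl ipP sepH)// (dotBr ipP sepH)//; ring.
apply: le_trans (ler_normD _ _) _; apply: lerD.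
  apply: le_trans (dot_le ipP sepH (M2m_B (hu n) hX) (hv n)) _.
  by rewrite ler_wpM2l ?nrm_ge0// nrm_le_shift.
exact: (dot_le ipP sepH hX (M2m_B (hv n) hY)).
Qed.

Lemma nrm_cvg_le (u : nat -> Omega -> H) X (r : R) : (forall n, M2 mea (u n)) -> M2 mea X ->
  nrm (fun w => u n w - X w) @[n --> \oo] --> 0 ->
  (forall e : R, 0 < e -> \forall n \near \oo, nrm (u n) ^+ 2 <= r + e) -> nrm X ^+ 2 <= r.
Proof.
move=> hu hX cu h; apply/ler_addgt0Pr => e e0; have e2 : 0 < e / 2 by rewrite divr_gt0.
have /cvgrPdist_le/(_ _ e2) := dot_cvg hu hu hX hX cu cu; rewrite (dotxx P ipP) => c.
near \oo => n.
have : `|nrm X ^+ 2 - dot (u n) (u n)| <= e / 2 by near: n.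
have : nrm (u n) ^+ 2 <= r + e / 2 by near: n; exact: h.
rewrite (dotxx P ipP) ler_norml => h1 /andP[_ h2]; lra.
Unshelve. all: by end_near. Qed.

Lemma orth_sumsq (I : nat -> Omega -> H) m n : (forall i, M2 mea (I i)) ->
  (forall i j, i != j -> dot (I i) (I j) = 0) ->
  nrm (fun w => \sum_(m <= i < n) I i w) ^+ 2 = \sum_(m <= i < n) nrm (I i) ^+ 2.
Proof.
move=> hI oI; rewrite -(dotxx P ipP) (dot_suml ipP sepH)//; last exact: M2m_sum.
rewrite big_seq [RHS]big_seq; apply: eq_bigr => i im.
rewrite (dot_sumr ipP sepH)// (bigD1_seq i)//= ?iota_uniq// big1 ?addr0 ?(dotxx P ipP)//.
by move=> j ji; apply: oI; rewrite eq_sym.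
Qed.

(** By orthogonality the squared norm of a block of terms is the sum of the squared norms. The
    remainder is bounded through c alone, so families sharing the same c converge uniformly. *)
Lemma orth_series (I : nat -> Omega -> H) (c : nat -> R) : (forall i, M2 mea (I i)) ->
  (forall i j, i != j -> dot (I i) (I j) = 0) -> (forall i, nrm (I i) ^+ 2 <= c i) ->
  cvgn (series c) -> exists X, M2 mea X /\
  forall n, nrm (fun w => \sum_(i < n) I i w - X w) ^+ 2 <= limn (series c) - series c n.
Proof.
move=> hI oI Ic cc.
have c0 i : 0 <= c i by apply: le_trans (Ic i); exact: sqr_ge0.
have nd : nondecreasing_seq (series c).
  by apply/nondecreasing_seqP => n; rewrite /series/= big_nat_recr//= lerDl.
have hS n : M2 mea (fun w => \sum_(i < n) I i w) by exact: M2m_sum.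
have diff m n : (m <= n)%N ->
    nrm (fun w => \sum_(i < m) I i w - \sum_(i < n) I i w) ^+ 2 <= series c n - series c m.
  move=> mn; rewrite nrmBC.
  have -> : (fun w => \sum_(i < n) I i w - \sum_(i < m) I i w) = (fun w => \sum_(m <= i < n) I i w).
    apply/funext => w; rewrite -!(big_mkord xpredT (fun i => I i w)).
    by rewrite [X in X - _](@big_cat_nat _ _ _ m)//= addrAC subrr add0r.
  rewrite orth_sumsq// sub_series_geq//; apply: ler_sum => i _; exact: Ic.
have lim_ge n : series c n <= limn (series c) by exact: nondecreasing_cvgn_le.
have [|X [MX cX]] := L2_complete ipP sepH hS.
  move=> e e0; have e2 : 0 < e ^+ 2 by rewrite exprn_gt0.
  move/cvgrPdist_le: (cc) => /(_ _ e2)[K _ hK]; exists K.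
  suff main m n : (K <= m)%N -> (m <= n)%N ->
      nrm (fun w => \sum_(i < m) I i w - \sum_(i < n) I i w) <= e.
    move=> m n Km Kn; have [mn|nm] := leqP m n; first exact: main.
    by rewrite nrmBC; apply: main => //; exact: ltnW.
  move=> Km mn; rewrite -ler_sqr ?nnegrE ?nrm_ge0 ?(ltW e0)//; apply: le_trans (diff _ _ mn) _.
  have := hK m Km; rewrite /= ger0_norm ?subr_ge0// => h.
  by have := lim_ge n; lra.
exists X; split => // n.
apply: (@nrm_cvg_le (fun m w => \sum_(i < n) I i w - \sum_(i < m) I i w)).
- by move=> m; exact: M2m_B.
- exact: M2m_B.
- under eq_fun => m.
    rewrite (_ : (fun w => _) = (fun w => X w - \sum_(i < m) I i w)); last first.
      by apply/funext => w; rewrite opprB addrC addrA subrK.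
    rewrite nrmBC; over.
  exact: cX.
- move=> e e0; near=> m.
  apply: le_trans (diff _ _ _) _; first by near: m; exact: nbhs_infty_ge.
  by have := lim_ge m; lra.
Unshelve. all: by end_near. Qed.

End Limits.

Section StochLim.
Context {d : measure_display} {Omega : measurableType d} {R : realType}.
Variable P : probability Omega R.
Variables (F : R -> set (set Omega)) (filtF : filtration F).
Context {H : completeNormedModType R} (ip : H -> H -> R).
Hypotheses (ipP : inner_product ip) (sepH : separable H).
Local Notation mea := (@measurable d Omega).
Local Notation smea := (@sigma_algebra_measurable d Omega).
Implicit Types (f g : R -> Omega -> H) (x : nat -> R) (B : R -> Omega -> R).

Lemma eq_RS B x n f g t : nodes x n t ->
  (forall k, (k < n)%N -> x k < x k.+1 -> f (x k) = g (x k)) -> RS B x n f = RS B x n g.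
Proof.
move=> [_ _ xS] fg; apply/funext => w; apply: eq_bigr => k _; rewrite /term.
have := xS k (ltn_ord k); rewrite le_eqVlt => /orP[/eqP xk|xk]; last by rewrite fg.
by rewrite /inc xk subrr !scale0r.
Qed.

(** The value at t does not enter: a left node equal to t belongs to an interval of length 0, whose
    increment vanishes. *)
Lemma stoch_lim_ext B t f g I : (forall s, 0 <= s < t -> f s = g s) ->
  stoch_lim P B t f I -> stoch_lim P B t g I.
Proof.
move=> fg hf e e0; have [dl dl0 hd] := hf e e0; exists dl => // x n hx mx.
rewrite -(@eq_RS B x n f g t hx); first exact: hd.
move=> k kn xk; apply: fg; have /andP[-> _] := nodes_in hx (ltnW kn).
by apply: lt_le_trans xk _; have /andP[] := nodes_in hx kn.
Qed.

(** A partition of [0, t] is continued to [0, T] by steps of length at most the mesh; the integrand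
    vanishes at the new nodes, so the Riemann sum is unchanged. *)
Lemma stoch_lim_restrict B t T f I : t <= T -> (forall s, t <= s -> f s = fun=> 0) ->
  stoch_lim P B T f I -> stoch_lim P B t f I.
Proof.
move=> tT f0 hf e e0; have [dl dl0 hd] := hf e e0; exists dl => // x n hx mx.
have [x0 xn xS] := hx; pose m := (Num.truncn ((T - t) / dl)).+1.
have Tm : T - t <= m%:R * dl.
  by rewrite -ler_pdivrMr//; apply: ltW; exact: truncnS_gt.
pose y k := if (k <= n)%N then x k else Num.min (t + (k - n)%:R * dl) T.
have yn k : y (n + k)%N = Num.min (t + k%:R * dl) T.
  rewrite /y -[X in (_ <= X)%N]addn0 leq_add2l leqn0; case: eqP => [->|_].
    by rewrite addn0 mul0r addr0 xn min_l.
  by rewrite addKn.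
have yS k : 0 <= y k.+1 - y k /\ ((k < n + m)%N -> y k.+1 - y k <= dl).
  have [kn|nk] := ltnP k n.
    by rewrite /y kn (ltnW kn) subr_ge0; split; [exact: xS|move=> _; exact: mx].
  have -> : k = (n + (k - n))%N by rewrite subnKC.
  rewrite -addnS !yn (_ : t + (k - n).+1%:R * dl = t + (k - n)%:R * dl + dl); last first.
    by rewrite -natr1; ring.
  set u := t + (k - n)%:R * dl.
  split=> [|_].
    by rewrite subr_ge0 le_min !ge_min lexx orbT andbT lerDl (ltW dl0).
  have [uT|Tu] := leP u T; last by rewrite min_r ?subrr ?ltW// (lt_trans Tu)// ltrDl.
  by rewrite lerBlDr ge_min addrC lexx.
have hy : nodes y (n + m) T.
  split; first by rewrite /y leq0n x0.
    by rewrite yn min_r//; lra.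
  by move=> k _; rewrite -subr_ge0; case: (yS k).
have my : mesh_le y (n + m) dl by move=> k km; case: (yS k) => _; exact.
have := hd y (n + m)%N hy my.
rewrite (_ : RS B y (n + m) f = RS B x n f)//; apply/funext => w.
rewrite /RS big_split_ord/= [X in _ + X]big1 ?addr0 => [|k _].
  by apply: eq_bigr => k _; rewrite /y (ltn_ord k) (ltnW (ltn_ord k)).
rewrite /term f0 ?scaler0// yn le_min tT andbT lerDl.
by rewrite mulr_ge0// ltW.
Qed.

Lemma RS_sub B x n f g w : RS B x n (fun s w => f s w - g s w) w = RS B x n f w - RS B x n g w.
Proof. by rewrite /RS -sumrB; apply: eq_bigr => k _; rewrite /term scalerBr. Qed.

Lemma RS_lincomb B x n N (b : 'I_N -> R) (g : 'I_N -> R -> Omega -> H) w :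
  RS B x n (fun s w => \sum_(l < N) b l *: g l s w) w = \sum_(l < N) b l *: RS B x n (g l) w.
Proof.
rewrite /RS; under [RHS]eq_bigr do rewrite scaler_sumr; rewrite exchange_big/=.
apply: eq_bigr => k _; rewrite /term scaler_sumr; apply: eq_bigr => l _.
by rewrite !scalerA mulrC.
Qed.

Lemma adaptedB t f g : adapted P F t f -> adapted P F t g ->
  adapted P F t (fun s w => f s w - g s w).
Proof.
move=> hf hg s st; have /andP[s0 _] := st.
by apply: (M2B ipP sepH (filt_sigma filtF s0) (filt_sub filtF s0)); [exact: hf|exact: hg].
Qed.

Section One.
Variables (B : R -> Omega -> R) (wB : wiener_process P F B) (t : R) (t0 : 0 <= t).

Lemma stoch_limB f g I J : adapted P F t f -> adapted P F t g -> M2 P mea I -> M2 P mea J ->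
  stoch_lim P B t f I -> stoch_lim P B t g J ->
  stoch_lim P B t (fun s w => f s w - g s w) (fun w => I w - J w).
Proof.
move=> hf hg MI MJ lf lg e e0; have e2 : 0 < e / 2 by rewrite divr_gt0.
have [d1 d10 h1] := lf _ e2; have [d2 d20 h2] := lg _ e2.
exists (Num.min d1 d2) => [|x n hx mx]; first by rewrite lt_min d10.
have mx1 : mesh_le x n d1 by move=> k /mx /le_trans; apply; rewrite ge_min lexx.
have mx2 : mesh_le x n d2 by move=> k /mx /le_trans; apply; rewrite ge_min lexx orbT.
have Mf := RS_M2 filtF ipP sepH wB hx hf; have Mg := RS_M2 filtF ipP sepH wB hx hg.
have -> : (fun w => RS B x n (fun s w => f s w - g s w) w - (I w - J w)) =
    (fun w => (RS B x n f w - I w) - (RS B x n g w - J w)).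
  by apply/funext => w; rewrite RS_sub !opprD !opprK addrACA.
rewrite [leRHS]splitr.
apply: le_trans (nrmB_le ipP sepH (M2m_B ipP sepH Mf MI) (M2m_B ipP sepH Mg MJ)) _.
by apply: lerD; [exact: h1|exact: h2].
Qed.

(** The Ito isometry in the limit, in the form of an upper bound checked along uniform grids. *)
Lemma stoch_lim_energy f I (r : R) : adapted P F t f -> M2 P mea I -> stoch_lim P B t f I ->
  (forall e : R, 0 < e -> \forall n \near \oo,
     \sum_(k < n.+1) (t / n.+1%:R) * nrm P (f (unif t n k)) ^+ 2 <= r + e) -> nrm P I ^+ 2 <= r.
Proof.
move=> hf MI lf h.
apply: (nrm_cvg_le ipP sepH (u := fun n => RS B (unif t n) n.+1 f)) => //.
- by move=> n; exact: (RS_M2 filtF ipP sepH wB (unif_nodes n t0) hf).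
- exact: stoch_lim_unif.
- move=> e /h; apply: filterS => n; apply: le_trans.
  rewrite (RS_isometry filtF ipP sepH wB (unif_nodes n t0) hf); apply: ler_sum => k _.
  by rewrite unif_step.
Qed.

Lemma stoch_lim_bound f I (C : R) : adapted P F t f -> M2 P mea I -> stoch_lim P B t f I ->
  bounded P t f C -> nrm P I ^+ 2 <= t * C ^+ 2.
Proof.
move=> hf MI lf hC; apply: stoch_lim_energy hf MI lf _ => e e0; apply: nearW => n.
apply: (@le_trans _ _ (\sum_(k < n.+1) (t / n.+1%:R) * C ^+ 2)).
  apply: ler_sum => k _; rewrite ler_wpM2l ?divr_ge0//.
  have kt := nodes_in (unif_nodes n t0) (ltnW (ltn_ord k)).
  by rewrite ler_sqr ?nnegrE ?nrm_ge0 ?hC// (le_trans (nrm_ge0 _ _) (hC _ kt)).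
rewrite sumr_const card_ord -[_ *+ n.+1]mulr_natr (_ : _ * _ = t * C ^+ 2); last first.
  have n1 : n.+1%:R != 0 :> R by rewrite pnatr_eq0.
  by move: (n.+1%:R : R) n1 => N n1; field.
by rewrite lerDl ltW.
Qed.

End One.

Section Cross.
Variables (W : nat -> R -> Omega -> R).
Hypotheses (wW : forall i, wiener_process P F (W i)) (indW : independent_processes P W).

Lemma dot_RS_cross i j t x n f g : i != j -> nodes x n t -> adapted P F t f -> adapted P F t g ->
  dot P ip (RS (W i) x n f) (RS (W j) x n g) = 0.
Proof.
move=> ij hx hf hg; have [_ _ xS] := hx.
have Mf k : M2 P mea (term (W i) (x (k : 'I_n)) (x k.+1) (f (x k))).
  exact: (RS_term filtF ipP sepH (wW i) hx hf (ltn_ord k)).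
have Mg k : M2 P mea (term (W j) (x (k : 'I_n)) (x k.+1) (g (x k))).
  exact: (RS_term filtF ipP sepH (wW j) hx hg (ltn_ord k)).
have Mgs := RS_M2 filtF ipP sepH (wW j) hx hg.
have nd (k : 'I_n) : 0 <= x k <= t by exact: nodes_in hx (ltnW (ltn_ord k)).
have nd0 (k : 'I_n) : 0 <= x k by case/andP: (nd k).
rewrite (dot_suml ipP sepH)// big1// => k _.
rewrite (dot_sumr ipP sepH)// big1// => l _.
have hfk := hf _ (nd k); have hgl := hg _ (nd l).
have [kl|lk|kl] := ltngtP k l.
- apply: (dot_cross_disj filtF wW ipP sepH) => //; try exact: xS.
  exact: (nodes_mono hx kl (ltnW (ltn_ord l))).
- rewrite (dotC P ipP); apply: (dot_cross_disj filtF wW ipP sepH) => //; try exact: xS.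
  exact: (nodes_mono hx lk (ltnW (ltn_ord k))).
- have -> : l = k by exact/val_inj/esym.
  apply: (dot_cross_same filtF wW indW ipP sepH) => //; first exact: xS.
  exact: hg.
Qed.

Lemma stoch_lim_orth i j t f g I J : i != j -> 0 <= t -> adapted P F t f -> adapted P F t g ->
  M2 P mea I -> M2 P mea J -> stoch_lim P (W i) t f I -> stoch_lim P (W j) t g J ->
  dot P ip I J = 0.
Proof.
move=> ij t0 hf hg MI MJ lf lg.
have Mf n := RS_M2 filtF ipP sepH (wW i) (unif_nodes n t0) hf.
have Mg n := RS_M2 filtF ipP sepH (wW j) (unif_nodes n t0) hg.
have := dot_cvg ipP sepH Mf Mg MI MJ (stoch_lim_unif t0 lf) (stoch_lim_unif t0 lg).
under eq_fun => n do rewrite (dot_RS_cross ij (unif_nodes n t0) hf hg).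
by move/(cvg_lim (@Rhausdorff R)) <-; rewrite lim_cst.
Qed.

End Cross.
End StochLim.

Section PiecewiseContinuous.
Context {R : realType}.
Local Notation mu := (@lebesgue_measure R).

Definition pw_cont (p : seq R) (T : R) (phi : R -> R) := forall e : R, 0 < e ->
  exists2 eta : R, 0 < eta & forall a b, 0 <= a <= T -> 0 <= b <= T -> `|a - b| < eta ->
    (forall c, c \in p -> ~~ (Num.min a b <= c <= Num.max a b)) -> `|phi a - phi b| <= e.

Lemma near_apart (p : seq R) (x : R) : x \notin p ->
  \forall y \near x, forall c, c \in p -> `|x - y| < `|x - c|.
Proof.
elim: p => [_|c p IH]; first by apply: filterE => y c.
rewrite in_cons negb_or => /andP[xc xp]; near=> y => c'; rewrite in_cons => /orP[/eqP->|].
  by near: y; apply: cvgr_dist_lt => //; rewrite normr_gt0 subr_eq0.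
by move: c'; near: y; exact: IH.
Unshelve. all: by end_near. Qed.

(** The function is continuous on the open set of points of ]0, T[ outside p, and only finitely many
    points remain. *)
Lemma pw_measurable p T phi : pw_cont p T phi ->
  measurable_fun (`[0, T]%classic : set (measurableTypeR R)) phi.
Proof.
move=> hp; pose V : set R := [set x | 0 < x < T /\ x \notin p].
have nV x : V x -> \forall y \near x, V y /\ forall c, c \in p -> `|x - y| < `|x - c|.
  move=> [/andP[x0 xT] xp]; near=> y.
  have ap : forall c, c \in p -> `|x - y| < `|x - c| by near: y; exact: near_apart.
  split=> //; split; last by apply/negP => /ap; rewrite ltxx.
  apply/andP; split; near: y; [exact: lt_nbhsr|exact: lt_nbhsl].
have oV : open V by rewrite openE => x /nV; apply: filterS => y [].
have cV : {in V, continuous phi}.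
  move=> x; rewrite inE => Vx; apply/cvgrPdist_le => e e0.
  have [eta eta0 h] := hp e e0; near=> y.
  have [[yT _] ap] : V y /\ forall c, c \in p -> `|x - y| < `|x - c| by near: y; exact: nV.
  have [xT _] := Vx; apply: h.
  - by case/andP: xT => /ltW-> /ltW->.
  - by case/andP: yT => /ltW-> /ltW->.
  - by near: y; apply: cvgr_dist_lt.
  - move=> c /ap h1; apply/negP; move: h1.
    by case: (leP x y) => xy + /andP[c1 c2];
      rewrite ltNge => /negP; apply; rewrite ler_norml; [rewrite ler0_norm|rewrite gtr0_norm]; lra.
have mp (s : seq R) : measurable ([set` s] : set (measurableTypeR R)) /\
    measurable_fun ([set` s] : set (measurableTypeR R)) phi.
  elim: s => [|c s [IH1 IH2]].
    rewrite (_ : [set` [::]] = set0); last by apply/seteqP; split.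
    by split => //; exact: measurable_fun_set0.
  rewrite (_ : [set` c :: s] = [set c] `|` [set` s]).
    have mc : measurable ([set c] : set (measurableTypeR R)) by exact: measurable_set1.
    by split; [exact: measurableU|apply/measurable_funU => //; split => //; exact: measurable_fun_set1].
  apply/seteqP; split => y /=; first by rewrite in_cons => /orP[/eqP|]; [left|right].
  by rewrite in_cons => -[->|->]; rewrite ?eqxx ?orbT.
have mV : measurable (V : set (measurableTypeR R)) by exact: open_measurable.
have mphiV : measurable_fun (V : set (measurableTypeR R)) phi by exact: open_continuous_measurable_fun.
have [ms mphis] := mp [:: 0, T & p].
apply: (@measurable_funS _ _ _ _ (V `|` [set` [:: 0, T & p]])).
- exact: measurableU.
- move=> x; rewrite /= in_itv/= => /andP[x0 xT].
  have [xs|] := boolP (x \in [:: 0, T & p]); first by right.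
  rewrite !in_cons !negb_or => /and3P[n0 nT np]; left; split => //.
  by rewrite !lt_neqAle x0 xT eq_sym n0 nT.
- by apply/measurable_funU.
Unshelve. all: by end_near. Qed.

Lemma integrable_cst (D : set (measurableTypeR R)) (c : R) : measurable D -> (mu D < +oo)%E ->
  mu.-integrable D (EFin \o (fun=> c)).
Proof.
move=> mD fD; apply/integrableP; split; first by apply/measurable_EFinP.
by rewrite /= integral_cst// lte_mul_pinfty// lee_fin.
Qed.

Lemma indic_integral (D E : set (measurableTypeR R)) (m : R) : measurable D -> measurable E ->
  mu E = m%:E -> \int[mu]_(x in D) (\1_E x : R) <= m.
Proof.
move=> mD mE Em; rewrite /Rintegral integral_indic// -lee_fin fineK.
  by rewrite -Em; apply: le_measure; rewrite ?inE; [exact: measurableI|exact: mE|exact: subIsetl].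
rewrite ge0_fin_numE//; apply: (@le_lt_trans _ _ (mu E)); last by rewrite Em ltry.
by apply: le_measure; rewrite ?inE; [exact: measurableI|exact: mE|exact: subIsetl].
Qed.

Lemma indic_integralE (D E : set (measurableTypeR R)) (m : R) : measurable E -> E `<=` D ->
  mu E = m%:E -> \int[mu]_(x in D) (\1_E x : R) = m.
Proof.
move=> mE ED Em.
transitivity (\int[mu]_(x in D `&` E) (1 : R)).
  rewrite Rintegral_mkcondr; apply: eq_Rintegral => x _.
  by rewrite patch_indic/= mul1r.
by rewrite (setIidr ED) Rintegral_cst// mul1r -[RHS]/(fine m%:E) -Em.
Qed.

Lemma cell_measure (h : R) k : 0 < h -> mu (cell h k) = h%:E.
Proof.
move=> h0; rewrite cellE lebesgue_measure_itv/= lte_fin ltr_pM2r// ltr_nat ltnSn.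
by rewrite -EFinB -mulrBl -natrB// subSnn mul1r.
Qed.

End PiecewiseContinuous.

(** * The energy of an integrand and its Riemann sums *)

Section Energy.
Context {d : measure_display} {Omega : measurableType d} {R : realType}.
Variable P : probability Omega R.
Variables (F : R -> set (set Omega)) (filtF : filtration F).
Context {H : completeNormedModType R} (ip : H -> H -> R).
Hypotheses (ipP : inner_product ip) (sepH : separable H).
Variables (T : R) (T_gt0 : 0 < T).
Local Notation mea := (@measurable d Omega).
Local Notation smea := (@sigma_algebra_measurable d Omega).
Local Notation mu := (@lebesgue_measure R).
Implicit Types (p : seq R) (f : R -> Omega -> H).

Definition energy f : R := \int[mu]_(s in `[0, T]) (nrm P (f s) ^+ 2).

Lemma sqr_diff_le (a b c e : R) : 0 <= a <= c -> 0 <= b <= c -> a <= b + e -> 0 <= e ->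
  a ^+ 2 <= b ^+ 2 + 2 * c * e.
Proof.
move=> /andP[a0 ac] /andP[b0 bc] h e0.
have [ab|ba] := leP a b.
  have : a ^+ 2 <= b ^+ 2 by rewrite ler_sqr.
  have : 0 <= 2 * c * e by rewrite !mulr_ge0//; lra.
  lra.
rewrite -lerBlDl subr_sqr [leRHS](_ : _ = e * (2 * c)); last by ring.
rewrite ler_pM//; lra.
Qed.

Lemma nrm_diff_le f a b : adapted P F T f -> 0 <= a <= T -> 0 <= b <= T ->
  nrm P (f a) <= nrm P (f b) + nrm P (fun w => f a w - f b w).
Proof.
move=> hf aT bT.
exact: (nrm_le_shift ipP sepH (adapted_mea filtF hf aT) (adapted_mea filtF hf bT)).
Qed.

Lemma energy_pw p f : regular P F T p f -> pw_cont p T (fun s => nrm P (f s) ^+ 2).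
Proof.
move=> hr e e0; have [hf hp] := hr.
have [C C0 hC] := regular_bounded filtF ipP sepH T_gt0 hr.
have C1 : 0 < 2 * C + 1 by lra.
have [eta eta0 hm] := hp _ (divr_gt0 e0 C1); exists eta => // a b aT bT ab nc.
have {}hm := hm a b aT bT ab nc.
have : 2 * C * (e / (2 * C + 1)) <= e.
  rewrite mulrA ler_pdivrMr// mulrC ler_pM2l//; lra.
have h1 := @sqr_diff_le (nrm P (f a)) (nrm P (f b)) C (e / (2 * C + 1)).
have h2 := @sqr_diff_le (nrm P (f b)) (nrm P (f a)) C (e / (2 * C + 1)).
rewrite !nrm_ge0 !hC//= in h1 h2.
have k1 := nrm_diff_le hf aT bT; have k2 := nrm_diff_le hf bT aT; rewrite nrmBC in k2.
have e1 : 0 <= e / (2 * C + 1) by rewrite divr_ge0// ltW.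
have {}h1 := h1 isT isT (le_trans k1 (lerD (lexx _) hm)) e1.
have {}h2 := h2 isT isT (le_trans k2 (lerD (lexx _) hm)) e1.
by move=> h3; rewrite ler_norml; apply/andP; split; lra.
Qed.

Lemma energy_integrable p f : regular P F T p f ->
  mu.-integrable `[0, T] (EFin \o (fun s => nrm P (f s) ^+ 2)).
Proof.
move=> hr; have [C C0 hC] := regular_bounded filtF ipP sepH T_gt0 hr.
have mI : measurable (`[0, T]%classic : set (measurableTypeR R)) by exact: measurable_itv.
apply: (@integrable_dom _ _ _ (fun=> C ^+ 2)) => //.
- exact: (pw_measurable (energy_pw hr)).
- by apply: integrable_cst => //; rewrite lebesgue_measure_itv/= lte_fin T_gt0 -EFinB ltry.
- move=> s; rewrite /= in_itv/= => sT; rewrite ger0_norm ?sqr_ge0// ler_sqr ?nnegrE ?nrm_ge0//.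
  exact: hC.
Qed.

(** A Riemann sum is the integral of a step function. Away from p it exceeds the squared norm by at
    most 2 C eps, and near p it is at most C^2 on a set of small measure. The isometry calls only
    for this upper estimate. *)
Lemma riemann_le p f (e : R) : regular P F T p f -> 0 < e -> \forall n \near \oo,
  \sum_(k < n.+1) (T / n.+1%:R) * nrm P (f (unif T n k)) ^+ 2 <= energy f + e.
Proof.
move=> hr e0; have [hf hp] := hr.
have [C C0 hC] := regular_bounded filtF ipP sepH T_gt0 hr.
pose eps := e / (4 * (C + 1) * T).
have D0 : 0 < 4 * (C + 1) * T by rewrite !mulr_gt0//; lra.
have eps0 : 0 < eps by rewrite divr_gt0.
have [eta eta0 hm] := hp _ eps0.
pose K := C ^+ 2 * (size p)%:R * 2 + 1.
have K0 : 0 < K by rewrite ltr_wpDl// !mulr_ge0// sqr_ge0.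
near=> n; pose dl := T / n.+1%:R.
have dl0 : 0 < dl by rewrite divr_gt0.
have dleta : dl < eta.
  apply: (@le_lt_trans _ _ (eta / 2)); last by lra.
  have mm : mesh_le (unif T n) n.+1 (eta / 2) by near: n; apply: unif_mesh; [exact: ltW|lra].
  by have := mm 0%N isT; rewrite unif_step.
have dlK : dl <= e / (2 * K).
  have mm : mesh_le (unif T n) n.+1 (e / (2 * K)).
    by near: n; apply: unif_mesh; [exact: ltW|rewrite divr_gt0// mulr_gt0].
  by have := mm 0%N isT; rewrite unif_step.
pose J : set (measurableTypeR R) := `[0, T[%classic.
have mJ : measurable J by exact: measurable_itv.
have fJ : (mu J < +oo)%E by rewrite lebesgue_measure_itv/= lte_fin T_gt0 -EFinB ltry.
pose q s := nrm P (f s) ^+ 2.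
pose st x := \sum_(k < n.+1) (\1_(cell dl k) x : R) * q (unif T n k).
pose Bc (c : R) : set (measurableTypeR R) := `[c - dl, c + dl]%classic.
have mB c : measurable (Bc c) by exact: measurable_itv.
(* If a point c of p separates x from the node of its cell, then x is within dl of c; there the
   crude bound C^2 is added. The two corrections integrate to at most e / 2 each. *)
pose phi x := (q x + 2 * C * eps) + \sum_(c <- p) (\1_(Bc c) x : R) * C ^+ 2.
have jc k : mu.-integrable J (EFin \o (fun x => (\1_(cell dl k) x : R) * q (unif T n k))).
  apply: (integrableZr mJ _ (integrable_indicator mJ _ fJ)); exact: measurable_cell.
have jB c : mu.-integrable J (EFin \o (fun x => (\1_(Bc c) x : R) * C ^+ 2)).
  exact: (integrableZr mJ _ (integrable_indicator mJ (mB c) fJ)).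
have [jst Est] := @Rintegral_sum R J _ (index_enum 'I_n.+1) _ mJ jc.
have [jBs EBs] := @Rintegral_sum R J _ p _ mJ jB.
have jq : mu.-integrable J (EFin \o q).
  apply: (integrableS _ _ _ (energy_integrable hr)) => //.
  by move=> x; rewrite /J /= !in_itv/= => /andP[-> /ltW].
have jcst : mu.-integrable J (EFin \o (fun=> 2 * C * eps)) by exact: integrable_cst.
have cJ (k : 'I_n.+1) : cell dl k `<=` J.
  move=> x /andP[x1 x2]; rewrite /J /= in_itv/=; apply/andP; split.
    by apply: le_trans x1; rewrite mulr_ge0// ltW.
  apply: lt_le_trans x2 _; rewrite (_ : T = n.+1%:R * dl) ?ler_pM2r ?ler_nat//.
  by rewrite /dl mulrCA divff ?mulr1// pnatr_eq0.
have -> : \sum_(k < n.+1) (T / n.+1%:R) * nrm P (f (unif T n k)) ^+ 2 = \int[mu]_(x in J) st x.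
  rewrite Est; apply: eq_bigr => k _; rewrite RintegralZr; [|exact: mJ|].
    by rewrite (indic_integralE _ (cJ k) (cell_measure k dl0))//; exact: measurable_cell.
  by apply: integrable_indicator => //; exact: measurable_cell.
apply: (@le_trans _ _ (\int[mu]_(x in J) phi x)).
  apply: le_Rintegral => //; first by exact: (integrableD mJ (integrableD mJ jq jcst) jBs).
  move=> x xJ; move: (xJ); rewrite /J /= in_itv/= => /andP[x0 xT].
  have [|j cx _] := @step_index R dl x n.+1 dl0 x0.
    by rewrite /dl mulrCA divff ?mulr1// pnatr_eq0.
  have -> : st x = q (unif T n j).
    rewrite /st (bigD1 j)//= big1 ?addr0 => [|i ij]; first by rewrite indicE mem_set// mul1r.
    rewrite indicE memNset ?mul0r// => ci; case/eqP: ij; apply/val_inj.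
    exact: (cell_inj dl0 ci cx).
  have xT' : 0 <= x <= T by rewrite x0 ltW.
  have jT : 0 <= unif T n j <= T by exact: nodes_in (unif_nodes n (ltW T_gt0)) (ltnW (ltn_ord j)).
  have /andP[x1 x2] : unif T n j <= x < unif T n j + dl.
    by move: cx; rewrite /unif -natr1 mulrDl mul1r.
  have s0 (s : seq R) : 0 <= \sum_(c <- s) (\1_(Bc c) x : R) * C ^+ 2.
    by apply: sumr_ge0 => c _; rewrite mulr_ge0 ?sqr_ge0.
  have [/hasP[c cp cb]|/hasPn no] := boolP (has (fun c => Num.min (unif T n j) x <= c <= Num.max (unif T n j) x) p).
    rewrite /phi (big_rem c)//=.
    have -> : (\1_(Bc c) x : R) = 1.
      rewrite indicE mem_set// /Bc /= in_itv/=; move: cb; rewrite (min_l x1) (max_r x1); lra.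
    have : q (unif T n j) <= C ^+ 2 by rewrite ler_sqr ?nnegrE ?nrm_ge0 ?hC.
    have : 0 <= q x by exact: sqr_ge0.
    have : 0 <= 2 * C * eps by apply: mulr_ge0; [exact: mulr_ge0|exact: ltW].
    have := s0 (rem c p); lra.
  apply: (@le_trans _ _ (q x + 2 * C * eps)); last by rewrite lerDl.
  apply: sqr_diff_le; rewrite ?nrm_ge0 ?hC//; last exact: ltW.
  apply: le_trans (nrm_diff_le hf jT xT') _; rewrite lerD2l.
  apply: hm => //; rewrite distrC ger0_norm ?subr_ge0//; lra.
rewrite RintegralD//; last exact: (integrableD mJ jq jcst).
rewrite RintegralD// EBs.
have -> : \int[mu]_(x in J) q x = energy f.
  by rewrite /J (Rintegral_itv_bndo_bndc (a := BLeft 0)).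
rewrite -addrA lerD2l [leRHS]splitr; apply: lerD.
  have mT : fine (mu J) = T by rewrite lebesgue_measure_itv/= lte_fin T_gt0 -EFinB/= subr0.
  rewrite Rintegral_cst// [X in _ * X]mT.
  have -> : 2 * C * eps * T = C * (e / (2 * (C + 1))).
    by rewrite /eps; field; rewrite !gt_eqF//; lra.
  rewrite mulrA ler_pdivrMr; last by lra.
  rewrite (_ : e / 2 * (2 * (C + 1)) = C * e + e); last by field.
  by rewrite lerDl ltW.
apply: (@le_trans _ _ (\sum_(c <- p) (2 * dl) * C ^+ 2)).
  apply: ler_sum => c _; rewrite RintegralZr//; last exact: integrable_indicator.
  rewrite ler_wpM2r ?sqr_ge0//; apply: indic_integral => //.
  rewrite lebesgue_measure_itv/= lte_fin ltrBlDr -addrA ltrDl addr_gt0//.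
  by rewrite -EFinB; congr EFin; ring.
rewrite big_const_seq count_predT iter_addr_0 -[_ *+ size p]mulr_natr.
apply: (@le_trans _ _ (K * dl)).
  rewrite (_ : K * dl = 2 * dl * C ^+ 2 * (size p)%:R + dl); last by rewrite /K; ring.
  by rewrite lerDl ltW.
by move: dlK; rewrite invfM mulrA ler_pdivlMr// mulrC.
Unshelve. all: by end_near. Qed.

End Energy.

(** * Stochastic convolutions as processes continuous in L2 *)

Section Process.
Context {d : measure_display} {Omega : measurableType d} {R : realType}.
Variable P : probability Omega R.
Variables (F : R -> set (set Omega)) (filtF : filtration F).
Variables (W : nat -> R -> Omega -> R).
Hypotheses (wW : forall i, wiener_process P F (W i)) (indW : independent_processes P W).
Context {H : completeNormedModType R} (ip : H -> H -> R).
Hypotheses (ipP : inner_product ip) (sepH : separable H).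
Variables (T : R) (T_gt0 : 0 < T).
Variables (U : R -> H -> H) (M : R) (M0 : 0 <= M).
Hypotheses (bU : forall t, 0 <= t -> bounded_operator (U t))
  (cU : forall x, {within `[0, +oo[, continuous (fun t : R => U t x)})
  (hM : forall t x, 0 <= t <= T -> `|U t x| <= M * `|x|).
Local Notation mea := (@measurable d Omega).
Local Notation smea := (@sigma_algebra_measurable d Omega).
Implicit Types (p : seq R) (f : R -> Omega -> H).

(** Z is a version of the convolution at time tau, written as an integral over the fixed interval
    [0, T] so that values at different times can be subtracted under one integral. *)
Definition conv_value f B tau Z := M2 P mea Z /\ stoch_lim P B T (cv U f tau) Z.

Lemma conv_exists i p f tau : regular P F T p f -> tau <= T -> exists Z, conv_value f (W i) tau Z.
Proof.
move=> hr tT; have [hf hp] := hr.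
have [C C0 hC] := regular_bounded filtF ipP sepH T_gt0 hr.
apply: (stoch_exists filtF ipP sepH (wW i) (p := tau :: p) (C := M * C)).
- exact: ltW.
- exact: (cv_adapted filtF ipP sepH M0 bU hM hf tT).
- move=> e e0; have [eta eta0 h] := cv_modulus filtF ipP sepH T_gt0 M0 bU cU hM hr e0.
  by exists eta => //; exact: h.
- exact: (cv_bounded filtF M0 bU hM hf tT hC C0).
Qed.

(** The bound does not depend on tau, which makes the series over the noises converge uniformly in
    time. *)
Lemma conv_energy i p f tau Z : regular P F T p f -> tau <= T -> conv_value f (W i) tau Z ->
  nrm P Z ^+ 2 <= M ^+ 2 * energy P T f.
Proof.
move=> hr tT [MZ lZ]; have [hf hp] := hr; have T0 := ltW T_gt0.
have hcv := cv_adapted filtF ipP sepH M0 bU hM hf tT.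
apply: (stoch_lim_energy filtF ipP sepH (wW i) T0 hcv MZ lZ) => e e0.
have M1 : 0 < M ^+ 2 + 1 by rewrite ltr_wpDl// sqr_ge0.
apply: filterS (riemann_le filtF ipP sepH T_gt0 hr (divr_gt0 e0 M1)) => n hn.
apply: (@le_trans _ _ (M ^+ 2 * \sum_(k < n.+1) (T / n.+1%:R) * nrm P (f (unif T n k)) ^+ 2)).
  rewrite mulr_sumr; apply: ler_sum => k _; rewrite [leRHS]mulrCA ler_wpM2l ?divr_ge0//.
  have kT := nodes_in (unif_nodes n T0) (ltnW (ltn_ord k)).
  rewrite -exprMn ler_sqr ?nnegrE ?mulr_ge0 ?nrm_ge0//.
  rewrite /cv; case: (ltP (unif T n k) tau) => [st|_]; last by rewrite nrm0 mulr_ge0 ?nrm_ge0.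
  apply: (nrm_op M0 bU hM); last exact: (adapted_mea filtF hf kT).
  case/andP: kT => k0 _; rewrite subr_ge0 (ltW st)/=; lra.
apply: le_trans (ler_wpM2l (sqr_ge0 M) hn) _; rewrite mulrDr lerD2l.
rewrite mulrA ler_pdivrMr// mulrC ler_pM2l//; lra.
Qed.

(** For tau' <= tau the difference of the integrands is an oscillation at scale tau - tau' when s <
    tau', is bounded by 2 M C when tau' <= s < tau, and vanishes afterwards. The middle part lives
    on an interval of length at most eta, so each part contributes at most e^2 / 2. *)
Lemma conv_cont i p f (e : R) : regular P F T p f -> 0 < e -> exists2 eta : R, 0 < eta &
  forall tau tau' Z Z', 0 <= tau <= T -> 0 <= tau' <= T -> `|tau - tau'| <= eta ->
    conv_value f (W i) tau Z -> conv_value f (W i) tau' Z' -> nrm P (fun w => Z w - Z' w) <= e.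
Proof.
move=> hr e0; have [hf hp] := hr; have T0 := ltW T_gt0.
have [C C0 hC] := regular_bounded filtF ipP sepH T_gt0 hr.
pose e1 := Num.sqrt (e ^+ 2 / (2 * (T + 1))).
have T1 : 0 < T + 1 by rewrite ltr_wpDl.
have e10 : 0 < e1 by rewrite sqrtr_gt0 divr_gt0 ?exprn_gt0// mulr_gt0.
have [h h0 ho] := osc_small filtF ipP sepH T_gt0 M0 bU cU hM hr e10.
pose K := (2 * (M * C)) ^+ 2 * 3 + 1.
have K0 : 0 < K by rewrite ltr_wpDl// mulr_ge0// sqr_ge0.
pose eta := Num.min h (e ^+ 2 / (2 * K)).
have eta0 : 0 < eta by rewrite lt_min h0 divr_gt0 ?exprn_gt0// mulr_gt0.
have etah : eta <= h by rewrite ge_min lexx.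
exists eta => //.
suff main tau tau' Z Z' : 0 <= tau <= T -> 0 <= tau' <= T -> tau' <= tau -> tau - tau' <= eta ->
    conv_value f (W i) tau Z -> conv_value f (W i) tau' Z' -> nrm P (fun w => Z w - Z' w) <= e.
  move=> tau tau' Z Z' tT tT' dt hZ hZ'; have [tt|tt] := leP tau' tau.
    by apply: (main tau tau') => //; apply: le_trans dt; exact: ler_norm.
  rewrite nrmBC; apply: (main tau' tau) => //; first exact: ltW.
  by apply: le_trans dt; rewrite distrC; exact: ler_norm.
move=> /andP[t0 tT] /andP[t0' tT'] tt dt [MZ lZ] [MZ' lZ'].
have hcv := cv_adapted filtF ipP sepH M0 bU hM hf tT.
have hcv' := cv_adapted filtF ipP sepH M0 bU hM hf tT'.
have hG := adaptedB filtF ipP sepH hcv hcv'.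
have lG := stoch_limB filtF ipP sepH (wW i) hcv hcv' MZ MZ' lZ lZ'.
have bcv := cv_bounded filtF M0 bU hM hf tT hC C0.
have bcv' := cv_bounded filtF M0 bU hM hf tT' hC C0.
pose D := (2 * (M * C)) ^+ 2.
have D0 : 0 <= D by exact: sqr_ge0.
have ptw s : 0 <= s <= T -> nrm P (fun w => cv U f tau s w - cv U f tau' s w) ^+ 2 <=
    e1 ^+ 2 + D * (if `|s - tau'| <= eta then 1 else 0).
  move=> sT; have Ms := adapted_mea filtF hf sT; have /andP[s0 _] := sT.
  have ind0 : 0 <= D * (if `|s - tau'| <= eta then 1 else 0 : R) by rewrite mulr_ge0//; case: ifP.
  have [st'|t's] := ltP s tau'.
    apply: (@le_trans _ _ (e1 ^+ 2)); last by rewrite lerDl.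
    have st := lt_le_trans st' tt.
    have u1 : 0 <= tau - s <= T by rewrite subr_ge0 (ltW st)/=; lra.
    have u2 : 0 <= tau' - s <= T by rewrite subr_ge0 (ltW st')/=; lra.
    rewrite ler_sqr ?nnegrE ?nrm_ge0 ?(ltW e10)// /cv st st'.
    apply: (nrm_le_fun (g := fun w => osc U T h (f s w))).
    - apply: (M2m_B ipP sepH); exact: (M2_op M0 bU hM smea (fun _ => id)).
    - exact: (osc_integ T_gt0 M0 bU hM (ltW h0) Ms).
    - exact: ltW.
    - exact: ho.
    - move=> w; apply: (le_osc hM) => //; have -> : tau - s - (tau' - s) = tau - tau' by ring.
      by rewrite ger0_norm ?subr_ge0//; exact: le_trans etah.
  have [st|ts] := ltP s tau.
    have -> : `|s - tau'| <= eta by rewrite ger0_norm ?subr_ge0//; lra.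
    rewrite mulr1; apply: (@le_trans _ _ D); last by rewrite lerDr sqr_ge0.
    rewrite ler_sqr ?nnegrE ?nrm_ge0 ?mulr_ge0//.
    apply: le_trans (nrmB_le ipP sepH (adapted_mea filtF hcv sT) (adapted_mea filtF hcv' sT)) _.
    by rewrite mulr_natl mulr2n; apply: lerD; [exact: bcv|exact: bcv'].
  rewrite /cv (ltNge s tau') t's (ltNge s tau) ts /=.
  rewrite (_ : (fun w => _) = fun=> 0) ?nrm0; last by apply/funext => w; rewrite subrr.
  by rewrite expr0n/= addr_ge0// sqr_ge0.
have fin : T * e1 ^+ 2 + D * (3 * eta) <= e ^+ 2.
  rewrite [e1 ^+ 2]sqr_sqrtr; last by rewrite divr_ge0 ?sqr_ge0// mulr_ge0// ltW.
  have h1 : T * (e ^+ 2 / (2 * (T + 1))) <= e ^+ 2 / 2.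
    rewrite mulrA ler_pdivrMr ?mulr_gt0// (_ : e ^+ 2 / 2 * _ = e ^+ 2 * (T + 1)); last by field.
    by have := sqr_ge0 e; nra.
  have h2 : K * eta <= e ^+ 2 / 2.
    have : eta <= e ^+ 2 / (2 * K) by rewrite ge_min lexx orbT.
    by rewrite invfM mulrA ler_pdivlMr// mulrC.
  have : D * (3 * eta) <= K * eta.
    rewrite (_ : K * eta = D * (3 * eta) + eta); last by rewrite /K /D; ring.
    by rewrite lerDl ltW.
  lra.
rewrite -ler_sqr ?nnegrE ?nrm_ge0 ?(ltW e0)//; apply: le_trans fin.
apply: (stoch_lim_energy filtF ipP sepH (wW i) T0 hG (M2m_B ipP sepH MZ MZ') lG) => r r0.
apply: filterS (unif_mesh T0 eta0) => n mn.
have nn := unif_nodes n T0.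
apply: (@le_trans _ _ (\sum_(k < n.+1) ((T / n.+1%:R) * e1 ^+ 2 +
    D * ((unif T n k.+1 - unif T n k) * (if `|unif T n k - tau'| <= eta then 1 else 0))))).
  apply: ler_sum => k _; rewrite unif_step [X in _ <= _ + X]mulrCA -mulrDr ler_wpM2l ?divr_ge0//.
  by apply: ptw; exact: nodes_in nn (ltnW (ltn_ord k)).
rewrite big_split/= -[X in _ + X]mulr_sumr; apply: (@le_trans _ _ (T * e1 ^+ 2 + D * (3 * eta))).
  apply: lerD; last by rewrite ler_wpM2l//; exact: near_sum nn mn (ltW eta0).
  rewrite sumr_const card_ord -[_ *+ n.+1]mulr_natr le_eqVlt; apply/orP; left; apply/eqP.
  have n1 : n.+1%:R != 0 :> R by rewrite pnatr_eq0.
  by move: (n.+1%:R : R) n1 => N n1; field.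
by rewrite lerDl ltW.
Qed.

(** This is used for S with psi, for S with phi and for the identity family with psi. The sequence
    [tl] bounds the remainder at all times at once; with continuity of each term it gives continuity
    of the sum. *)
Lemma conv_process (f : nat -> R -> Omega -> H) (p : nat -> seq R) :
  (forall i, regular P F T (p i) (f i)) -> cvgn (series (fun i => energy P T (f i))) ->
  exists (Y : nat -> R -> Omega -> H) (Z : R -> Omega -> H) (tl : nat -> R),
  [/\ forall i tau, 0 <= tau <= T -> conv_value (f i) (W i) tau (Y i tau),
      forall tau, 0 <= tau <= T -> M2 P mea (Z tau),
      tl n @[n --> \oo] --> 0,
      forall n tau, 0 <= tau <= T ->
        nrm P (fun w => \sum_(i < n) Y i tau w - Z tau w) ^+ 2 <= tl n
    & forall e : R, 0 < e -> exists2 eta : R, 0 < eta & forall tau tau',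
        0 <= tau <= T -> 0 <= tau' <= T -> `|tau - tau'| <= eta ->
        nrm P (fun w => Z tau w - Z tau' w) <= e].
Proof.
move=> hr cE; have T0 := ltW T_gt0.
have /choice[Y hY] : forall i, exists Y : R -> Omega -> H,
    forall tau, 0 <= tau <= T -> conv_value (f i) (W i) tau (Y tau).
  move=> i; have /choice[Y hY] : forall tau, exists Z : Omega -> H,
      0 <= tau <= T -> conv_value (f i) (W i) tau Z.
    move=> tau; have [/andP[_ tT]|nt] := boolP (0 <= tau <= T); last by exists (fun=> 0).
    by have [Z hZ] := conv_exists i (hr i) tT; exists Z.
  by exists Y.
pose c i := M ^+ 2 * energy P T (f i).
have cc : cvgn (series c).
  exact: (is_cvg_seriesZ cE).
pose tl n := limn (series c) - series c n.
have /choice[Z hZ] : forall tau, exists Z : Omega -> H, 0 <= tau <= T -> M2 P mea Z /\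
    forall n, nrm P (fun w => \sum_(i < n) Y i tau w - Z w) ^+ 2 <= tl n.
  move=> tau; have [tT|nt] := boolP (0 <= tau <= T); last by exists (fun=> 0).
  have /andP[_ tT'] := tT.
  have [] := @orth_series _ _ _ P _ _ ipP sepH (fun i => Y i tau) c _ _ _ cc; last first.
  - by move=> X hX; exists X.
  - by move=> i; exact: conv_energy (hr i) tT' (hY i tau tT).
  - move=> i j ij; have [Mi li] := hY i tau tT; have [Mj lj] := hY j tau tT.
    have [hfi _] := hr i; have [hfj _] := hr j.
    exact: (stoch_lim_orth filtF ipP sepH wW indW ij T0
      (cv_adapted filtF ipP sepH M0 bU hM hfi tT') (cv_adapted filtF ipP sepH M0 bU hM hfj tT') Mi Mj li lj).
  - by move=> i; case: (hY i tau tT).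
have tl0 : tl n @[n --> \oo] --> 0.
  by rewrite -(subrr (limn (series c))); apply: cvgB => //; exact: cvg_cst.
exists Y, Z, tl; split => //.
- by move=> tau tT; case: (hZ tau tT).
- by move=> n tau tT; case: (hZ tau tT) => _; exact.
- move=> e e0; have e3 : 0 < e / 3 by rewrite divr_gt0.
  have e32 : 0 < (e / 3) ^+ 2 by rewrite exprn_gt0.
  have /cvgr0Pnorm_le/(_ _ e32)[n _ /(_ n (leqnn n)) hn] := tl0.
  have n0 : 0 < n.+1%:R :> R by [].
  have en : 0 < e / 3 / n.+1%:R by rewrite divr_gt0.
  (* Beyond the first n terms the remainder is at most e / 3 at every time, so a common eta is
     sought for finitely many processes; [n.+1] covers n = 0. *)
  have [eta eta0 heta] : exists2 eta : R, 0 < eta & forall i, (i < n)%N -> forall tau tau',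
      0 <= tau <= T -> 0 <= tau' <= T -> `|tau - tau'| <= eta ->
      nrm P (fun w => Y i tau w - Y i tau' w) <= e / 3 / n.+1%:R.
    elim: {hn} n (e / 3 / n.+1%:R) en {n0} => [|n IH] r r0; first by exists 1.
    have [eta1 eta10 h1] := IH r r0; have [eta2 eta20 h2] := conv_cont n (hr n) r0.
    exists (Num.min eta1 eta2) => [|i]; first by rewrite lt_min eta10.
    rewrite ltnS leq_eqVlt => /orP[/eqP->|lin] tau tau' tT tT' dt.
      by apply: h2 (hY _ _ tT) (hY _ _ tT') => //; apply: le_trans dt _; rewrite ge_min lexx orbT.
    by apply: h1 => //; apply: le_trans dt _; rewrite ge_min lexx.
  exists eta => // tau tau' tT tT' dt.
  have MY i s : 0 <= s <= T -> M2 P mea (Y i s) by move=> sT; case: (hY i s sT).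
  have MS s : 0 <= s <= T -> M2 P mea (fun w => \sum_(i < n) Y i s w).
    by move=> sT; apply: (M2m_sum ipP sepH) => i; exact: MY.
  have MZ s : 0 <= s <= T -> M2 P mea (Z s) by move=> sT; case: (hZ s sT).
  have tlb s : 0 <= s <= T -> nrm P (fun w => \sum_(i < n) Y i s w - Z s w) <= e / 3.
    move=> sT; rewrite -ler_sqr ?nnegrE ?nrm_ge0 ?(ltW e3)//.
    have [_ /(_ n)] := hZ s sT; move=> /le_trans; apply.
    by apply: le_trans hn; exact: ler_norm.
  apply: le_trans (nrm_tri ipP sepH (MZ _ tT) (MS _ tT) (MZ _ tT')) _.
  rewrite nrmBC (_ : e = e / 3 + (e / 3 + e / 3)); last by field.
  apply: lerD; first exact: tlb.
  apply: le_trans (nrm_tri ipP sepH (MS _ tT) (MS _ tT') (MZ _ tT')) _.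
  apply: lerD; last exact: tlb.
  have -> : (fun w => \sum_(i < n) Y i tau w - \sum_(i < n) Y i tau' w) =
      (fun w => \sum_(i < n) (Y i tau w - Y i tau' w)) by apply/funext => w; rewrite sumrB.
  apply: le_trans (nrm_sum_le ipP sepH _ _) _.
    by move=> i; apply: (M2m_B ipP sepH); exact: MY.
  apply: (@le_trans _ _ (\sum_(i < n) e / 3 / n.+1%:R)).
    by apply: ler_sum => i _; exact: heta.
  rewrite sumr_const card_ord -[_ *+ n]mulr_natr mulrAC ler_pdivrMr// ler_pM2l// ler_nat//.
Qed.

End Process.

(** * The Volterra equation *)

Section Masses.
Context {R : realType}.
Local Notation mu := (@lebesgue_measure R).

Lemma small_mul (c r : R) : 0 <= c -> 0 < r ->
  exists2 q : R, 0 < q & forall q', q' <= q -> c * q' <= r.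
Proof.
move=> c0 r0; have c1 : 0 < c + 1 by rewrite ltr_wpDl.
exists (r / (c + 1)) => [|q' h]; first by rewrite divr_gt0.
apply: le_trans (ler_wpM2l c0 h) _; rewrite mulrA ler_pdivrMr// mulrC ler_pM2l//; lra.
Qed.

Lemma small_sqr (c r : R) : 0 <= c -> 0 < r -> exists2 q : R, 0 < q & c * q ^+ 2 <= r.
Proof.
move=> c0 r0; have [q q0 h] := small_mul c0 r0; exists (Num.min q 1); first by rewrite lt_min q0 ltr01.
have m0 : 0 < Num.min q 1 by rewrite lt_min q0 ltr01.
apply: h; rewrite expr2; apply: (@le_trans _ _ (Num.min q 1 * 1)).
  by rewrite ler_pM2l// ge_min lexx orbT.
by rewrite mulr1 ge_min lexx.
Qed.

Variables (a0 : R -> R) (ia0 : mu.-integrable setT (EFin \o a0)).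

Lemma sum_cells (g : R -> R) (D : set (measurableTypeR R)) h n : 0 < h -> measurable D ->
  (forall l, (l < n)%N -> cell h l `<=` D) ->
  mu.-integrable D (EFin \o g) -> (forall x, D x -> 0 <= g x) ->
  \sum_(l < n) \int[mu]_(x in cell h l) g x <= \int[mu]_(x in D) g x.
Proof.
move=> h0 mD cD jg g0.
have jc (l : 'I_n) : mu.-integrable D (EFin \o (fun x => g x * (\1_(cell h l) x : R))).
  apply: (@integrable_dom _ D _ g) => //.
    apply: measurable_funM; first by have /integrableP[/measurable_EFinP] := jg.
    by apply: measurable_indic; exact: measurable_cell.
  move=> x Dx; rewrite normrM (ger0_norm (g0 x Dx)) indicE; case: (_ \in _).
    by rewrite normr1 mulr1.
  by rewrite normr0 mulr0 g0.
have [js Es] := @Rintegral_sum R D _ (index_enum 'I_n) _ mD jc.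
rewrite (eq_bigr (fun l : 'I_n => \int[mu]_(x in D) (g x * (\1_(cell h l) x : R)))); last first.
  move=> l _; transitivity (\int[mu]_(x in D `&` cell h l) g x).
    by rewrite (setIidr (cD _ (ltn_ord l))).
  by rewrite Rintegral_mkcondr; apply: eq_Rintegral => x _; rewrite patch_indic.
rewrite -Es; apply: le_Rintegral => // x Dx.
have [[j cj]|no] := pselect (exists j : 'I_n, cell h j x); last first.
  rewrite big1 ?g0// => j _; rewrite indicE memNset ?mulr0// => cj.
  by apply: no; exists j.
rewrite (bigD1 j)//= big1 ?addr0 => [|i ij]; first by rewrite indicE mem_set// mulr1.
rewrite indicE memNset ?mulr0// => ci; case/eqP: ij; apply/val_inj.
exact: (cell_inj h0 ci cj).
Qed.

(** The weights are integrals over disjoint cells of the reflected kernel, so their absolute values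
    add up to at most its L1 norm. *)
Lemma mass_sum t h n : 0 < h ->
  \sum_(l < n) `|mass a0 (t - l.+1%:R * h) (t - l%:R * h)| <= tmass a0.
Proof.
move=> h0; have jn : mu.-integrable setT (EFin \o (fun x => `|a0 x|)) by exact: (integrable_norm ia0).
have jr := reflect_integrable t ia0; have jrn := reflect_integrable t jn.
apply: (@le_trans _ _ (\sum_(l < n) \int[mu]_(x in cell h l) `|a0 (t - x)|)).
  apply: ler_sum => l _; rewrite -(cell_mass ia0)//; apply: Rintegral_norm_le => //.
  - exact: measurable_cell.
  - by apply: integrableS jr => //; exact: measurable_cell.
  - by apply: integrableS jrn => //; exact: measurable_cell.
apply: le_trans (sum_cells h0 measurableT _ jrn _) _ => //.
have := reflect_integral t jn measurableT; rewrite (_ : [set x0 | _] = setT); last by apply/seteqP; split.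
by rewrite /tmass /Rintegral => <-.
Qed.

End Masses.

(** Here rx and ry stand for approximations of x and y, and v for one of u. The identity splits the
    error in the Volterra equation, once with Riemann sums and once with partial sums of the series
    as approximations. *)
Lemma insert_three (V : zmodType) (x y u rx ry v : V) :
  (x - y) - u = ((x - rx) - (y - ry)) + ((rx - ry) - v) + (v - u).
Proof.
have -> : (x - rx) - (y - ry) = (x - y) - (rx - ry).
  by rewrite !opprB [LHS]addrACA [RHS]addrACA [- rx - y]addrC.
by rewrite [RHS]addrA [X in X + v]addrA !subrK.
Qed.

(** * The discretised Volterra equation for one noise *)

Section MainLimit.
Context {d : measure_display} {Omega : measurableType d} {R : realType}.
Variable P : probability Omega R.
Variables (F : R -> set (set Omega)) (filtF : filtration F).
Variables (W : nat -> R -> Omega -> R).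
Hypotheses (wW : forall i, wiener_process P F (W i)).
Context {H : completeNormedModType R} (ip : H -> H -> R).
Hypotheses (ipP : inner_product ip) (sepH : separable H).
Variables (T : R) (T_gt0 : 0 < T).
Variables (D : set H) (A : H -> H) (a a0 : R -> R) (S : R -> H -> H) (M : R).
Hypotheses (resS : resolvent D A a S).
Hypotheses (M0 : 0 <= M) (hM : forall t x, 0 <= t <= T -> `|S t x| <= M * `|x|).
Hypotheses (a0E : forall tau, 0 <= tau <= T -> a0 tau = a tau)
  (ia0 : (@lebesgue_measure R).-integrable setT (EFin \o a0)).
Local Notation mea := (@measurable d Omega).
Local Notation smea := (@sigma_algebra_measurable d Omega).
Implicit Types (p : seq R) (f : R -> Omega -> H).

Lemma M2m_Z (k : R) X : M2 P mea X -> M2 P mea (fun w => (k *: X w : H)).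
Proof. exact: (M2Z ipP sepH smea). Qed.

Lemma nrm_le_fun_ae X (g : Omega -> R) (c : R) : M2 P mea (X : Omega -> H) ->
  integ P (fun w => g w ^+ 2) -> 0 <= c -> mean P (fun w => g w ^+ 2) <= c ^+ 2 ->
  {ae P, forall w, `|X w| <= g w} -> nrm P X <= c.
Proof.
move=> [bX iX] ig c0 gc Xg; rewrite -ler_sqr ?nnegrE ?nrm_ge0// nrm_sqE; apply: le_trans gc.
rewrite -lee_fin !mean_EFin//; apply: ae_ge0_le_integral => //.
- by case/integrableP: iX.
- by move=> w _; rewrite lee_fin sqr_ge0.
- by case/integrableP: ig.
- apply: filterS Xg => w hw _; rewrite lee_fin ler_sqr ?nnegrE//.
  exact: le_trans hw.
Qed.

Lemma nrm_lincomb_le n (b : 'I_n -> R) (V : 'I_n -> Omega -> H) (c : R) :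
  (forall l, M2 P mea (V l)) -> (forall l, nrm P (V l) <= c) ->
  nrm P (fun w => \sum_(l < n) b l *: V l w) <= (\sum_(l < n) `|b l|) * c.
Proof.
move=> hV Vc; apply: le_trans (nrm_sum_le ipP sepH _ _) _.
  by move=> l; exact: M2m_Z.
rewrite mulr_suml; apply: ler_sum => l _.
rewrite nrmZ; [|exact: hV]; by rewrite ler_wpM2l.
Qed.

Lemma adapted_le t f : t <= T -> adapted P F T f -> adapted P F t f.
Proof. by move=> tT hf s /andP[s0 st]; apply: hf; rewrite s0 (le_trans st). Qed.

Lemma modulus_le p t f (eta e : R) : t <= T -> modulus P p T f eta e -> modulus P p t f eta e.
Proof.
move=> tT hm x y /andP[x0 xt] /andP[y0 yt]; apply: hm.
  by rewrite x0 (le_trans xt).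
by rewrite y0 (le_trans yt).
Qed.

Lemma bounded_le t f C : t <= T -> bounded P T f C -> bounded P t f C.
Proof. by move=> tT hC x /andP[x0 xt]; apply: hC; rewrite x0 (le_trans xt). Qed.

(* The factor b_l of S(t_l - t_k) A x in the discretised resolvent equation. *)
Definition weight (t : R) n (l : nat) : R :=
  mass a0 (t - l.+1%:R * (t / n.+1%:R)) (t - l%:R * (t / n.+1%:R)).

Lemma weight_sum t n : 0 < t -> \sum_(l < n.+1) `|weight t n l| <= tmass a0.
Proof. by move=> t0; apply: mass_sum => //; rewrite divr_gt0. Qed.

Lemma weight_le t n l : 0 < t -> (l < n.+1)%N -> `|weight t n l| <= tmass a0.
Proof.
move=> t0 ln; apply: le_trans (weight_sum n t0).
by rewrite (bigD1 (Ordinal ln))//= lerDl; apply: sumr_ge0.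
Qed.

Section OneNoise.
Variables (i : nat) (p : seq R) (psi phi : R -> Omega -> H).
Hypotheses (rpsi : regular P F T p psi) (rphi : regular P F T p phi).
Hypothesis Dpsi : forall tau, 0 <= tau <= T ->
  {ae P, forall w, D (psi tau w) /\ A (psi tau w) = phi tau w}.
Variables (t : R) (t0 : 0 < t) (tT : t <= T).

Let bS : forall t, 0 <= t -> bounded_operator (S t). Proof. by case: resS. Qed.
Let cS : forall x, {within `[0, +oo[, continuous (fun t : R => S t x)}.
Proof. by case: resS => _ []. Qed.

(** The integrand whose Riemann sum is that of W^Psi(t) minus that of the plain integral minus the
    weighted Riemann sums of the Z(t_l). Having the sum over l inside the integrand is the exchange
    of the two finite sums. *)
Definition defect n (s : R) (w : Omega) : H :=
  (cv S psi t s w - cv (fun _ x => x) psi t s w) -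
  \sum_(l < n.+1) weight t n l *: cv S phi (unif t n l) s w.

(** Since [cv] vanishes when its two times coincide, the sum in [defect] effectively runs over l >
    k, whereas the discretised resolvent equation needs l >= k. The missing term l = k is the one
    subtracted on the left. *)
Lemma defect_node n (k : 'I_n.+1) w : D (psi (unif t n k) w) -> A (psi (unif t n k) w) = phi (unif t n k) w ->
  `|defect n (unif t n k) w - weight t n k *: phi (unif t n k) w|
    <= tmass a0 * osc S T (t / n.+1%:R) (phi (unif t n k) w).
Proof.
set h := t / n.+1%:R; have h0 : 0 < h by rewrite divr_gt0.
have n1 : n.+1%:R != 0 :> R by rewrite pnatr_eq0.
have tE : t = n.+1%:R * h by rewrite /h mulrCA divff// mulr1.
move: (ltn_ord k); move: (val k) => {}k kn.
have nt : unif t n k = k%:R * h by [].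
have kt : unif t n k < t by rewrite nt [X in _ < X]tE ltr_pM2r// ltr_nat.
set x := psi _ w; move=> Dx Ax.
pose m := (n - k)%N; have mE : (m.+1 = n.+1 - k)%N by rewrite subSn// -ltnS.
pose r := t - unif t n k.
have rE : r = m.+1%:R * h by rewrite /r nt {1}tE mE natrB ?(ltnW kn)// mulrBl.
have rT : r <= T.
  by apply: le_trans tT; rewrite /r gerBl nt mulr_ge0// ltW.
have := resolvent_step ipP T_gt0 resS hM a0E ia0 Dx h0 rE rT.
rewrite Ax; congr (`|_| <= _).
rewrite /defect /cv kt -/x -/r -[RHS]addrA -opprD; congr (_ - _).
rewrite -(big_mkord xpredT (fun l => weight t n l *: (if unif t n k < unif t n l then
  S (unif t n l - unif t n k) (phi (unif t n k) w) else 0))).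
rewrite (@big_cat_nat _ _ _ k)//=; last exact: ltnW.
rewrite [X in _ = X + _ + _]big_nat_cond [X in _ = X + _ + _]big1 ?add0r => [|l]; last first.
  by rewrite andbT => /andP[_ lk]; rewrite ltNge ltW ?scaler0// !/(unif _ _ _) ltr_pM2r// ltr_nat.
have shift (G : nat -> H) : \sum_(k <= l < n.+1) G l = \sum_(0 <= j < m.+1) G (j + k)%N.
  by rewrite -{1}[k]add0n big_addn mE.
have wE j : weight t n (j + k) = mass a0 (r - j.+1%:R * h) (r - j%:R * h).
  rewrite /weight -/h (_ : t - (j + k).+1%:R * h = r - j.+1%:R * h); last first.
    by rewrite /r nt -addSn natrD; ring.
  by rewrite (_ : t - (j + k)%:R * h = r - j%:R * h)// /r nt natrD; ring.
rewrite (eq_bigr (fun j : 'I_m.+1 => weight t n (j + k) *: S (j%:R * h) (phi (unif t n k) w))); last first.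
  by move=> j _; rewrite wE.
rewrite shift big_mkord !big_ord_recl.
have -> : (ord0 : 'I_m.+1) = 0%N :> nat by [].
rewrite add0n ltxx scaler0 add0r [RHS]addrC; congr (_ + _).
  by rewrite mul0r; have [_ [_ ->] _ _] := resS.
apply: eq_bigr => j _; rewrite lift0.
have -> : unif t n k < unif t n (j.+1 + k) by rewrite !/(unif _ _ _) ltr_pM2r// ltr_nat ltnS leq_addl.
have -> // : unif t n (j.+1 + k) - unif t n k = j.+1%:R * h.
by rewrite /unif -/h natrD; ring.
Qed.

(** The plain integral of psi is the convolution with the constant family equal to the identity, so
    these facts give it the same treatment as the convolution with S. *)
Lemma id_bounded : forall s : R, 0 <= s -> bounded_operator ((fun (_ : R) (x : H) => x) s).
Proof. by move=> s _; split => //; exists 1 => x; rewrite mul1r. Qed.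
Lemma id_le : forall (s : R) (x : H), 0 <= s <= T -> `|(fun (_ : R) (x : H) => x) s x| <= 1 * `|x|.
Proof. by move=> s x _; rewrite mul1r. Qed.
Lemma id_cont : forall x : H, {within `[0, +oo[, continuous (fun s : R => x)}.
Proof. by move=> x; apply: continuous_subspaceT => s; exact: cst_continuous. Qed.

Lemma defect_adapted n : adapted P F t (defect n).
Proof.
have [hpsi _] := rpsi; have [hphi _] := rphi.
apply: (adaptedB filtF ipP sepH).
  apply: (adaptedB filtF ipP sepH); apply: (adapted_le tT).
    exact: (cv_adapted filtF ipP sepH M0 bS hM).
  exact: (cv_adapted filtF ipP sepH ler01 id_bounded id_le).
move=> s st; have /andP[s0 _] := st.
have sG := filt_sigma filtF s0.
apply: (M2_sum ipP sepH sG (filt_sub filtF s0)) => l.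
apply: (M2Z ipP sepH sG); apply: (adapted_le tT) st.
apply: (cv_adapted filtF ipP sepH M0 bS hM hphi).
have /andP[_ lt] := nodes_in (unif_nodes n (ltW t0)) (ltnW (ltn_ord l)).
exact: le_trans lt tT.
Qed.

(** There are four errors of at most e / 4: the Riemann sums of X, of I and of the weighted Z(t_l),
    and the Riemann sum of the defect. The third uses an estimate uniform in l together with the
    summability of the weights. *)
Lemma main_one X I (Z : R -> Omega -> H) : conv_value P T S psi (W i) t X ->
  conv_value P T (fun _ x => x) psi (W i) t I ->
  (forall tau, 0 <= tau <= T -> conv_value P T S phi (W i) tau (Z tau)) ->
  forall e : R, 0 < e -> \forall n \near \oo,
    nrm P (fun w => (X w - I w) - \sum_(l < n.+1) weight t n l *: Z (unif t n l) w) <= e.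
Proof.
move=> [MX lX] [MI lI] hZ e e0; have [hpsi _] := rpsi; have [hphi _] := rphi.
have La0 : 0 <= tmass a0 by apply: Rintegral_ge0 => x _; exact: normr_ge0.
set La := tmass a0 in La0 *.
have t0' := ltW t0.
have [C C0 hC] := regular_bounded filtF ipP sepH T_gt0 rphi.
have e4 : 0 < e / 4 by rewrite divr_gt0.
have e42 : 0 < (e / 4) ^+ 2 / 2 by rewrite divr_gt0// exprn_gt0.
have [e1 e10 he1] := small_sqr (mulr_ge0 (mulr_ge0 (ler0n _ 2) (sqr_ge0 La)) t0') e42.
have [h1 h10 ho] := osc_small filtF ipP sepH T_gt0 M0 bS cS hM rphi e10.
have [q1 q10 hq1] := small_mul (mulr_ge0 (mulr_ge0 (ler0n _ 2) (sqr_ge0 C)) (sqr_ge0 La)) e42.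
have [e' e'0 he'] := small_mul La0 e4.
have e'2 : 0 < e' ^+ 2 / 2 by rewrite divr_gt0// exprn_gt0.
have [e2 e20 he2] := small_sqr t0' e'2.
have [eta eta0 hm] := cv_modulus filtF ipP sepH T_gt0 M0 bS cS hM rphi e20.
pose K := 4 * (M * C) ^+ 2 * ((size p).+1%:R * 3).
have K0 : 0 <= K by rewrite !mulr_ge0// sqr_ge0.
have [q2 q20 hq2] := small_mul K0 e'2.
have lX' : stoch_lim P (W i) t (cv S psi t) X.
  by apply: stoch_lim_restrict lX => // s ts; apply/funext => w; rewrite /cv ltNge ts.
have lI' : stoch_lim P (W i) t (cv (fun _ x => x) psi t) I.
  by apply: stoch_lim_restrict lI => // s ts; apply/funext => w; rewrite /cv ltNge ts.
have /cvgr0Pnorm_le/(_ _ e4) nX := stoch_lim_unif t0' lX'.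
have /cvgr0Pnorm_le/(_ _ e4) nI := stoch_lim_unif t0' lI'.
pose hh := Num.min (Num.min h1 q1) (Num.min (eta / 2) q2).
have hh0 : 0 < hh by rewrite !lt_min h10 q10 q20 divr_gt0.
near=> n.
have mm : mesh_le (unif t n) n.+1 hh by near: n; exact: unif_mesh.
have nXn : `|nrm P (fun w => RS (W i) (unif t n) n.+1 (cv S psi t) w - X w)| <= e / 4 by near: n.
have nIn : `|nrm P (fun w => RS (W i) (unif t n) n.+1 (cv (fun _ x => x) psi t) w - I w)| <= e / 4.
  by near: n.
set h := t / n.+1%:R.
have h0 : 0 < h by rewrite divr_gt0.
have : h <= hh by have := mm 0%N isT; rewrite unif_step.
rewrite /hh !le_min => /andP[/andP[hh1 hq1'] /andP[heta hq2']].
have nn := unif_nodes n t0'.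
have mh : mesh_le (unif t n) n.+1 h by move=> k _; rewrite unif_step.
have nodT k : (k <= n.+1)%N -> 0 <= unif t n k <= T.
  by move=> kn; have /andP[-> kt] := nodes_in nn kn; exact: le_trans kt tT.
have hX : adapted P F t (cv S psi t).
  by apply: (adapted_le tT); exact: (cv_adapted filtF ipP sepH M0 bS hM).
have hI : adapted P F t (cv (fun _ x => x) psi t).
  by apply: (adapted_le tT); exact: (cv_adapted filtF ipP sepH ler01 id_bounded id_le).
have hl (l : 'I_n.+1) : adapted P F t (cv S phi (unif t n l)).
  apply: (adapted_le tT); apply: (cv_adapted filtF ipP sepH M0 bS hM hphi).
  by have /andP[] := nodT _ (ltnW (ltn_ord l)).
pose RX := RS (W i) (unif t n) n.+1 (cv S psi t).
pose RI := RS (W i) (unif t n) n.+1 (cv (fun _ x => x) psi t).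
pose Rl (l : 'I_n.+1) := RS (W i) (unif t n) n.+1 (cv S phi (unif t n l)).
pose RD := RS (W i) (unif t n) n.+1 (defect n).
have MRX : M2 P mea RX by exact: (RS_M2 filtF ipP sepH (wW i) nn hX).
have MRI : M2 P mea RI by exact: (RS_M2 filtF ipP sepH (wW i) nn hI).
have MRl l : M2 P mea (Rl l) by exact: (RS_M2 filtF ipP sepH (wW i) nn (hl l)).
have MRD : M2 P mea RD by exact: (RS_M2 filtF ipP sepH (wW i) nn (defect_adapted n)).
have MZ (l : 'I_n.+1) : M2 P mea (Z (unif t n l)).
  by case: (hZ _ (nodT _ (ltnW (ltn_ord l)))).
have RDE w : RD w = (RX w - RI w) - \sum_(l < n.+1) weight t n l *: Rl l w.
  rewrite /RD (_ : defect n = (fun s w => (fun s w => cv S psi t s w - cv (fun _ x => x) psi t s w) s w -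
    (fun s w => \sum_(l < n.+1) weight t n l *: cv S phi (unif t n l) s w) s w))//.
  rewrite RS_sub RS_sub; congr (_ - _).
  exact: (RS_lincomb (W i) (unif t n) n.+1 (fun l : 'I_n.+1 => weight t n l) (fun l => cv S phi (unif t n l))).
have MB1 := M2m_B ipP sepH MX MRX; have MB2 := M2m_B ipP sepH MI MRI.
have MB3 l := M2m_B ipP sepH (MRl l) (MZ l).
pose E4 w := \sum_(l < n.+1) weight t n l *: (Rl l w - Z (unif t n l) w).
have ME4 : M2 P mea E4 by apply: (M2m_sum ipP sepH) => l; exact: M2m_Z.
have -> : (fun w => (X w - I w) - \sum_(l < n.+1) weight t n l *: Z (unif t n l) w) =
    (fun w => (((X w - RX w) - (I w - RI w)) + RD w) + E4 w).
  apply/funext => w.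
  have -> : E4 w = \sum_(l < n.+1) weight t n l *: Rl l w - \sum_(l < n.+1) weight t n l *: Z (unif t n l) w.
    by rewrite -sumrB; apply: eq_bigr => l _; rewrite scalerBr.
  by rewrite RDE -insert_three.
have n1 : nrm P (fun w => X w - RX w) <= e / 4.
  by rewrite nrmBC; apply: le_trans (ler_norm _) _.
have n2 : nrm P (fun w => I w - RI w) <= e / 4.
  by rewrite nrmBC; apply: le_trans (ler_norm _) _.
have n4 : nrm P E4 <= e / 4.
  apply: le_trans (nrm_lincomb_le _ MB3 (c := e') _) _; last first.
    apply: le_trans (ler_wpM2r (ltW e'0) (weight_sum n t0)) _.
    exact: he'.
  move=> l; rewrite -ler_sqr ?nnegrE ?nrm_ge0 ?(ltW e'0)//.
  have [MZl lZl] := hZ _ (nodT _ (ltnW (ltn_ord l))).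
  have /andP[_ lT] := nodT _ (ltnW (ltn_ord l)).
  have /andP[_ lt] := nodes_in nn (ltnW (ltn_ord l)).
  have lZl' : stoch_lim P (W i) t (cv S phi (unif t n l)) (Z (unif t n l)).
    by apply: stoch_lim_restrict lZl => // s ts; apply/funext => w; rewrite /cv ltNge (le_trans lt).
  have bl := bounded_le tT (cv_bounded filtF M0 bS hM hphi lT hC C0).
  have heta' : h < eta by lra.
  apply: le_trans (stoch_lim_close filtF ipP sepH (wW i) (hl l) MZl lZl' (modulus_le tT (hm _ lT))
    bl nn mh h0 heta' (ltW e20)) _.
  have := hq2 _ hq2'; rewrite /K /=; lra.
have n3 : nrm P RD <= e / 4.
  rewrite -ler_sqr ?nnegrE ?nrm_ge0 ?(ltW e4)//.
  rewrite (RS_isometry filtF ipP sepH (wW i) nn (defect_adapted n)).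
  (* The first summand is the resolvent error, the second the missing diagonal term of
     [defect_node]. *)
  have bnd (k : 'I_n.+1) : nrm P (defect n (unif t n k)) <= La * e1 + `|weight t n k| * C.
    have kT := nodT _ (ltnW (ltn_ord k)).
    have Mk := regular_mea filtF rphi kT.
    have Md : M2 P mea (defect n (unif t n k)).
      exact: (adapted_mea filtF (defect_adapted n) (nodes_in nn (ltnW (ltn_ord k)))).
    apply: le_trans (nrm_le_shift ipP sepH Md (M2m_Z (weight t n k) Mk)) _.
    rewrite addrC; apply: lerD; last by rewrite nrmZ// ler_wpM2l// hC.
    apply: (nrm_le_fun_ae (g := fun w => La * osc S T h1 (phi (unif t n k) w))).
    - by apply: (M2m_B ipP sepH) => //; exact: M2m_Z.
    - under eq_fun do rewrite exprMn.
      by apply: integZ; exact: (osc_integ T_gt0 M0 bS hM (ltW h10) Mk).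
    - by rewrite mulr_ge0// ltW.
    - under eq_fun do rewrite exprMn.
      rewrite meanZ; last exact: (osc_integ T_gt0 M0 bS hM (ltW h10) Mk).
      by rewrite exprMn ler_wpM2l ?sqr_ge0// ho.
    - apply: filterS (Dpsi kT) => w [Dw Aw].
      apply: le_trans (defect_node Dw Aw) _; rewrite ler_wpM2l//.
      by apply: (osc_mono T_gt0 hM) => //; exact: ltW.
  (* After squaring, one of the two factors |b_k| is bounded by [La] and the other is kept for
     summation. The diagonal terms then contribute at most 2 C^2 La^2 h, which is small with the
     mesh even though the kernel may be unbounded. *)
  apply: (@le_trans _ _ (\sum_(k < n.+1) (h * (2 * La ^+ 2 * e1 ^+ 2) + (2 * C ^+ 2 * La * h) * `|weight t n k|))).
    apply: ler_sum => k _; rewrite unif_step -/h [X in _ <= _ + X]mulrAC.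
    rewrite [X in _ <= _ + X]mulrC -mulrDr ler_wpM2l ?(ltW h0)//.
    have wk := weight_le t0 (ltn_ord k); rewrite -/La in wk.
    have w0 : 0 <= `|weight t n k| by [].
    apply: (@le_trans _ _ ((La * e1 + `|weight t n k| * C) ^+ 2)).
      by rewrite ler_sqr ?nnegrE ?nrm_ge0// addr_ge0// mulr_ge0// ltW.
    have h3 : `|weight t n k| * `|weight t n k| <= La * `|weight t n k| by rewrite ler_wpM2r.
    have h4 : C ^+ 2 * (`|weight t n k| * `|weight t n k|) <= C ^+ 2 * (La * `|weight t n k|).
      by rewrite ler_wpM2l ?sqr_ge0.
    have := sqr_ge0 (La * e1 - `|weight t n k| * C); lra.
  rewrite big_split/= -[X in _ + X]mulr_sumr sumr_const card_ord -[_ *+ n.+1]mulr_natr.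
  have -> : h * (2 * La ^+ 2 * e1 ^+ 2) * n.+1%:R = 2 * La ^+ 2 * t * e1 ^+ 2.
    have n1' : n.+1%:R != 0 :> R by rewrite pnatr_eq0.
    by rewrite /h; move: (n.+1%:R : R) n1' => N n1'; field.
  have h5 : 2 * C ^+ 2 * La * h * \sum_(k < n.+1) `|weight t n k| <= 2 * C ^+ 2 * La * h * La.
    rewrite ler_wpM2l ?weight_sum// mulr_ge0 ?(ltW h0)// mulr_ge0// mulr_ge0 ?sqr_ge0//.
  have := hq1 _ hq1'; rewrite [leLHS](_ : _ = 2 * C ^+ 2 * La * h * La); last by ring.
  lra.
apply: le_trans (nrmD_le ipP sepH _ ME4) _.
  apply: (M2D ipP sepH smea (fun _ => id)) => //; exact: (M2m_B ipP sepH).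
apply: le_trans (lerD (nrmD_le ipP sepH (M2m_B ipP sepH MB1 MB2) MRD) (lexx _)) _.
have := nrmB_le ipP sepH MB1 MB2; lra.
Unshelve. all: by end_near. Qed.

End OneNoise.
End MainLimit.

(** * The discretised Volterra equation for the whole series *)

Section SeriesLimit.
Context {d : measure_display} {Omega : measurableType d} {R : realType}.
Variable P : probability Omega R.
Context {H : completeNormedModType R} (ip : H -> H -> R).
Hypotheses (ipP : inner_product ip) (sepH : separable H).
Local Notation mea := (@measurable d Omega).
Local Notation smea := (@sigma_algebra_measurable d Omega).
Implicit Types (X I : nat -> Omega -> H).

(** The random variable is quantified inside the filter, so that one index serves all times. *)
Lemma tail_small (tl : nat -> R) (e : R) : tl n @[n --> \oo] --> 0 -> 0 < e ->
  \forall n \near \oo, forall (Y : Omega -> H), nrm P Y ^+ 2 <= tl n -> nrm P Y <= e.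
Proof.
move=> t0 e0; have e2 : 0 < e ^+ 2 by rewrite exprn_gt0.
move/cvgr0Pnorm_le/(_ _ e2): t0; apply: filterS => n h Y hY.
rewrite -ler_sqr ?nnegrE ?nrm_ge0 ?(ltW e0)//; apply: le_trans hY _.
by apply: le_trans h; exact: ler_norm.
Qed.

(** The number m of noises is fixed first, from remainders that depend neither on the time nor on
    the grid; then n is taken large for those m noises. *)
Lemma series_limit (T t : R) (a0 : R -> R) (X I : nat -> Omega -> H) Xs Is
    (Z : nat -> R -> Omega -> H) Zs (tx ti tz : nat -> R) :
  0 < t -> t <= T -> (@lebesgue_measure R).-integrable setT (EFin \o a0) ->
  (forall i, M2 P mea (X i)) -> (forall i, M2 P mea (I i)) -> M2 P mea Xs -> M2 P mea Is ->
  (forall i tau, 0 <= tau <= T -> M2 P mea (Z i tau)) ->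
  (forall tau, 0 <= tau <= T -> M2 P mea (Zs tau)) ->
  tx n @[n --> \oo] --> 0 -> ti n @[n --> \oo] --> 0 -> tz n @[n --> \oo] --> 0 ->
  (forall n, nrm P (fun w => \sum_(i < n) X i w - Xs w) ^+ 2 <= tx n) ->
  (forall n, nrm P (fun w => \sum_(i < n) I i w - Is w) ^+ 2 <= ti n) ->
  (forall n tau, 0 <= tau <= T -> nrm P (fun w => \sum_(i < n) Z i tau w - Zs tau w) ^+ 2 <= tz n) ->
  (forall i (e : R), 0 < e -> \forall n \near \oo,
    nrm P (fun w => (X i w - I i w) - \sum_(l < n.+1) weight a0 t n l *: Z i (unif t n l) w) <= e) ->
  forall e : R, 0 < e -> \forall n \near \oo,
    nrm P (fun w => (Xs w - Is w) - \sum_(l < n.+1) weight a0 t n l *: Zs (unif t n l) w) <= e.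
Proof.
move=> t0 tT ia0 MX MI MXs MIs MZ MZs tx0 ti0 tz0 hX hI hZ hone e e0.
have La0 : 0 <= tmass a0 by apply: Rintegral_ge0 => x _; exact: normr_ge0.
have e4 : 0 < e / 4 by rewrite divr_gt0.
have [e' e'0 he'] := small_mul La0 e4.
have [m [mx mi mz]] : exists m, [/\ forall Y : Omega -> H, nrm P Y ^+ 2 <= tx m -> nrm P Y <= e / 4,
    forall Y : Omega -> H, nrm P Y ^+ 2 <= ti m -> nrm P Y <= e / 4 &
    forall Y : Omega -> H, nrm P Y ^+ 2 <= tz m -> nrm P Y <= e'].
  near \oo => m; exists m; split.
  - by near: m; exact: tail_small.
  - by near: m; exact: tail_small.
  - by near: m; exact: tail_small.
have em : 0 < e / 4 / m.+1%:R by rewrite divr_gt0.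
have hall : \forall n \near \oo, forall i, (i < m)%N ->
    nrm P (fun w => (X i w - I i w) - \sum_(l < n.+1) weight a0 t n l *: Z i (unif t n l) w) <= e / 4 / m.+1%:R.
  move: (e / 4 / m.+1%:R) em => r r0; clear mx mi mz.
  elim: m => [|m IH]; first by apply: filterE => n i.
  near=> n; move=> i; rewrite ltnS leq_eqVlt => /orP[/eqP->|im].
    by near: n; exact: hone.
  by move: i im; near: n.
near=> n.
have hn : forall i, (i < m)%N ->
    nrm P (fun w => (X i w - I i w) - \sum_(l < n.+1) weight a0 t n l *: Z i (unif t n l) w) <= e / 4 / m.+1%:R.
  by near: n.
have nT (l : 'I_n.+1) : 0 <= unif t n l <= T.
  have /andP[-> lt] := nodes_in (unif_nodes n (ltW t0)) (ltnW (ltn_ord l)).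
  exact: le_trans lt tT.
pose SX w := \sum_(i < m) X i w; pose SI w := \sum_(i < m) I i w.
pose SZ (l : 'I_n.+1) w := \sum_(i < m) Z i (unif t n l) w.
have MSX : M2 P mea SX by exact: (M2m_sum ipP sepH).
have MSI : M2 P mea SI by exact: (M2m_sum ipP sepH).
have MSZ l : M2 P mea (SZ l) by apply: (M2m_sum ipP sepH) => i; exact: MZ.
have MZl (l : 'I_n.+1) : M2 P mea (Zs (unif t n l)) by exact: MZs.
have MB1 := M2m_B ipP sepH MXs MSX; have MB2 := M2m_B ipP sepH MIs MSI.
have MB3 l := M2m_B ipP sepH (MSZ l) (MZl l).
have M2Z' (k : R) Y : M2 P mea Y -> M2 P mea (fun w => (k *: Y w : H)) by exact: (M2Z ipP sepH smea).
pose E4 w := \sum_(l < n.+1) weight a0 t n l *: (SZ l w - Zs (unif t n l) w).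
have ME4 : M2 P mea E4 by apply: (M2m_sum ipP sepH) => l; exact: M2Z'.
pose E i w := (X i w - I i w) - \sum_(l < n.+1) weight a0 t n l *: Z i (unif t n l) w.
have ME i : M2 P mea (E i).
  apply: (M2m_B ipP sepH); first exact: (M2m_B ipP sepH).
  by apply: (M2m_sum ipP sepH) => l; apply: M2Z'; exact: MZ.
pose E3 w := \sum_(i < m) E i w.
have ME3 : M2 P mea E3 by exact: (M2m_sum ipP sepH).
have E3E w : E3 w = (SX w - SI w) - \sum_(l < n.+1) weight a0 t n l *: SZ l w.
  rewrite /E3 /E sumrB sumrB exchange_big/=; congr (_ - _).
  by apply: eq_bigr => l _; rewrite scaler_sumr.
have -> : (fun w => (Xs w - Is w) - \sum_(l < n.+1) weight a0 t n l *: Zs (unif t n l) w) =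
    (fun w => (((Xs w - SX w) - (Is w - SI w)) + E3 w) + E4 w).
  apply/funext => w.
  have -> : E4 w = \sum_(l < n.+1) weight a0 t n l *: SZ l w - \sum_(l < n.+1) weight a0 t n l *: Zs (unif t n l) w.
    by rewrite -sumrB; apply: eq_bigr => l _; rewrite scalerBr.
  by rewrite E3E -insert_three.
have n1 : nrm P (fun w => Xs w - SX w) <= e / 4 by rewrite nrmBC; exact: mx (hX m).
have n2 : nrm P (fun w => Is w - SI w) <= e / 4 by rewrite nrmBC; exact: mi (hI m).
have n3 : nrm P E3 <= e / 4.
  apply: le_trans (nrm_sum_le ipP sepH _ _) _ => //.
  apply: (@le_trans _ _ (\sum_(i < m) e / 4 / m.+1%:R)).
    by apply: ler_sum => i _; exact: hn.
  rewrite sumr_const card_ord -[_ *+ m]mulr_natr mulrAC ler_pdivrMr// ler_pM2l// ler_nat//.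
have n4 : nrm P E4 <= e / 4.
  apply: le_trans (nrm_lincomb_le ipP sepH _ MB3 (c := e') _) _.
    by move=> l; apply: mz; exact: hZ.
  apply: le_trans (ler_wpM2r (ltW e'0) (weight_sum ia0 n t0)) _; exact: he'.
apply: le_trans (nrmD_le ipP sepH _ ME4) _.
  apply: (M2D ipP sepH smea (fun _ => id)) => //; exact: (M2m_B ipP sepH).
apply: le_trans (lerD (nrmD_le ipP sepH (M2m_B ipP sepH MB1 MB2) ME3) (lexx _)) _.
have := nrmB_le ipP sepH MB1 MB2; lra.
Unshelve. all: by end_near. Qed.

End SeriesLimit.

(** * From grid sums to the Bochner integral of the kernel against Z *)

Section BochnerAssembly.
Context {d : measure_display} {Omega : measurableType d} {R : realType}.
Variable P : probability Omega R.
Context {H : completeNormedModType R} (ip : H -> H -> R).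
Hypotheses (ipP : inner_product ip) (sepH : separable H).
Local Notation mea := (@measurable d Omega).
Local Notation smea := (@sigma_algebra_measurable d Omega).
Local Notation mu := (@lebesgue_measure R).

Let GM : (mea : set (set Omega)) `<=` mea. Proof. by []. Qed.

Lemma L2_of X Y : M2 P mea (Y : Omega -> H) -> {ae P, forall w, X w = Y w} -> L2 P mea X.
Proof. by move=> hY h; apply/(L2P P X smea GM); exists Y. Qed.

(** At t = 0 the domain is a single point, of measure 0, and the empty sum serves as approximation
    at every tolerance. *)
Lemma bochner_null (f : R -> Omega -> H) v : (forall tau, 0 <= tau <= 0 -> L2 P mea (f tau)) ->
  {ae P, forall w, v w = 0} -> bochner_L2 P `[0, 0] f v.
Proof.
move=> hf v0; split.
- by move=> tau; rewrite /= in_itv/=; exact: hf.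
- exact: (L2_of (M2_cst P ipP sepH smea 0) v0).
- move=> e e0; exists 0%N, (fun=> set0), (fun=> fun=> 0) => /=.
  rewrite set_itv1; split.
  + by case.
  + exact: measurable_fun_set1.
  + by rewrite integral_set1 lte_fin.
  + rewrite (@L2norm_ae _ _ _ P _ _ (fun=> 0)).
      by rewrite (L2norm_nrm (M2_cst P ipP sepH smea 0)) nrm0 lte_fin.
    by apply: filterS v0 => w vw; rewrite big_ord0 subr0.
Qed.

Variables (T : R) (T_gt0 : 0 < T) (Z : R -> Omega -> H).
Hypotheses (MZ : forall tau, 0 <= tau <= T -> M2 P mea (Z tau))
  (cZ : forall e : R, 0 < e -> exists2 eta : R, 0 < eta & forall tau tau',
        0 <= tau <= T -> 0 <= tau' <= T -> `|tau - tau'| <= eta ->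
        nrm P (fun w => Z tau w - Z tau' w) <= e).

Lemma cont_bounded : exists2 C : R, 0 <= C & bounded P T Z C.
Proof.
have [eta eta0 h] := cZ ltr01.
apply: (modulus_bounded ipP sepH T_gt0 (p := [::]) MZ eta0) => x y xT yT xy _.
by apply: h => //; exact: ltW.
Qed.

(* Multiplication by alpha t is a strongly continuous family of operators on R, so
   the uniform bounds for such families apply. *)
Lemma cont_unif (alpha : R -> R) : continuous alpha -> exists2 C : R, 0 <= C &
  (forall s, 0 <= s <= T -> `|alpha s| <= C) /\
  forall e : R, 0 < e -> exists2 eta : R, 0 < eta & forall x y, 0 <= x <= T -> 0 <= y <= T ->
    `|x - y| <= eta -> `|alpha x - alpha y| <= e.
Proof.
move=> ca; pose Sa (t : R) (x : R^o) : R^o := alpha t * x.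
have cSa : forall x, {within `[0, +oo[, continuous (fun t : R => Sa t x)}.
  by move=> x; apply: continuous_subspaceT => t; exact: (cvgM (ca t) (cvg_cst x)).
have bSa t : 0 <= t -> bounded_operator (Sa t).
  move=> _; split => [k x y|]; first by rewrite /Sa mulrDr /GRing.scale/=; ring.
  by exists `|alpha t| => x; rewrite normrM.
have [C C0 hC] := @op_bounded R R^o Sa T bSa cSa.
exists C => //; split=> [s sT|e e0].
  by have := hC s 1 sT; rewrite /Sa mulr1 normr1 mulr1.
have [n _ /(_ n (leqnn n)) hn] := @op_unif_continuous R R^o Sa T cSa 1 e e0.
exists n.+1%:R^-1 => [|x y xT yT xy]; first by rewrite invr_gt0.
by have := hn x y xT yT xy; rewrite /Sa !mulr1.
Qed.

Lemma dot_Z_measurable (t : R) Y : t <= T -> M2 P mea Y ->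
  measurable_fun (`[0, t]%classic : set (measurableTypeR R)) (fun tau => dot P ip (Z tau) Y).
Proof.
move=> tT MY; apply: (pw_measurable (p := [::])) => e e0.
have N1 : 0 < nrm P Y + 1 by rewrite ltr_wpDl// nrm_ge0.
have [eta eta0 h] := cZ (divr_gt0 e0 N1); exists eta => // x y /andP[x0 xt] /andP[y0 yt] xy _.
have xT : 0 <= x <= T by rewrite x0 (le_trans xt).
have yT : 0 <= y <= T by rewrite y0 (le_trans yt).
have {}h := h x y xT yT (ltW xy).
rewrite -(dotBl ipP sepH); [|exact: MZ|exact: MZ|exact: MY].
apply: le_trans (dot_le ipP sepH (M2m_B ipP sepH (MZ xT) (MZ yT)) MY) _.
apply: (@le_trans _ _ (e / (nrm P Y + 1) * (nrm P Y + 1))); last by rewrite divfK// gt_eqF.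
by rewrite ler_pM ?nrm_ge0// lerDl.
Qed.

Lemma nrm_Z_measurable (t : R) : t <= T ->
  measurable_fun (`[0, t]%classic : set (measurableTypeR R)) (fun tau => nrm P (Z tau) ^+ 2).
Proof.
move=> tT; apply: (pw_measurable (p := [::])) => e e0.
have [C C0 hC] := cont_bounded.
have [q q0 hq] := small_mul (mulr_ge0 (ler0n _ 2) C0) e0.
have [eta eta0 h] := cZ q0; exists eta => // x y /andP[x0 xt] /andP[y0 yt] xy _.
have xT : 0 <= x <= T by rewrite x0 (le_trans xt).
have yT : 0 <= y <= T by rewrite y0 (le_trans yt).
have {}h := h x y xT yT (ltW xy).
have h1 := nrm_le_shift ipP sepH (MZ xT) (MZ yT); have h2 := nrm_le_shift ipP sepH (MZ yT) (MZ xT).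
rewrite nrmBC in h2.
have hxC : 0 <= nrm P (Z x) <= C by rewrite nrm_ge0 hC.
have hyC : 0 <= nrm P (Z y) <= C by rewrite nrm_ge0 hC.
have k1 := sqr_diff_le hxC hyC (le_trans h1 (lerD (lexx _) h)) (ltW q0).
have k2 := sqr_diff_le hyC hxC (le_trans h2 (lerD (lexx _) h)) (ltW q0).
have := hq q (lexx _); rewrite ler_norml => h3; apply/andP; split; lra.
Qed.

(** Measurability of the error is part of the notion of Bochner integral. The squared norm is
    expanded into scalar products, each of them a measurable function of tau multiplied by scalar
    coefficients. *)
Lemma err_measurable (t : R) (beta : R -> R) n (E : 'I_n -> set R) (x : 'I_n -> Omega -> H) :
  t <= T -> measurable_fun (`[0, t]%classic : set (measurableTypeR R)) beta ->
  (forall l, measurable (E l)) -> (forall l, M2 P mea (x l)) ->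
  measurable_fun (`[0, t]%classic : set (measurableTypeR R))
    (fun tau => nrm P (fun w => beta tau *: Z tau w - \sum_(l < n) (\1_(E l) tau : R) *: x l w)).
Proof.
move=> tT mb mE Mx.
pose J : set (measurableTypeR R) := `[0, t]%classic.
pose g tau := (beta tau * beta tau * nrm P (Z tau) ^+ 2 -
  2 * (beta tau * \sum_(l < n) (\1_(E l) tau : R) * dot P ip (Z tau) (x l))) +
  \sum_(l < n) \sum_(m < n) (\1_(E l) tau : R) * ((\1_(E m) tau : R) * dot P ip (x l) (x m)).
have mg : measurable_fun J g.
  have mI l : measurable_fun J (\1_(E l) : R -> R) by apply: measurable_indic; exact: mE.
  apply: measurable_funD; first apply: measurable_funB.
  - by apply: measurable_funM; [exact: measurable_funM|exact: nrm_Z_measurable].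
  - apply: measurable_funM => //; apply: measurable_funM => //.
    apply: measurable_sum => l; apply: measurable_funM => //; exact: dot_Z_measurable.
  - by apply: measurable_sum => l; apply: measurable_sum => m; do ?apply: measurable_funM.
have Zm (k : R) Y : M2 P mea Y -> M2 P mea (fun w => (k *: Y w : H)) by exact: (M2Z ipP sepH smea).
apply: (@eq_measurable_fun _ _ _ _ _ (fun tau => Num.sqrt (g tau))); last first.
  apply: (@measurableT_comp _ _ _ _ _ _ (Num.sqrt : R -> R)) => //.
  by apply: continuous_measurable_fun; exact: sqrt_continuous.
move=> tau; rewrite inE /J /= in_itv/= => /andP[t0 tt].
have tauT : 0 <= tau <= T by rewrite t0 (le_trans tt).
have MZt := MZ tauT.
set N := nrm P _; have N0 : 0 <= N by exact: nrm_ge0.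
suff -> : g tau = N ^+ 2 by rewrite sqrtr_sqr ger0_norm.
have Ms : M2 P mea (fun w => \sum_(l < n) (\1_(E l) tau : R) *: x l w).
  by apply: (M2m_sum ipP sepH) => l; exact: Zm.
rewrite /N (nrm_subsq ipP sepH (Zm _ _ MZt) Ms) /g; congr (_ - _ + _).
- by rewrite nrmZ// exprMn real_normK ?num_real// expr2.
- rewrite (dotZl ipP sepH)//; congr (_ * (_ * _)).
  rewrite (dot_sumr ipP sepH)//; last by move=> l; exact: Zm.
  by apply: eq_bigr => l _; rewrite [RHS](dotC P ipP) (dotZl ipP sepH)// (dotC P ipP).
- rewrite -(dotxx P ipP) (dot_suml ipP sepH)//; last by move=> l; exact: Zm.
  apply: eq_bigr => l _; rewrite (dot_sumr ipP sepH)//; [|by move=> m; exact: Zm|exact: Zm].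
  apply: eq_bigr => m _; rewrite (dotZl ipP sepH)//; last exact: Zm.
  congr (_ * _); rewrite [RHS](dotC P ipP) (dotZl ipP sepH)// (dotC P ipP)//.
Qed.

(** The kernel has no pointwise regularity, so the approximating functions are built from a
    continuous alpha close to it in L1: they equal alpha(t_l) Z(t_l) on the l-th cell. Their
    integrals carry the coefficients h alpha(t_l) in place of b_l, and the total discrepancy of the
    coefficients is again controlled by the L1 distance. *)
Lemma bochner_assembly (a0 : R -> R) (t : R) (f : R -> Omega -> H) v :
  mu.-integrable setT (EFin \o a0) -> 0 < t -> t <= T -> M2 P mea v ->
  (forall tau, 0 <= tau <= t -> {ae P, forall w, f tau w = a0 (t - tau) *: Z tau w}) ->
  (forall e : R, 0 < e -> \forall n \near \oo,
    nrm P (fun w => v w - \sum_(l < n.+1) weight a0 t n l *: Z (unif t n l) w) <= e) ->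
  bochner_L2 P `[0, t] f v.
Proof.
move=> ia0 t0 tT Mv hf hv; have t0' := ltW t0.
have [C C0 hC] := cont_bounded.
pose beta tau := a0 (t - tau).
pose J : set (measurableTypeR R) := `[0, t]%classic.
pose J' : set (measurableTypeR R) := `[0, t[%classic.
have mJ : measurable J by exact: measurable_itv.
have mJ' : measurable J' by exact: measurable_itv.
have J'J : J' `<=` J by move=> x; rewrite /J /J' /= !in_itv/= => /andP[-> /ltW].
have fJ : (mu J < +oo)%E by rewrite lebesgue_measure_itv/= lte_fin t0 -EFinB ltry.
have JT tau : J tau -> 0 <= tau <= T.
  by rewrite /J /= in_itv/= => /andP[-> tt]; exact: le_trans tT.
have jT : mu.-integrable setT (EFin \o beta) by exact: reflect_integrable.
have jJ : mu.-integrable J (EFin \o beta) by apply: integrableS jT.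
have Zm (k : R) Y : M2 P mea Y -> M2 P mea (fun w => (k *: Y w : H)) by exact: (M2Z ipP sepH smea).
split; first by move=> tau Jt; apply: (L2_of (Zm (beta tau) _ (MZ (JT _ Jt)))); apply: hf;
  move: Jt; rewrite /J /= in_itv/=.
  by apply: (L2_of Mv); exact: nearW.
move=> e e0; have e4 : 0 < e / 4 by rewrite divr_gt0.
have [d1 d10 hd1] := small_mul C0 e4.
have [g_ [cg ig cvg_g]] := approximation_continuous_integrable mJ fJ jJ.
have [alpha [ca ja intd]] : exists alpha : R -> R, [/\ continuous alpha,
    mu.-integrable J (EFin \o alpha) & \int[mu]_(x in J) `|beta x - alpha x| <= d1].
  move/fine_cvgP: cvg_g => [[m _ hfin] /cvgrPdist_le/(_ _ d10)[q _ hq]].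
  exists (g_ q); split => //; have := hq q (leqnn q); rewrite /= sub0r normrN.
  by apply: le_trans; exact: ler_norm.
have [Ca Ca0 [hCa ha]] := cont_unif ca.
have [e2 e20 he2] := small_mul t0' e4.
have e22 : 0 < e2 / 2 by rewrite divr_gt0.
have [q1 q10 hq1] := small_mul C0 e22.
have [q2 q20 hq2] := small_mul Ca0 e22.
have [q3 q30 hq3] := small_mul (mulr_ge0 C0 t0') e4.
have q13 : 0 < Num.min q1 q3 by rewrite lt_min q10.
have [eta1 eta10 h1] := ha _ q13.
have [eta2 eta20 h2] := cZ q20.
have hh0 : 0 < Num.min eta1 eta2 by rewrite lt_min eta10.
near \oo => n.
have hvn : nrm P (fun w => v w - \sum_(l < n.+1) weight a0 t n l *: Z (unif t n l) w) <= e / 4.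
  by near: n; exact: hv.
have mm : mesh_le (unif t n) n.+1 (Num.min eta1 eta2) by near: n; exact: unif_mesh.
set h := t / n.+1%:R.
have h0 : 0 < h by rewrite divr_gt0.
have : h <= Num.min eta1 eta2 by have := mm 0%N isT; rewrite unif_step.
rewrite le_min => /andP[heta1 heta2].
have nJ (l : 'I_n.+1) : J (unif t n l).
  by rewrite /J /= in_itv/=; exact: nodes_in (unif_nodes n t0') (ltnW (ltn_ord l)).
have cJ' (l : nat) : (l < n.+1)%N -> cell h l `<=` J'.
  move=> ln x /andP[x1 x2]; rewrite /J' /= in_itv/=; apply/andP; split.
    by apply: le_trans x1; rewrite mulr_ge0// ltW.
  apply: lt_le_trans x2 _; rewrite (_ : t = n.+1%:R * h) ?ler_pM2r ?ler_nat//.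
  by rewrite /h mulrCA divff ?mulr1// pnatr_eq0.
have cJ (l : nat) : (l < n.+1)%N -> cell h l `<=` J by move=> ln x cx; exact: J'J (cJ' l ln x cx).
have near_node (l : 'I_n.+1) x : cell h l x ->
    `|alpha x - alpha (unif t n l)| <= Num.min q1 q3 /\ nrm P (fun w => Z x w - Z (unif t n l) w) <= q2.
  move=> cx; have xJ := cJ l (ltn_ord l) x cx.
  have dx : `|x - unif t n l| <= h.
    move: cx; rewrite /cell /= /unif -/h -natr1 mulrDl mul1r => /andP[x1 x2].
    by rewrite ger0_norm ?subr_ge0//; lra.
  split; first by apply: h1; [exact: JT|exact: JT|exact: le_trans heta1].
  by apply: h2; [exact: JT|exact: JT|exact: le_trans heta2].
pose xl (l : 'I_n.+1) (w : Omega) := alpha (unif t n l) *: Z (unif t n l) w.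
have Mxl l : M2 P mea (xl l) by apply: Zm; apply: MZ; exact: JT.
pose er tau := nrm P (fun w => beta tau *: Z tau w - \sum_(l < n.+1) (\1_(cell h l) tau : R) *: xl l w).
have Msum tau : M2 P mea (fun w => \sum_(l < n.+1) (\1_(cell h l) tau : R) *: xl l w).
  by apply: (M2m_sum ipP sepH) => l; exact: Zm.
have mb : measurable_fun J beta by have /integrableP[/measurable_EFinP] := jJ.
have mer : measurable_fun J er.
  by apply: err_measurable => // l; exact: measurable_cell.
have errE tau : J tau ->
    L2norm P (f tau - \sum_(l < n.+1) (\1_(cell h l) tau : R) *: xl l) = (er tau)%:E.
  move=> Jt; rewrite -(L2norm_nrm (M2m_B ipP sepH (Zm (beta tau) _ (MZ (JT _ Jt))) (Msum tau))).
  apply: L2norm_ae; have : 0 <= tau <= t by move: Jt; rewrite /J /= in_itv/=.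
  move/hf; apply: filterS => w fw.
  by rewrite -fw; congr (_ - _); rewrite fct_sumE.
(* The first term pays for replacing the kernel by alpha; [e2] pays for freezing alpha and Z at the
   node, half for each. *)
pose G tau := `|beta tau - alpha tau| * C + e2.
have jd : mu.-integrable J (EFin \o (fun x => `|beta x - alpha x|)).
  exact: (integrable_norm (integrableB mJ jJ ja)).
have jG : mu.-integrable J (EFin \o G).
  exact: (integrableD mJ (integrableZr mJ C jd) (integrable_cst e2 mJ fJ)).
have mtJ : fine (mu J) = t by rewrite lebesgue_measure_itv/= lte_fin t0 -EFinB/= subr0.
have erG tau : J' tau -> er tau <= G tau.
  move=> J't; have tauT := JT _ (J'J _ J't); move: (J't); rewrite /J' /= in_itv/= => /andP[tau0 taut].
  have [|j cx _] := @step_index R h tau n.+1 h0 tau0.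
    by rewrite /h mulrCA divff ?mulr1// pnatr_eq0.
  have [n1 n2] := near_node j tau cx.
  rewrite /er.
  have -> : (fun w => beta tau *: Z tau w - \sum_(l < n.+1) (\1_(cell h l) tau : R) *: xl l w) =
    (fun w => ((beta tau - alpha tau) *: Z tau w + (alpha tau - alpha (unif t n j)) *: Z tau w) +
       alpha (unif t n j) *: (Z tau w - Z (unif t n j) w)).
    apply/funext => w; rewrite (bigD1 j)//= big1 ?addr0 => [|i ij]; last first.
      rewrite indicE memNset ?scale0r// => ci; case/eqP: ij; apply/val_inj.
      exact: (cell_inj h0 ci cx).
    rewrite indicE mem_set// scale1r -scalerDl scalerBr addrA -scalerDl; congr (_ *: _ - _).
    by rewrite addrA !subrK.
  have MZt := MZ tauT; have MZj := MZ (JT _ (nJ j)).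
  have MBj := M2m_B ipP sepH MZt MZj.
  have MD : M2 P mea (fun w => (beta tau - alpha tau) *: Z tau w + (alpha tau - alpha (unif t n j)) *: Z tau w).
    by apply: (M2D ipP sepH smea (fun _ => id)); exact: Zm.
  apply: le_trans (nrmD_le ipP sepH MD (Zm _ _ MBj)) _.
  apply: le_trans (lerD (nrmD_le ipP sepH (Zm _ _ MZt) (Zm _ _ MZt)) (lexx _)) _.
  rewrite !nrmZ// /G -addrA lerD//; first by rewrite ler_wpM2l// hC.
  rewrite (splitr e2) lerD//.
    apply: le_trans (hq1 q1 (lexx _)); rewrite mulrC ler_pM ?nrm_ge0 ?hC//.
    by apply: le_trans n1 _; rewrite ge_min lexx.
  apply: le_trans (hq2 q2 (lexx _)); rewrite ler_pM ?nrm_ge0//.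
  by apply: hCa; exact: JT.
have intG : \int[mu]_(x in J) G x <= e / 4 + e / 4.
  rewrite RintegralD//; [|exact: (integrableZr mJ C jd)|exact: integrable_cst].
  rewrite RintegralZr//; apply: lerD; first by rewrite mulrC; exact: hd1.
  by rewrite Rintegral_cst// [X in _ * X <= _]mtJ mulrC; exact: he2.
exists n.+1, (fun l => cell h l), xl; split.
- move=> l; split; [exact: measurable_cell|exact: cJ|].
  by apply: (L2_of (Mxl l)); exact: nearW.
- apply: (@eq_measurable_fun _ _ _ _ _ (EFin \o er)); last exact/measurable_EFinP.
  by move=> tau; rewrite inE => Jt; rewrite errE.
- have mJ'e (g : R -> R) : measurable_fun J g -> measurable_fun J' (EFin \o g).
    by move=> mg; apply/measurable_EFinP; exact: measurable_funS mg.
  (* The bound of [er] by [G] is known only on [0, t[, because t lies in no cell of the grid;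
     removing one point leaves the integrals unchanged. *)
  have JJ' (g : R -> R) : measurable_fun J g -> (\int[mu]_(x in J) (g x)%:E = \int[mu]_(x in J') (g x)%:E)%E.
    by move=> mg; apply/esym/(@integral_itv_bndo_bndc _ (BLeft 0) t (EFin \o g)); exact: mJ'e.
  have mG : measurable_fun J G by have /integrableP[/measurable_EFinP] := jG.
  apply: (@le_lt_trans _ _ (\int[mu]_(x in J) (er x)%:E)%E).
    rewrite le_eqVlt; apply/orP; left; apply/eqP; apply: eq_integral => tau.
    by rewrite inE => Jt; exact: errE.
  rewrite JJ'//; apply: (@le_lt_trans _ _ (\int[mu]_(x in J') (G x)%:E)%E).
    apply: ge0_le_integral => //.
    + by move=> x _; rewrite lee_fin nrm_ge0.
    + exact: mJ'e.
    + exact: mJ'e.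
  rewrite -JJ'// -(fineK (integrable_fin_num mJ jG)) lte_fin.
  by apply: le_lt_trans intG _; lra.
- pose vs w := v w - \sum_(l < n.+1) h *: xl l w.
  have Mvs : M2 P mea vs.
    by apply: (M2m_B ipP sepH) => //; apply: (M2m_sum ipP sepH) => l; exact: Zm.
  have -> : (v - \sum_(j < n.+1) fine (mu (cell h j)) *: xl j)%R = vs.
    apply/funext => w; rewrite /vs; congr (_ - _); rewrite fct_sumE; apply: eq_bigr => l _.
    by rewrite cell_measure.
  rewrite (L2norm_nrm Mvs) lte_fin.
  have -> : vs = (fun w => (v w - \sum_(l < n.+1) weight a0 t n l *: Z (unif t n l) w) +
      \sum_(l < n.+1) (weight a0 t n l - h * alpha (unif t n l)) *: Z (unif t n l) w).
    apply/funext => w.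
    have -> : \sum_(l < n.+1) (weight a0 t n l - h * alpha (unif t n l)) *: Z (unif t n l) w =
        \sum_(l < n.+1) weight a0 t n l *: Z (unif t n l) w - \sum_(l < n.+1) h *: xl l w.
      by rewrite -sumrB; apply: eq_bigr => l _; rewrite scalerBl /xl scalerA.
    by rewrite addrA subrK.
  have MZl (l : 'I_n.+1) : M2 P mea (Z (unif t n l)) by apply: MZ; exact: JT.
  apply: le_lt_trans (nrmD_le ipP sepH _ _) _.
  + apply: (M2m_B ipP sepH) => //; apply: (M2m_sum ipP sepH) => l; exact: Zm.
  + apply: (M2m_sum ipP sepH) => l; exact: Zm.
  (* The weight b_l is the integral of [beta] over the l-th cell, so its distance to h alpha(t_l) is
     at most the integral of |beta - alpha| there plus h q3, where q3 bounds the variation of alpha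
     on a cell. *)
  have wb : \sum_(l < n.+1) `|weight a0 t n l - h * alpha (unif t n l)| <= d1 + t * q3.
    have jq : mu.-integrable J (EFin \o (fun x => `|beta x - alpha x| + q3)).
      exact: (integrableD mJ jd (integrable_cst q3 mJ fJ)).
    apply: (@le_trans _ _ (\int[mu]_(x in J) (`|beta x - alpha x| + q3))); last first.
      rewrite RintegralD//; last exact: integrable_cst.
      by apply: lerD => //; rewrite Rintegral_cst// [X in _ * X <= _]mtJ mulrC.
    apply: le_trans (sum_cells h0 mJ cJ jq _); last by move=> x _; rewrite addr_ge0// ltW.
    apply: ler_sum => l _.
    have mc : measurable (cell h l : set (measurableTypeR R)) by exact: measurable_cell.
    have fc : (mu (cell h l) < +oo)%E by rewrite cell_measure// ltry.
    have jb : mu.-integrable (cell h l) (EFin \o beta) by apply: integrableS jT.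
    have -> : weight a0 t n l - h * alpha (unif t n l) =
        \int[mu]_(x in cell h l) (beta x - alpha (unif t n l)).
      rewrite RintegralB//; last exact: integrable_cst.
      rewrite Rintegral_cst//.
      have muh : fine (mu (cell h l)) = h by rewrite cell_measure.
      rewrite [X in _ = _ - _ * X]muh.
      by rewrite (cell_mass ia0 t l h0) mulrC.
    apply: Rintegral_norm_le => //.
    - exact: (integrableB mc jb (integrable_cst _ mc fc)).
    - by apply: integrableS jq => //; exact: cJ.
    - move=> x cx; apply: le_trans (ler_distD (alpha x) _ _) _; rewrite lerD2l.
      by have [n1 _] := near_node l x cx; apply: le_trans n1 _; rewrite ge_min lexx orbT.
  have hl : nrm P (fun w => \sum_(l < n.+1) (weight a0 t n l - h * alpha (unif t n l)) *: Z (unif t n l) w) <=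
      e / 4 + e / 4.
    apply: le_trans (nrm_lincomb_le ipP sepH _ MZl (c := C) _) _.
      by move=> l; apply: hC; exact: JT.
    apply: le_trans (ler_wpM2r C0 wb) _; rewrite mulrC mulrDr.
    apply: lerD; first exact: hd1.
    by rewrite mulrA; exact: hq3.
  by apply: le_lt_trans (lerD hvn hl) _; lra.
Unshelve. all: by end_near. Qed.

End BochnerAssembly.

(** * Passage between almost sure classes and measurable versions *)

Section Bridge.
Context {d : measure_display} {Omega : measurableType d} {R : realType}.
Variable P : probability Omega R.
Variables (F : R -> set (set Omega)) (filtF : filtration F).
Context {H : completeNormedModType R} (ip : H -> H -> R).
Hypotheses (ipP : inner_product ip) (sepH : separable H).
Local Notation mea := (@measurable d Omega).
Local Notation smea := (@sigma_algebra_measurable d Omega).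
Implicit Types (f g : R -> Omega -> H) (B : R -> Omega -> R).

Let GM : (mea : set (set Omega)) `<=` mea. Proof. by []. Qed.

Lemma partition_nodes (t : R) s : itv_partition 0 t s -> nodes (fun k => (0 :: s)`_k) (size s) t.
Proof.
move=> [ps /eqP ls]; split => //; first by rewrite -ls (last_nth 0).
by move=> k ks; apply: ltW; move/(pathP 0) : ps; exact.
Qed.

Lemma partition_locate (u T x : R) s : path <%R u s -> last u s = T -> u < x < T -> x \notin s ->
  exists2 k, (k < size s)%N & (u :: s)`_k < x < s`_k.
Proof.
elim: s u => [|c s IH] u /=.
  by move=> _ -> /andP[h1 h2]; have := lt_trans h1 h2; rewrite ltxx.
move=> /andP[uc ps] ls /andP[ux xT]; rewrite in_cons negb_or => /andP[xc xs].
have [lxc|cx] := ltP x c; first by exists 0%N => //=; rewrite ux.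
have [|k ks hk] := IH c ps ls _ xs; first by rewrite xT andbT lt_neqAle eq_sym xc.
by exists k.+1.
Qed.

Lemma fine_partition (t dl : R) : 0 <= t -> 0 < dl -> exists2 s, itv_partition 0 t s &
  forall k, (k < size s)%N -> s`_k - (0 :: s)`_k < dl.
Proof.
move=> t0 dl0; have [<-|tn] := eqVneq 0 t; first by exists [::] => //; split.
have tp : 0 < t by rewrite lt_neqAle tn.
near \oo => n.
have mm : mesh_le (unif t n) n.+1 (dl / 2) by near: n; apply: unif_mesh => //; rewrite divr_gt0.
have [u0 un _] := unif_nodes n t0.
have nthE k : (k <= n.+1)%N -> (0 :: mkseq (fun k => unif t n k.+1) n.+1)`_k = unif t n k.
  by case: k => [|k] kn; [rewrite u0|rewrite /= nth_mkseq].
exists (mkseq (fun k => unif t n k.+1) n.+1).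
  split; last by rewrite (last_nth 0) size_mkseq nthE// un.
  apply/(pathP (0 : R)) => k; rewrite size_mkseq => kn; rewrite (nthE k (ltnW kn)) (nth_mkseq 0 _ kn).
  by rewrite -subr_gt0 unif_step divr_gt0.
move=> k; rewrite size_mkseq => kn; rewrite (nthE k (ltnW kn)) (nth_mkseq 0 _ kn).
by apply: le_lt_trans (mm k kn) _; rewrite ltr_pdivrMr// ltr_pMr// ltr1n.
Unshelve. all: by end_near. Qed.

(** A version is chosen at each time, and the division points, including 0 and T, become the
    exceptional times: two times not separated by a division point lie in the same open interval of
    the partition. *)
Lemma puc_version T f : adapted_PUC P F T f -> exists f' p, regular P F T p f' /\
  forall tau, 0 <= tau <= T -> {ae P, forall w, f tau w = f' tau w}.
Proof.
move=> [hL2 [s [hs hu]]].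
have /choice[f' hf'] : forall tau, exists Y, 0 <= tau <= T ->
    M2 P (F tau) Y /\ {ae P, forall w, f tau w = Y w}.
  move=> tau; have [tT|nt] := boolP (0 <= tau <= T); last by exists (fun=> 0).
  have /andP[t0 _] := tT.
  by have /(L2P P (f tau) (filt_sigma filtF t0) (filt_sub filtF t0))[Y hY] := hL2 tau tT; exists Y.
have had : adapted P F T f' by move=> tau /hf'[].
exists f', (0 :: s); split; last by move=> tau /hf'[].
split=> // e e0.
have [eta eta0 heta] : exists2 eta : R, 0 < eta & forall k, (k < size s)%N ->
    forall x y, (0 :: s)`_k < x < s`_k -> (0 :: s)`_k < y < s`_k ->
      `|x - y| < eta -> (L2norm P (f x \- f y)%R < e%:E)%E.
  suff : forall m, (m <= size s)%N -> exists2 eta : R, 0 < eta & forall k, (k < m)%N ->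
    forall x y, (0 :: s)`_k < x < s`_k -> (0 :: s)`_k < y < s`_k ->
      `|x - y| < eta -> (L2norm P (f x \- f y)%R < e%:E)%E by move=> /(_ _ (leqnn _)).
  elim=> [_|m IH ms]; first by exists 1.
  have [e1 e10 h1] := IH (ltnW ms); have [e2 e20 h2] := hu m ms e e0.
  exists (Num.min e1 e2) => [|k]; first by rewrite lt_min e10.
  rewrite ltnS leq_eqVlt => /orP[/eqP->|km] x y hx hy; rewrite lt_min => /andP[xy1 xy2].
    exact: h2.
  exact: h1 hx hy xy1.
exists eta => // x y xT yT xy nc.
have [ps /eqP ls] := hs.
have nx : x \notin 0 :: s.
  by apply/negP => /nc/negP; apply; rewrite ge_min le_max lexx.
have nT : T \in 0 :: s by rewrite -ls mem_last.
have /andP[x0 xT'] := xT.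
have hx0 : 0 < x < T.
  rewrite !lt_neqAle x0 xT' !andbT; apply/andP; split.
    by apply: contraNneq nx => <-; rewrite mem_head.
  by apply: contraNneq nx => ->.
have xs : x \notin s by move: nx; rewrite in_cons negb_or => /andP[].
have [k ks /andP[kx xk]] := partition_locate ps ls hx0 xs.
have in1 : (0 :: s)`_k \in 0 :: s by rewrite mem_nth//= ltnS ltnW.
have in2 : s`_k \in 0 :: s by rewrite in_cons mem_nth// orbT.
have ky : (0 :: s)`_k < y < s`_k.
  apply/andP; split; rewrite ltNge; apply/negP => h.
    by have /negP := nc _ in1; apply; rewrite ge_min le_max h (ltW kx) orbT.
  by have /negP := nc _ in2; apply; rewrite ge_min le_max h (ltW xk) orbT.
have kx' : (0 :: s)`_k < x < s`_k by rewrite kx.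
have := heta k ks x y kx' ky xy.
have Mx := adapted_mea filtF had xT; have My := adapted_mea filtF had yT.
rewrite (@L2norm_ae _ _ _ P _ _ (fun w => f' x w - f' y w)); last first.
  have [_ ax] := hf' x xT; have [_ ay] := hf' y yT.
  by apply: filterS2 ax ay => w /= -> ->.
by rewrite (L2norm_nrm (M2m_B ipP sepH Mx My)) lte_fin => /ltW.
Qed.

Lemma regular_sub T (p q : seq R) f : {subset p <= q} -> regular P F T p f -> regular P F T q f.
Proof.
move=> pq [hf hp]; split => // e e0; have [eta eta0 h] := hp e e0; exists eta => // x y xT yT xy nc.
by apply: h => // c /pq/nc.
Qed.

Section Integral.
Variables (B : R -> Omega -> R) (wB : wiener_process P F B) (t : R) (t0 : 0 <= t).
Variables (f f' : R -> Omega -> H) (hf' : adapted P F t f')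
  (ff' : forall tau, 0 <= tau <= t -> {ae P, forall w, f tau w = f' tau w}).

(** For a fixed partition only finitely many times occur, so the exceptional null sets can be united
    although the versions were chosen for uncountably many times. *)
Lemma riemann_sum_ae s : itv_partition 0 t s ->
  {ae P, forall w, riemann_sum B f s w = RS B (fun k => (0 :: s)`_k) (size s) f' w}.
Proof.
move=> hs; have hx := partition_nodes hs.
have : {ae P, forall w, forall k : nat, (k < size s)%N -> f (0 :: s)`_k w = f' (0 :: s)`_k w}.
  apply: ae_foralln => k; have [ks|ks] := ltnP k (size s); last by apply: nearW => w.
  by apply: filterS (ff' (nodes_in hx (ltnW ks))) => w fw _.
apply: filterS => w hw; rewrite /riemann_sum /RS; apply: eq_bigr => k _.
by rewrite /term /inc /= hw.
Qed.

Lemma stoch_lim_integral I I' : M2 P mea I' -> stoch_lim P B t f' I' ->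
  {ae P, forall w, I w = I' w} -> is_stoch_integral P B f t I.
Proof.
move=> MI lI II'; split; first exact: (L2_of MI II').
move=> e e0; have e2 : 0 < e / 2 by rewrite divr_gt0.
have [dl dl0 hd] := lI _ e2; exists dl => // s hs ms.
have hx := partition_nodes hs.
have MR := RS_M2 filtF ipP sepH wB hx hf'.
rewrite (@L2norm_ae _ _ _ P _ _ (fun w => RS B (fun k => (0 :: s)`_k) (size s) f' w - I' w)).
  rewrite (L2norm_nrm (M2m_B ipP sepH MR MI)) lte_fin.
  apply: le_lt_trans (hd _ _ hx _) _; first by move=> k /ms/ltW.
  by rewrite ltr_pdivrMr// ltr_pMr// ltr1n.
by apply: filterS2 (riemann_sum_ae hs) II' => w /= -> ->.
Qed.

(** Both candidates are close to the Riemann sum of one sufficiently fine partition, whose existence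
    is [fine_partition]. *)
Lemma integral_unique J I' : M2 P mea I' -> stoch_lim P B t f' I' ->
  is_stoch_integral P B f t J -> {ae P, forall w, J w = I' w}.
Proof.
move=> MI lI [/(L2P P J smea GM)[J' [MJ JJ']] hJ].
suff n0 : nrm P (fun w => J' w - I' w) = 0.
  apply: filterS2 JJ' (nrm0_ae (M2m_B ipP sepH MJ MI) n0) => w -> /eqP.
  by rewrite subr_eq0 => /eqP.
apply/eqP; rewrite eq_le nrm_ge0 andbT; apply/ler_addgt0Pr => e e0; rewrite add0r.
have e2 : 0 < e / 2 by rewrite divr_gt0.
have [d1 d10 h1] := lI _ e2; have [d2 d20 h2] := hJ _ e2.
have [||s hs ms] := @fine_partition t (Num.min d1 d2); rewrite ?lt_min ?d10//.
have hx := partition_nodes hs; have MR := RS_M2 filtF ipP sepH wB hx hf'.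
apply: le_trans (nrm_tri ipP sepH MJ MR MI) _; rewrite (splitr e) lerD//; last first.
  by apply: h1 => // k /ms/ltW/le_trans; apply; rewrite ge_min lexx.
have := h2 s hs; rewrite (@L2norm_ae _ _ _ P _ _ (fun w => RS B (fun k => (0 :: s)`_k) (size s) f' w - J' w)).
  rewrite (L2norm_nrm (M2m_B ipP sepH MR MJ)) nrmBC lte_fin => h; apply/ltW/h => k /ms.
  by rewrite lt_min => /andP[].
by apply: filterS2 (riemann_sum_ae hs) JJ' => w /= -> ->.
Qed.

End Integral.

Lemma series_intro (W : nat -> R -> Omega -> R) Phi t (I : nat -> Omega -> H) X (tl : nat -> R) :
  (forall i, is_stoch_integral P (W i) (Phi i) t (I i)) -> (forall i, M2 P mea (I i)) -> M2 P mea X ->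
  tl n @[n --> \oo] --> 0 -> (forall n, nrm P (fun w => \sum_(i < n) I i w - X w) ^+ 2 <= tl n) ->
  is_stoch_series P W Phi t X.
Proof.
move=> hI MI MX tl0 htl; split; first by apply: (L2_of MX); exact: nearW.
exists I; split => //.
have hn n : L2norm P (fun w => \sum_(i < n) I i w - X w) = (nrm P (fun w => \sum_(i < n) I i w - X w))%:E.
  by rewrite L2norm_nrm//; apply: (M2m_B ipP sepH) => //; exact: (M2m_sum ipP sepH).
under eq_fun do rewrite hn; apply: cvg_EFin; first exact: nearW.
apply/cvgr0Pnorm_le => e e0; have := tail_small P (H := H) tl0 e0; apply: filterS => n h.
by rewrite /= ger0_norm ?nrm_ge0//; exact: h (htl n).
Qed.

(** The series comes with its own versions of the integrals. These agree with [I i] almost surely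
    for all i at once, so the partial sums have the same L2 distances and the two limits
    coincide. *)
Lemma series_unique (W : nat -> R -> Omega -> R) Phi t (I : nat -> Omega -> H) X Y (tl : nat -> R) :
  (forall i J, is_stoch_integral P (W i) (Phi i) t J -> {ae P, forall w, J w = I i w}) ->
  (forall i, M2 P mea (I i)) -> M2 P mea X ->
  tl n @[n --> \oo] --> 0 -> (forall n, nrm P (fun w => \sum_(i < n) I i w - X w) ^+ 2 <= tl n) ->
  is_stoch_series P W Phi t Y -> {ae P, forall w, Y w = X w}.
Proof.
move=> uI MI MX tl0 htl [/(L2P P Y smea GM)[Y' [MY YY']] [J [hJ cJ]]].
suff n0 : nrm P (fun w => Y' w - X w) = 0.
  apply: filterS2 YY' (nrm0_ae (M2m_B ipP sepH MY MX) n0) => w -> /eqP.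
  by rewrite subr_eq0 => /eqP.
have aJ : {ae P, forall w, forall i : nat, J i w = I i w}.
  by apply: ae_foralln => i; exact: uI.
have MS n : M2 P mea (fun w => \sum_(i < n) I i w) by exact: (M2m_sum ipP sepH).
have hn n : L2norm P (fun w => \sum_(i < n) J i w - Y w) = (nrm P (fun w => \sum_(i < n) I i w - Y' w))%:E.
  rewrite -(L2norm_nrm (M2m_B ipP sepH (MS n) MY)); apply: L2norm_ae.
  apply: filterS2 aJ YY' => w hw ->; congr (_ - _); apply: eq_bigr => i _; exact: hw.
rewrite (eq_fun hn) in cJ.
have {}cJ : nrm P (fun w => \sum_(i < n) I i w - Y' w) @[n --> \oo] --> 0 by have /fine_cvgP[_] := cJ.
apply/eqP; rewrite eq_le nrm_ge0 andbT; apply/ler_addgt0Pr => e e0; rewrite add0r.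
have e2 : 0 < e / 2 by rewrite divr_gt0.
near \oo => n.
apply: le_trans (nrm_tri ipP sepH MY (MS n) MX) _; rewrite (splitr e) lerD//.
  rewrite nrmBC; apply: le_trans (ler_norm _) _; near: n.
  by move/cvgr0Pnorm_le: cJ; apply.
have : nrm P (fun w => \sum_(i < n) I i w - X w) ^+ 2 <= tl n by exact: htl.
move: (fun w => _) => V; move: V; near: n; exact: tail_small.
Unshelve. all: by end_near. Qed.

(** Tonelli exchanges the sum over i with the time integral in [PUC_space]. Passing to versions
    inside the expectation is legitimate without measurability of the original functions, by
    [ge0_integral_ae_eq]. *)
Lemma energy_summable T (Psi f : nat -> R -> Omega -> H) (p : nat -> seq R) : 0 < T ->
  PUC_space P F T Psi -> (forall i, regular P F T (p i) (f i)) ->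
  (forall i tau, 0 <= tau <= T -> {ae P, forall w, Psi i tau w = f i tau w}) ->
  cvgn (series (fun i => energy P T (f i))).
Proof.
move=> T0 [_ hfin] hr hae.
have en0 i : 0 <= energy P T (f i) by apply: Rintegral_ge0 => s _; exact: sqr_ge0.
apply: nneseries_lty_cvg => //.
pose J : set (measurableTypeR R) := `[0, T]%classic.
have mJ : measurable J by exact: measurable_itv.
have jq i := energy_integrable filtF ipP sepH T0 (hr i).
have -> : (\sum_(0 <= k <oo) (energy P T (f k))%:E =
    \int[@lebesgue_measure R]_(x in J) \sum_(0 <= k <oo) (nrm P (f k x) ^+ 2)%:E)%E.
  rewrite integral_nneseries//.
  - apply: eq_eseriesr => i _; rewrite /energy /Rintegral fineK//.
    exact: (integrable_fin_num mJ (jq i)).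
  - by move=> i; have /integrableP[] := jq i.
  - by move=> i x _; rewrite lee_fin sqr_ge0.
apply: le_lt_trans hfin; rewrite le_eqVlt; apply/orP; left; apply/eqP.
apply: eq_integral => tau; rewrite inE /J /= in_itv/= => tT.
apply: eq_eseriesr => i _; have [_ iX] := regular_mea filtF (hr i) tT.
rewrite nrm_sqE mean_EFin//; apply: ge0_integral_ae_eq.
- by move=> w; rewrite lee_fin sqr_ge0.
- by move=> w; rewrite lee_fin sqr_ge0.
- by apply: filterS (hae i tau tT) => w ->.
Qed.

End Bridge.

(** * The theorem *)

Section LinearOn.
Context {R : realType} {H : normedModType R} (D : set H) (A : H -> H).
Hypothesis linA : linear_on D A.

Lemma linear_on0 : D 0 /\ A 0 = 0.
Proof.
have [D0 L] := linA; split => //; have [_] := L 1 0 0 D0 D0.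
by rewrite !scale1r addr0 => h; apply: (addrI (A 0)); rewrite addr0 -h.
Qed.

Lemma linear_on_sum n (c : 'I_n -> R) (x y : 'I_n -> H) :
  (forall k, D (x k) /\ A (x k) = y k) ->
  D (\sum_(k < n) c k *: x k) /\ A (\sum_(k < n) c k *: x k) = \sum_(k < n) c k *: y k.
Proof.
move=> h; have [_ L] := linA.
apply: (big_ind2 (fun u v : H => D u /\ A u = v)); first exact: linear_on0.
  move=> u u' v v' [Du <-] [Dv <-].
  by have [h1 h2] := L 1 u v Du Dv; rewrite !scale1r in h1 h2.
move=> k _; have [Dx <-] := h k; have [D0 A0] := linear_on0.
by have [h1 h2] := L (c k) (x k) 0 Dx D0; rewrite A0 !addr0 in h1 h2.
Qed.

End LinearOn.

Section Convolution.
Context {d : measure_display} {Omega : measurableType d} {R : realType}.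
Variable P : probability Omega R.
Variables (F : R -> set (set Omega)) (filtF : filtration F).
Context {H : completeNormedModType R} (ip : H -> H -> R).
Hypotheses (ipP : inner_product ip) (sepH : separable H).
Variables (T : R) (T_gt0 : 0 < T).
Variables (U : R -> H -> H) (M : R) (M0 : 0 <= M).
Hypotheses (bU : forall t, 0 <= t -> bounded_operator (U t))
  (hM : forall t x, 0 <= t <= T -> `|U t x| <= M * `|x|).
Variables (B : R -> Omega -> R) (wB : wiener_process P F B).
Local Notation mea := (@measurable d Omega).
Local Notation smea := (@sigma_algebra_measurable d Omega).
Implicit Types (f g : R -> Omega -> H).

(** The integrand of the theorem without truncation. On [0, tau] it differs from [cv] at most at s =
    tau, a value that does not affect the integral. *)
Definition shifted f (tau s : R) (w : Omega) : H := U (tau - s) (f s w).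

Lemma shifted_adapted f tau : adapted P F T f -> tau <= T -> adapted P F tau (shifted f tau).
Proof.
move=> hf tT s /andP[s0 st]; have sG := filt_sigma filtF s0.
apply: (M2_op M0 bU hM sG (filt_sub filtF s0)).
  by rewrite subr_ge0 st/=; lra.
by apply: hf; rewrite s0 (le_trans st).
Qed.

Lemma shifted_lim f tau Y : tau <= T -> conv_value P T U f B tau Y ->
  stoch_lim P B tau (shifted f tau) Y.
Proof.
move=> tT [_ lY]; apply: (@stoch_lim_ext _ _ _ _ _ _ _ (cv U f tau)).
  by move=> s /andP[_ st]; apply/funext => w; rewrite /cv st.
by apply: stoch_lim_restrict lY => // s ts; apply/funext => w; rewrite /cv ltNge ts.
Qed.

Lemma conv_integral f g tau Y : adapted P F T f -> 0 <= tau <= T ->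
  (forall s, 0 <= s <= tau -> {ae P, forall w, g s w = shifted f tau s w}) ->
  conv_value P T U f B tau Y ->
  is_stoch_integral P B g tau Y /\
  forall J, is_stoch_integral P B g tau J -> {ae P, forall w, J w = Y w}.
Proof.
move=> hf /andP[t0 tT] hg hY; have [MY _] := hY.
have hs := shifted_adapted hf tT; have lY := shifted_lim tT hY.
split; first by apply: (stoch_lim_integral filtF ipP sepH wB hs hg MY lY); exact: nearW.
by move=> J; exact: (integral_unique filtF ipP sepH wB t0 hs hg MY lY).
Qed.

(** On a Riemann sum A acts termwise, by linearity and because it commutes with the family on D;
    [closed_L2] then passes to the limit. Only finitely many nodes are involved at each stage, so
    domain membership holds simultaneously at all of them. *)
Lemma conv_closed (D : set H) (A : H -> H) f g tau Y Z : linear_on D A -> closed_operator D A ->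
  (forall t x, 0 <= t -> D x -> D (U t x) /\ A (U t x) = U t (A x)) ->
  adapted P F T f -> adapted P F T g ->
  (forall s, 0 <= s <= T -> {ae P, forall w, D (f s w) /\ A (f s w) = g s w}) ->
  0 <= tau <= T -> conv_value P T U f B tau Y -> conv_value P T U g B tau Z ->
  {ae P, forall w, D (Y w) /\ A (Y w) = Z w}.
Proof.
move=> linA clA UA hf hg hD /andP[t0 tT] hY hZ; have [MY _] := hY; have [MZ _] := hZ.
have nn n := unif_nodes n t0.
apply: (closed_L2 ipP sepH clA
  (u := fun n => RS B (unif tau n) n.+1 (shifted f tau))
  (v := fun n => RS B (unif tau n) n.+1 (shifted g tau))) => //.
- by move=> n; exact: (RS_M2 filtF ipP sepH wB (nn n) (shifted_adapted hf tT)).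
- by move=> n; exact: (RS_M2 filtF ipP sepH wB (nn n) (shifted_adapted hg tT)).
- exact: stoch_lim_unif t0 (shifted_lim tT hY).
- exact: stoch_lim_unif t0 (shifted_lim tT hZ).
move=> n.
have : {ae P, forall w, forall k : nat, (k < n.+1)%N ->
    D (f (unif tau n k) w) /\ A (f (unif tau n k) w) = g (unif tau n k) w}.
  apply: ae_foralln => k; have [kn|kn] := ltnP k n.+1; last by apply: nearW => w.
  have /andP[k0 kt] := nodes_in (nn n) (ltnW kn).
  have kT : 0 <= unif tau n k <= T by rewrite k0 (le_trans kt).
  by apply: filterS (hD _ kT) => w hw _.
apply: filterS => w hw; apply: linear_on_sum => // k.
have [Df Af] := hw k (ltn_ord k).
have /andP[_ kt] := nodes_in (nn n) (ltnW (ltn_ord k)).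
have [|h1 h2] := UA (tau - unif tau n k) _ _ Df; first by rewrite subr_ge0.
by split=> //; rewrite /shifted h2 Af.
Qed.

Lemma sum_closed (D : set H) (A : H -> H) (Y Z : nat -> Omega -> H) Ys Zs (ty tz : nat -> R) :
  linear_on D A -> closed_operator D A ->
  (forall i, M2 P mea (Y i)) -> (forall i, M2 P mea (Z i)) -> M2 P mea Ys -> M2 P mea Zs ->
  ty n @[n --> \oo] --> 0 -> tz n @[n --> \oo] --> 0 ->
  (forall n, nrm P (fun w => \sum_(i < n) Y i w - Ys w) ^+ 2 <= ty n) ->
  (forall n, nrm P (fun w => \sum_(i < n) Z i w - Zs w) ^+ 2 <= tz n) ->
  (forall i, {ae P, forall w, D (Y i w) /\ A (Y i w) = Z i w}) ->
  {ae P, forall w, D (Ys w) /\ A (Ys w) = Zs w}.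
Proof.
move=> linA clA MY MZ MYs MZs ty0 tz0 hY hZ hD.
have conv (X : nat -> Omega -> H) Xs (tl : nat -> R) : tl n @[n --> \oo] --> 0 ->
    (forall n, nrm P (fun w => \sum_(i < n) X i w - Xs w) ^+ 2 <= tl n) ->
    nrm P (fun w => \sum_(i < n) X i w - Xs w) @[n --> \oo] --> 0.
  move=> tl0 h; apply/cvgr0Pnorm_le => e e0.
  apply: filterS (tail_small P (H := H) tl0 e0) => n hn.
  by rewrite ger0_norm ?nrm_ge0//; exact: hn (h n).
apply: (closed_L2 ipP sepH clA (u := fun n w => \sum_(i < n) Y i w)
  (v := fun n w => \sum_(i < n) Z i w)) => //.
- by move=> n; exact: (M2m_sum ipP sepH).
- by move=> n; exact: (M2m_sum ipP sepH).
- exact: conv ty0 hY.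
- exact: conv tz0 hZ.
move=> n; have : {ae P, forall w, forall i : nat, D (Y i w) /\ A (Y i w) = Z i w}.
  by apply: ae_foralln.
apply: filterS => w hw.
have := linear_on_sum linA (fun=> 1) (fun i : 'I_n => hw i).
by under eq_bigr do rewrite scale1r; under [in X in _ = X]eq_bigr do rewrite scale1r.
Qed.

(** The energy bound carries the length of the interval as a factor, and here that length is 0. *)
Lemma conv_at0 f Y : 0 <= T -> adapted P F T f -> conv_value P T U f B 0 Y -> nrm P Y = 0.
Proof.
move=> T0 hf hY; have [MY _] := hY; apply/eqP; rewrite -sqrf_eq0 eq_le sqr_ge0 andbT.
have h := stoch_lim_bound filtF ipP sepH wB (lexx 0) (shifted_adapted hf T0) MY (shifted_lim T0 hY).
have := h (nrm P (shifted f 0 0)); rewrite mul0r; apply => s.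
by rewrite -eq_le => /eqP <-.
Qed.

Lemma sum_at0 (Y : nat -> Omega -> H) Ys (ty : nat -> R) :
  (forall i, M2 P mea (Y i)) -> M2 P mea Ys -> ty n @[n --> \oo] --> 0 ->
  (forall n, nrm P (fun w => \sum_(i < n) Y i w - Ys w) ^+ 2 <= ty n) ->
  (forall i, nrm P (Y i) = 0) -> {ae P, forall w, Ys w = 0}.
Proof.
move=> MY MYs ty0 hY h0; apply: nrm0_ae => //.
apply/eqP; rewrite eq_le nrm_ge0 andbT; apply/ler_addgt0Pr => e e0; rewrite add0r.
have [n _ /(_ n (leqnn n)) hn] := tail_small P (H := H) ty0 e0.
have MS : M2 P mea (fun w => \sum_(i < n) Y i w) by exact: (M2m_sum ipP sepH).
apply: le_trans (nrm_le_shift ipP sepH MYs MS) _.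
rewrite nrmBC; have -> : nrm P (fun w => \sum_(i < n) Y i w) = 0.
  apply/eqP; rewrite eq_le nrm_ge0 andbT; apply: le_trans (nrm_sum_le ipP sepH _ _) _ => //.
  by rewrite big1.
by rewrite add0r; exact: hn (hY n).
Qed.

End Convolution.

Theorem theorem5
  (R : realType) (H : completeNormedModType R)
  (hilbertH : hilbert_space H) (separableH : separable H)
  (d : measure_display) (Omega : measurableType d) (P : probability Omega R)
  (F : R -> set (set Omega)) (filtF : filtration F)
  (T : R) (T_gt0 : 0 < T)
  (W : nat -> R -> Omega -> R)
  (wienerW : forall i, wiener_process P F (W i))
  (indepW : independent_processes P W)
  (D : set H) (A : H -> H)
  (linA : linear_on D A) (closedA : closed_operator D A)
  (unbA : unbounded_operator D A) (denseD : dense D)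
  (a : R -> R) (a_L1 : L1_loc a)
  (hAa : (generates_C0_semigroup D A /\ completely_positive a) \/
         (generates_cosine_family D A /\
          [\/ completely_positive a, creep_log_convex a
            | square_of_completely_positive a]))
  (S : R -> H -> H) (resS : resolvent D A a S)
  (Psi : nat -> R -> Omega -> H)
  (PsiPUC : PUC_space P F T Psi)
  (APsiPUC : PUC_space P F T (fun i t w => A (Psi i t w)))
  (PsiD : forall i t, 0 <= t <= T -> {ae P, forall w, D (Psi i t w)}) :
  (exists WPsi, is_stoch_convolution P W S Psi T WPsi) /\
  forall WPsi, is_stoch_convolution P W S Psi T WPsi ->
    (forall tau, 0 <= tau <= T -> {ae P, forall w, D (WPsi tau w)}) /\
    forall t, 0 <= t <= T ->
      exists conv_AW stoch_Psi : Omega -> H,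
        [/\ bochner_L2 P `[0, t]
              (fun tau w => a (t - tau) *: A (WPsi tau w)) conv_AW,
            is_stoch_series P W Psi t stoch_Psi
          & {ae P, forall w, WPsi t w = conv_AW w + stoch_Psi w}].
Proof.
have [ip ipP] : exists ip : H -> H -> R, inner_product ip by [].
have sepH := separableH; have T0 := ltW T_gt0.
have [bS [cS S0] SA _] := resS.
have [M M0 hM] := op_bounded T bS cS.
have smea := @sigma_algebra_measurable d Omega.
have bI := @id_bounded R H; have cI := @id_cont R H; have hI := @id_le R H T.
(* Extending the kernel by 0 outside [0, T] makes it integrable on the whole line, so that it can be
   reflected without tracking domains. *)
pose a0 := a \_ `[0, T].
have a0E tau : 0 <= tau <= T -> a0 tau = a tau.
  by move=> tT; rewrite /a0 patchE mem_set//= in_itv.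
have ia0 : (@lebesgue_measure R).-integrable setT (EFin \o a0).
  have mT : measurable (`[0, T]%classic : set (measurableTypeR R)) by exact: measurable_itv.
  by rewrite /a0 -restrict_EFin; apply/(integrable_mkcond _ mT); exact: a_L1.
(* For each i the exceptional times of [Psi i] and of its image under A are joined, so that both
   versions are regular with the same list. *)
have /choice[pp hpp] : forall i, exists q : seq R * ((R -> Omega -> H) * (R -> Omega -> H)),
    [/\ regular P F T q.1 q.2.1, regular P F T q.1 q.2.2,
      forall tau, 0 <= tau <= T -> {ae P, forall w, Psi i tau w = q.2.1 tau w}
    & forall tau, 0 <= tau <= T -> {ae P, forall w, A (Psi i tau w) = q.2.2 tau w}].
  move=> i; have [PUC1 _] := PsiPUC; have [PUC2 _] := APsiPUC.
  have [f [p1 [r1 e1]]] := puc_version filtF ipP sepH (PUC1 i).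
  have [g [p2 [r2 e2]]] := puc_version filtF ipP sepH (PUC2 i).
  exists (p1 ++ p2, (f, g)); split => //=.
    by apply: regular_sub r1 => c cp; rewrite mem_cat cp.
  by apply: regular_sub r2 => c cp; rewrite mem_cat cp orbT.
pose p i := (pp i).1; pose psi i := (pp i).2.1; pose phi i := (pp i).2.2.
have rpsi i : regular P F T (p i) (psi i) by case: (hpp i).
have rphi i : regular P F T (p i) (phi i) by case: (hpp i).
have epsi i tau : 0 <= tau <= T -> {ae P, forall w, Psi i tau w = psi i tau w}.
  by case: (hpp i) => _ _ h _; exact: h.
have ephi i tau : 0 <= tau <= T -> {ae P, forall w, A (Psi i tau w) = phi i tau w}.
  by case: (hpp i) => _ _ _; exact.
have apsi i : adapted P F T (psi i) by case: (rpsi i).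
have aphi i : adapted P F T (phi i) by case: (rphi i).
have Dpsi i tau : 0 <= tau <= T -> {ae P, forall w, D (psi i tau w) /\ A (psi i tau w) = phi i tau w}.
  by move=> tT; apply: filterS3 (PsiD i tau tT) (epsi i tau tT) (ephi i tau tT) => w + <- <-.
have spsi := energy_summable filtF ipP sepH T_gt0 PsiPUC rpsi epsi.
have sphi := energy_summable filtF ipP sepH T_gt0 APsiPUC rphi ephi.
have [X [Xs [tx [hX MXs tx0 htx _]]]] :=
  conv_process filtF wienerW indepW ipP sepH T_gt0 M0 bS cS hM rpsi spsi.
have [Z [Zs [tz [hZ MZs tz0 htz cZ]]]] :=
  conv_process filtF wienerW indepW ipP sepH T_gt0 M0 bS cS hM rphi sphi.
have [I [Is [ti [hI' MIs ti0 hti _]]]] :=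
  conv_process filtF wienerW indepW ipP sepH T_gt0 ler01 bI cI hI rpsi spsi.
have MX i tau : 0 <= tau <= T -> M2 P measurable (X i tau) by move=> tT; case: (hX i tau tT).
have MZ i tau : 0 <= tau <= T -> M2 P measurable (Z i tau) by move=> tT; case: (hZ i tau tT).
have MI i tau : 0 <= tau <= T -> M2 P measurable (I i tau) by move=> tT; case: (hI' i tau tT).
have intX i tau : 0 <= tau <= T ->
    is_stoch_integral P (W i) (fun s w => S (tau - s) (Psi i s w)) tau (X i tau) /\
    forall J, is_stoch_integral P (W i) (fun s w => S (tau - s) (Psi i s w)) tau J ->
      {ae P, forall w, J w = X i tau w}.
  move=> tT; apply: (conv_integral filtF ipP sepH M0 bS hM (wienerW i) (apsi i) tT _ (hX i tau tT)).
  move=> s /andP[s0 st]; have sT : 0 <= s <= T by case/andP: tT => _; rewrite s0; exact: le_trans.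
  by apply: filterS (epsi i s sT) => w ->.
have intI i tau : 0 <= tau <= T -> is_stoch_integral P (W i) (Psi i) tau (I i tau).
  move=> tT; have [] := conv_integral filtF ipP sepH ler01 bI hI (wienerW i) (apsi i) (g := Psi i)
    tT _ (hI' i tau tT).
    move=> s /andP[s0 st]; have sT : 0 <= s <= T by case/andP: tT => _; rewrite s0; exact: le_trans.
    exact: epsi i s sT.
  by [].
have serX tau : 0 <= tau <= T ->
    is_stoch_series P W (fun i s w => S (tau - s) (Psi i s w)) tau (Xs tau).
  move=> tT; apply: (series_intro ipP sepH (I := fun i => X i tau) (tl := tx)) => //.
  - by move=> i; case: (intX i tau tT).
  - by move=> i; exact: MX.
  - exact: MXs.
  - by move=> n; exact: htx.
have DX tau : 0 <= tau <= T -> {ae P, forall w, D (Xs tau w) /\ A (Xs tau w) = Zs tau w}.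
  move=> tT; apply: (sum_closed ipP sepH (Y := fun i => X i tau) (Z := fun i => Z i tau) linA closedA
    (fun i => MX i tau tT) (fun i => MZ i tau tT) (MXs tau tT) (MZs tau tT) tx0 tz0
    (fun n => htx n tau tT) (fun n => htz n tau tT)) => i.
  exact: (conv_closed filtF ipP sepH M0 bS hM (wienerW i) linA closedA SA (apsi i) (aphi i) (Dpsi i)
    tT (hX i tau tT) (hZ i tau tT)).
split; first by exists Xs.
move=> WPsi hW.
have WX tau : 0 <= tau <= T -> {ae P, forall w, WPsi tau w = Xs tau w}.
  move=> tT; apply: (series_unique ipP sepH (I := fun i => X i tau) (tl := tx) _ _ (MXs tau tT) tx0
    (fun n => htx n tau tT) (hW tau tT)) => i; last exact: MX.
  by case: (intX i tau tT).
have WD tau : 0 <= tau <= T -> {ae P, forall w, D (WPsi tau w) /\ A (WPsi tau w) = Zs tau w}.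
  by move=> tT; apply: filterS2 (WX tau tT) (DX tau tT) => w ->.
split=> [tau tT|t tT]; first by apply: filterS (WD tau tT) => w [].
(* With this witness the equation is immediate; the content lies in showing that the difference is
   the Bochner integral. *)
exists (fun w => Xs t w - Is t w), (Is t); split; last first.
- by apply: filterS (WX t tT) => w ->; rewrite subrK.
- apply: (series_intro ipP sepH (I := fun i => I i t) (tl := ti)) => //.
  + by move=> i; exact: intI.
  + by move=> i; exact: MI.
  + exact: MIs.
  + by move=> n; exact: hti.
have /andP[t0 tT'] := tT.
have fE tau : 0 <= tau <= t ->
    {ae P, forall w, a (t - tau) *: A (WPsi tau w) = a0 (t - tau) *: Zs tau w}.
  move=> /andP[tau0 taut]; have tauT : 0 <= tau <= T by rewrite tau0 (le_trans taut).
  by apply: filterS (WD tau tauT) => w [_ ->]; rewrite a0E// subr_ge0 taut/=; lra.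
(* For t = 0 the grid has step 0 and no cells; there both stochastic integrals vanish almost
   surely. *)
move: t0; rewrite le_eqVlt => /predU1P[t0|t0].
  have z0 : 0 <= (0 : R) <= T by rewrite lexx.
  rewrite -t0 in fE tT tT' *; apply: (bochner_null ipP sepH).
    move=> tau tau0; have tauT : 0 <= tau <= T.
      by move: tau0; rewrite -eq_le => /eqP <-.
    by apply: (L2_of (M2Z ipP sepH smea (a0 (0 - tau)) (MZs tau tauT))); exact: fE.
  have x0 : {ae P, forall w, Xs 0 w = 0}.
    apply: (sum_at0 ipP sepH (fun i => MX i 0 z0) (MXs 0 z0) tx0 (fun n => htx n 0 z0)) => i.
    exact: (conv_at0 filtF ipP sepH M0 bS hM (wienerW i) T0 (apsi i) (hX i 0 z0)).
  have i0 : {ae P, forall w, Is 0 w = 0}.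
    apply: (sum_at0 ipP sepH (fun i => MI i 0 z0) (MIs 0 z0) ti0 (fun n => hti n 0 z0)) => i.
    exact: (conv_at0 filtF ipP sepH ler01 bI hI (wienerW i) T0 (apsi i) (hI' i 0 z0)).
  by apply: filterS2 x0 i0 => w -> ->; rewrite subrr.
apply: (bochner_assembly ipP sepH T_gt0 MZs cZ ia0 t0 tT' _ fE).
  by apply: (M2m_B ipP sepH); [exact: MXs|exact: MIs].
apply: (series_limit ipP sepH (X := fun i => X i t) (I := fun i => I i t) (Z := Z)
  t0 tT' ia0 _ _ (MXs t tT) (MIs t tT) MZ MZs tx0 ti0 tz0) => //.
- by move=> i; exact: MX.
- by move=> i; exact: MI.
- by move=> n; exact: htx.
- by move=> n; exact: hti.
move=> i; exact: (main_one filtF wienerW ipP sepH T_gt0 resS M0 hM a0E ia0 (rpsi i) (rphi i) (Dpsi i)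
  t0 tT' (hX i t tT) (hI' i t tT) (hZ i)).
Qed.
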